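(* As a $(\mathfrak{gl}_{>0},\mathfrak{gl}_{>0})$-bicrystal, $$\mathbf{B}(\widetilde{U}_q(\mathfrak{gl}_{>0}))\simeq\bigsqcup_{\mu,\nu\in\mathscr{P}}\mathcal{B}_{\mu,\nu}\times\mathcal{B}_{\mu,\nu},$$ where the bicrystal structure on the left is the one carried over from $\widetilde{\mathcal{M}}$ through the $\mathfrak{gl}_{>0}$-crystal isomorphism $\mathbf{B}(\widetilde{U}_q(\mathfrak{gl}_{>0}))\simeq\widetilde{\mathcal{M}}$, and on the right the first $\mathfrak{gl}_{>0}$-crystal structure acts on the first factor and the second one on the second factor.
   Context: Crystals. $\mathfrak{gl}_{>0}$ is the Lie algebra of complex matrices $(a_{ij})_{i,j\geq 1}$ with finitely many nonzero entries; its integral weight lattice is $\mathcal{P}=\bigoplus_{i\ge1}\mathbb{Z}\epsilon_i$, with simple roots $\alpha_i=\epsilon_i-\epsilon_{i+1}$ and simple coroots $h_i=E_{ii}-E_{i+1,i+1}$ ($i\geq1$). Crystals are in Kashiwara's usual sense. Tensor product convention: $\widetilde e_i(b_1\otimes b_2)=\widetilde e_ib_1\otimes b_2$ if $\varphi_i(b_1)\ge\varepsilon_i(b_2)$ and $b_1\otimes\widetilde e_ib_2$ otherwise; $\widetilde f_i(b_1\otimes b_2)=\widetilde f_ib_1\otimes b_2$ if $\varphi_i(b_1)>\varepsilon_i(b_2)$ and $b_1\otimes\widetilde f_ib_2$ otherwise; weights add. The dual crystal $B^\vee=\{b^\vee\mid b\in B\}$ has ${\rm wt}(b^\vee)=-{\rm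 wt}(b)$, $\varepsilon_i(b^\vee)=\varphi_i(b)$, $\varphi_i(b^\vee)=\varepsilon_i(b)$, $\widetilde e_i(b^\vee)=(\widetilde f_ib)^\vee$, $\widetilde f_i(b^\vee)=(\widetilde e_ib)^\vee$. A $(\mathfrak{gl}_{>0},\mathfrak{gl}_{>0})$-bicrystal is a set with two $\mathfrak{gl}_{>0}$-crystal structures whose operators commute with each other. $\mathbf{B}(\widetilde U_q(\mathfrak{gl}_{>0}))=\bigsqcup_{\omega\in\mathcal{P}}\mathbf{B}(\infty)\otimes T_\omega\otimes\mathbf{B}(-\infty)$ is the crystal of the modified quantized enveloping algebra, where $\mathbf{B}(\pm\infty)$ is the crystal base of the negative (resp. positive) part of $U_q(\mathfrak{gl}_{>0})$ and $T_\omega=\{t_\omega\}$ with ${\rm wt}(t_\omega)=\omega$, $\varepsilon_i(t_\omega)=\varphi_i(t_\omega)=-\infty$, $\widetilde e_it_\omega=\widetilde f_it_\omega=\mathbf 0$. Tableaux. $\mathscr{P}$ is the set of partitions, identified with Young diagrams; $\ell(\mu)$ is the number of nonzero parts and $\mu'$ the conjugate of $\mu$. $\mathcal{B}_\mu=SST_{\mathbb{N}}(\mu)$ is the set of semistandard tableaux (rows weakly, columns strictly increasing) of shape $\mu$ with entries in $\mathbb{N}=\{1,2,\dots\}$. It is a $\mathfrak{gl}_{>0}$-crystal: a tableau is identified with the tensor product of its entries read column by column from right to left, each column from top to bottom, where $\mathbb{N}$ is the natural crystal (${\rm wt}(j)=\epsilon_j$, $\widetilde f_jj=j+1$). $H_\mu\in\mathcal{B}_\mu$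 is the highest weight element, $H_\mu(i,j)=i$. For $s\ge\ell(\nu)$, $E_\nu(s)\in\mathcal{B}_\nu^\vee$ is defined by $(E_\nu(s))^\vee(i,j)=s-\nu'_j+i$ (with $(T^\vee)^\vee=T$). $\mathcal{B}_{\mu,\nu}$ is the connected component of $\mathcal{B}_\mu\otimes\mathcal{B}_\nu^\vee$ containing $H_\mu\otimes E_\nu(s)$ for $s\geq\ell(\mu)+\ell(\nu)$; it does not depend on $s$, and is an extremal weight $\mathfrak{gl}_{>0}$-crystal. Matrices. $\mathcal{M}$ is the set of $\mathbb{N}\times\mathbb{N}$ matrices $A=(a_{ij})_{i,j\ge1}$ with $a_{ij}\in\mathbb{Z}_{\ge0}$ and $\sum a_{ij}<\infty$. The $i$-th row $A_i$ is identified with the one-row semistandard tableau having $a_{ij}$ entries equal to $j$, and $A$ with $A_1\otimes A_2\otimes\cdots$ (finitely many nonempty factors); this gives a $\mathfrak{gl}_{>0}$-crystal structure on $\mathcal{M}$ with operators $\widetilde e_i,\widetilde f_i$. A second $\mathfrak{gl}_{>0}$-crystal structure is given by $\widetilde e_i^tA=(\widetilde e_iA^t)^t$, $\widetilde f_i^tA=(\widetilde f_iA^t)^t$, ${\rm wt}^t(A)={\rm wt}(A^t)$, where $A^t$ is the transpose. These commute, so $\mathcal{M}$ is a bicrystal, and $\widetilde{\mathcal{M}}=\mathcal{M}^\vee\times\mathcal{M}$ is a bicrystal by taking the tensor product $\mathcal{M}^\vee\otimes\mathcal{M}$ with respect to each of the two structures. There is an isomorphism $\mathbf{B}(\widetilde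 U_q(\mathfrak{gl}_{>0}))\simeq\widetilde{\mathcal{M}}$ of $\mathfrak{gl}_{>0}$-crystals with respect to the first structure $(\widetilde e_i,\widetilde f_i)$. *)

(* Defs.v *)
From mathcomp Require Import all_boot all_order all_algebra.
From mathcomp Require Import finmap.
From mathcomp Require Import boolp classical_sets.
From mathcomp Require Import monalg.

Set Implicit Arguments.
Unset Strict Implicit.
Unset Printing Implicit Defensive.

Import Order.TTheory GRing.Theory Num.Theory.
Local Open Scope ring_scope.

(* All indices are shifted by one: the natural number k stands for the positive
   integer k + 1, whether as an index of a simple root, a letter of a tableau,
   or a row or column number. *)

Notation weight := {malg int[nat]}.

Definition epsw (k : nat) : weight := << k >>.

(* The coweight lattice, free on the E_kk, is also represented by [weight]. *)
Definition pairing (h la : weight) : int := \sum_(k <- msupp h) h@_k * la@_k.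

Definition alpha (i : nat) : weight := epsw i - epsw i.+1.
Definition coroot (i : nat) : weight := epsw i - epsw i.+1.

(* Integers with -oo, represented by [None] *)
Definition zinf := option int.

Definition lez (x y : zinf) : bool :=
  match x, y with
  | None, _ => true
  | Some _, None => false
  | Some a, Some b => a <= b
  end.
Definition ltz (x y : zinf) : bool := ~~ lez y x.
Definition maxz (x y : zinf) : zinf := if lez x y then y else x.
Definition addz (x : zinf) (n : int) : zinf := omap (fun a => a + n) x.

(* The structure maps of a crystal with underlying set [T]; [None] is the
   symbol 0 in the codomain of the operators.  The axioms are in [is_crystal]. *)
Record crystal (T : Type) := Crystal {
  wt : T -> weight;
  veps : nat -> T -> zinf;
  vphi : nat -> T -> zinf;
  ke : nat -> T -> option T;
  kf : nat -> T -> option T }.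

Record is_crystal (T : Type) (C : crystal T) : Prop := IsCrystal {
  crystal_phi : forall i b,
    vphi C i b = addz (veps C i b) (pairing (coroot i) (wt C b));
  crystal_e : forall i b b', ke C i b = Some b' ->
    [/\ wt C b' = wt C b + alpha i, veps C i b' = addz (veps C i b) (- 1)
      & vphi C i b' = addz (vphi C i b) 1];
  crystal_f : forall i b b', kf C i b = Some b' ->
    [/\ wt C b' = wt C b - alpha i, veps C i b' = addz (veps C i b) 1
      & vphi C i b' = addz (vphi C i b) (- 1)];
  crystal_ef : forall i b b', kf C i b = Some b' <-> ke C i b' = Some b;
  crystal_ninf : forall i b, vphi C i b = None ->
    ke C i b = None /\ kf C i b = None }.

Record crystal_iso (T T' : Type) (C : crystal T) (C' : crystal T')
    (f : T -> T') : Prop := CrystalIso {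
  iso_bij : bijective f;
  iso_wt : forall b, wt C' (f b) = wt C b;
  iso_eps : forall i b, veps C' i (f b) = veps C i b;
  iso_phi : forall i b, vphi C' i (f b) = vphi C i b;
  iso_e : forall i b, ke C' i (f b) = omap f (ke C i b);
  iso_f : forall i b, kf C' i (f b) = omap f (kf C i b) }.

Definition commuting (T : Type) (o o' : T -> option T) : Prop :=
  forall b, obind o (o' b) = obind o' (o b).

Record is_bicrystal (T : Type) (C D : crystal T) : Prop := IsBicrystal {
  bicrystal_l : is_crystal C;
  bicrystal_r : is_crystal D;
  bicrystal_ee : forall i j, commuting (ke C i) (ke D j);
  bicrystal_ef : forall i j, commuting (ke C i) (kf D j);
  bicrystal_fe : forall i j, commuting (kf C i) (ke D j);
  bicrystal_ff : forall i j, commuting (kf C i) (kf D j) }.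

Definition bicrystal_iso (T T' : Type) (C D : crystal T) (C' D' : crystal T')
    (f : T -> T') : Prop :=
  crystal_iso C C' f /\ crystal_iso D D' f.

Definition some_such (T : Type) (P : T -> Prop) : option T :=
  match pselect (exists x, P x) with
  | left h => Some (projT1 (cid h))
  | right _ => None
  end.

(* The structure on [S] for which [iota], assumed injective, identifies [S]
   with a part of [T] stable under the operators of [C]. *)
Definition pullback (S T : Type) (iota : S -> T) (C : crystal T) : crystal S :=
  {| wt b := wt C (iota b);
     veps i b := veps C i (iota b);
     vphi i b := vphi C i (iota b);
     ke i b := some_such (fun b' => ke C i (iota b) = Some (iota b'));
     kf i b := some_such (fun b' => kf C i (iota b) = Some (iota b')) |}.

(* The element b^vee of the dual crystal is represented by b. *)
Definition dual (T : Type) (C : crystal T) : crystal T :=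
  {| wt b := - wt C b;
     veps := vphi C;
     vphi := veps C;
     ke := kf C;
     kf := ke C |}.

(* epsilon_i and phi_i of b1 (x) b2, given the weights and the values of
   epsilon_i or phi_i of the two factors *)
Definition tens_eps (i : nat) (w1 : weight) (e1 e2 : zinf) : zinf :=
  maxz e1 (addz e2 (- pairing (coroot i) w1)).
Definition tens_phi (i : nat) (w2 : weight) (p1 p2 : zinf) : zinf :=
  maxz (addz p1 (pairing (coroot i) w2)) p2.

Definition tensor (T1 T2 : Type) (C1 : crystal T1) (C2 : crystal T2) :
    crystal (T1 * T2) :=
  {| wt b := wt C1 b.1 + wt C2 b.2;
     veps i b := tens_eps i (wt C1 b.1) (veps C1 i b.1) (veps C2 i b.2);
     vphi i b := tens_phi i (wt C2 b.2) (vphi C1 i b.1) (vphi C2 i b.2);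
     ke i b := if lez (veps C2 i b.2) (vphi C1 i b.1)
               then omap (fun c => (c, b.2)) (ke C1 i b.1)
               else omap (fun c => (b.1, c)) (ke C2 i b.2);
     kf i b := if ltz (veps C2 i b.2) (vphi C1 i b.1)
               then omap (fun c => (c, b.2)) (kf C1 i b.1)
               else omap (fun c => (b.1, c)) (kf C2 i b.2) |}.

(* The crystal of all finite tensor products of elements of [C]: the sequence
   [:: b1; ...; br] is b1 (x) (b2 (x) (... (x) br)), and [::] is the element of
   the trivial crystal. *)
Section SeqCrystal.
Variables (T : Type) (C : crystal T).

Definition seq_wt (w : seq T) : weight := \sum_(b <- w) wt C b.

Fixpoint seq_eps (i : nat) (w : seq T) : zinf :=
  if w is b :: w' then tens_eps i (wt C b) (veps C i b) (seq_eps i w')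
  else Some 0.

Fixpoint seq_phi (i : nat) (w : seq T) : zinf :=
  if w is b :: w' then tens_phi i (seq_wt w') (vphi C i b) (seq_phi i w')
  else Some 0.

Fixpoint seq_e (i : nat) (w : seq T) : option (seq T) :=
  if w is b :: w' then
    if lez (seq_eps i w') (vphi C i b)
    then omap (fun c => c :: w') (ke C i b)
    else omap (fun v => b :: v) (seq_e i w')
  else None.

Fixpoint seq_f (i : nat) (w : seq T) : option (seq T) :=
  if w is b :: w' then
    if ltz (seq_eps i w') (vphi C i b)
    then omap (fun c => c :: w') (kf C i b)
    else omap (fun v => b :: v) (seq_f i w')
  else None.

Definition seq_crystal : crystal (seq T) :=
  {| wt := seq_wt; veps := seq_eps; vphi := seq_phi; ke := seq_e; kf := seq_f |}.

End SeqCrystal.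

Definition crystal_sum (I : Type) (T : I -> Type)
    (C : forall k, crystal (T k)) : crystal {k : I & T k} :=
  {| wt b := wt (C (projT1 b)) (projT2 b);
     veps i b := veps (C (projT1 b)) i (projT2 b);
     vphi i b := vphi (C (projT1 b)) i (projT2 b);
     ke i b := omap (existT T (projT1 b)) (ke (C (projT1 b)) i (projT2 b));
     kf i b := omap (existT T (projT1 b)) (kf (C (projT1 b)) i (projT2 b)) |}.

Definition act_fst (T1 T2 : Type) (C : crystal T1) : crystal (T1 * T2) :=
  {| wt b := wt C b.1;
     veps i b := veps C i b.1;
     vphi i b := vphi C i b.1;
     ke i b := omap (fun c => (c, b.2)) (ke C i b.1);
     kf i b := omap (fun c => (c, b.2)) (kf C i b.1) |}.

Definition act_snd (T1 T2 : Type) (C : crystal T2) : crystal (T1 * T2) :=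
  {| wt b := wt C b.2;
     veps i b := veps C i b.2;
     vphi i b := vphi C i b.2;
     ke i b := omap (fun c => (b.1, c)) (ke C i b.2);
     kf i b := omap (fun c => (b.1, c)) (kf C i b.2) |}.

Inductive connected (T : Type) (C : crystal T) (b0 : T) : T -> Prop :=
| connected_refl : connected C b0 b0
| connected_e i b b' :
    connected C b0 b -> ke C i b = Some b' -> connected C b0 b'
| connected_f i b b' :
    connected C b0 b -> kf C i b = Some b' -> connected C b0 b'.

Definition component (T : Type) (C : crystal T) (b0 : T) : Type :=
  {b : T | connected C b0 b}.

Definition component_crystal (T : Type) (C : crystal T) (b0 : T) :
    crystal (component C b0) :=
  pullback (fun b => proj1_sig b) C.

Definition natural : crystal nat :=
  {| wt k := epsw k;
     veps i k := Some (k == i.+1)%:Z;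
     vphi i k := Some (k == i)%:Z;
     ke i k := if k == i.+1 then Some i else None;
     kf i k := if k == i then Some i.+1 else None |}.

Definition partition : Type := {mu : seq nat | sorted geq mu && (0%N \notin mu)}.

Definition plength (mu : partition) : nat := size (val mu).

Definition conj_part (mu : partition) (j : nat) : nat :=
  count (fun m => (j < m)%N) (val mu).

(* A tableau is the sequence of its rows, from top to bottom. *)
Definition below (r r' : seq nat) : bool :=
  all (fun j => (nth 0 r j < nth 0 r' j)%N) (iota 0 (size r')).

Definition is_sst (mu : partition) (t : seq (seq nat)) : bool :=
  [&& shape t == val mu, all (sorted leq) t & sorted below t].

Definition SST (mu : partition) : Type := {t : seq (seq nat) | is_sst mu t}.

Definition column (t : seq (seq nat)) (j : nat) : seq nat :=
  [seq nth 0%N r j | r <- t & (j < size r)%N].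

Definition reading (t : seq (seq nat)) : seq nat :=
  flatten [seq column t j | j <- rev (iota 0 (size (head [::] t)))].

Definition sst_crystal (mu : partition) : crystal (SST mu) :=
  pullback (fun t => reading (val t)) (seq_crystal natural).

Lemma nth_part_geq (mu : partition) (i i' : nat) :
  (i <= i')%N -> (nth 0 (val mu) i' <= nth 0 (val mu) i)%N.
Proof.
case: mu => mu /= /andP[smu _] le_i.
have [lt_i'|] := ltnP i' (size mu); last by move/(nth_default 0%N) ->.
have geq_trans : transitive geq by move=> a b c /= h1 h2; exact: leq_trans h2 h1.
have geq_refl : reflexive geq by move=> a; exact: leqnn.
apply: (sorted_leq_nth geq_trans geq_refl) => //.
by rewrite inE; exact: leq_ltn_trans lt_i'.
Qed.

Section FillTableau.
Variables (mu : partition) (F : nat -> nat -> nat).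

Definition fill : seq (seq nat) :=
  mkseq (fun i => mkseq (F i) (nth 0 (val mu) i)) (plength mu).

Lemma fill_sst : (forall i, {homo F i : j j' / (j <= j')%N}) ->
  (forall i j, (F i j < F i.+1 j)%N) -> is_sst mu fill.
Proof.
move=> Fhomo Flt; apply/and3P; split.
- apply/eqP/(@eq_from_nth _ 0%N); first by rewrite size_map size_mkseq.
  move=> i; rewrite size_map size_mkseq => lt_i.
  by rewrite (nth_map [::]) ?size_mkseq // nth_mkseq // size_mkseq.
- apply/allP => r /mapP[i _ ->].
  apply: (homo_sorted (Fhomo i)); exact: iota_sorted.
- apply/(sortedP [::]) => i; rewrite size_mkseq => lt_i.
  rewrite !nth_mkseq ?(ltnW lt_i) //; apply/allP => j.
  rewrite mem_iota add0n size_mkseq /= => lt_j.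
  rewrite !nth_mkseq //; apply: leq_trans lt_j _; exact: nth_part_geq.
Qed.

End FillTableau.

Definition highest (mu : partition) : SST mu :=
  exist _ (fill mu (fun i _ => i))
    (fill_sst mu (fun i j j' _ => leqnn i) (fun i _ => ltnSn i)).

Definition lowest_entry (nu : partition) (s i j : nat) : nat :=
  (s - conj_part nu j + i)%N.

Lemma lowest_entry_homo nu s i :
  {homo lowest_entry nu s i : j j' / (j <= j')%N}.
Proof.
move=> j j' le_j; rewrite leq_add2r leq_sub2l //.
by apply: sub_count => m /= lt_m; exact: leq_ltn_trans lt_m.
Qed.

Lemma lowest_entry_lt nu s i j :
  (lowest_entry nu s i j < lowest_entry nu s i.+1 j)%N.
Proof. by rewrite /lowest_entry addnS. Qed.

(* E_nu(s), to be seen in the dual crystal of SST nu *)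
Definition lowest (nu : partition) (s : nat) : SST nu :=
  exist _ (fill nu (lowest_entry nu s))
    (fill_sst nu (lowest_entry_homo nu s) (lowest_entry_lt nu s)).

Definition B2_tensor (mu nu : partition) : crystal (SST mu * SST nu) :=
  tensor (sst_crystal mu) (dual (sst_crystal nu)).

(* The component does not depend on s >= plength mu + plength nu; the smallest
   such s is used. *)
Definition B2_base (mu nu : partition) : SST mu * SST nu :=
  (highest mu, lowest nu (plength mu + plength nu)).

Definition B2 (mu nu : partition) : Type :=
  component (B2_tensor mu nu) (B2_base mu nu).

Definition B2_crystal (mu nu : partition) : crystal (B2 mu nu) :=
  component_crystal (B2_tensor mu nu) (B2_base mu nu).

Definition Mat : Type := {fsfun nat * nat -> nat with 0%N}.

Definition tr_mat (A : Mat) : Mat :=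
  [fsfun ij in [fset (kl.2, kl.1) | kl in finsupp A]%fset => A (ij.2, ij.1)].

Definition nrows (A : Mat) : nat := \max_(ij <- finsupp A) ij.1.+1.
Definition ncols (A : Mat) : nat := \max_(ij <- finsupp A) ij.2.+1.

(* Row i as a weakly increasing word. *)
Definition mat_row (A : Mat) (i : nat) : seq nat :=
  flatten [seq nseq (A (i, j)) j | j <- iota 0 (ncols A)].

(* A_1 (x) A_2 (x) ... up to the last nonempty row, each factor being the
   reading of the tableau with one row A_i. *)
Definition mat_rows (A : Mat) : seq (seq nat) :=
  [seq reading [:: mat_row A i] | i <- iota 0 (nrows A)].

Definition mat_crystal : crystal Mat :=
  pullback mat_rows (seq_crystal (seq_crystal natural)).

Definition mat_crystal_t : crystal Mat := pullback tr_mat mat_crystal.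

Definition bimat_crystal : crystal (Mat * Mat) :=
  tensor (dual mat_crystal) mat_crystal.
Definition bimat_crystal_t : crystal (Mat * Mat) :=
  tensor (dual mat_crystal_t) mat_crystal_t.

Notation Qq := {fraction {poly rat}}.

Definition qv : Qq := tofrac 'X.

(* A_0: rational functions regular at q = 0 *)
Definition regular0 (a : Qq) : Prop :=
  exists n d : {poly rat}, d.[0] != 0 /\ a = tofrac n / tofrac d.

Definition qint (n : nat) : Qq := (qv ^+ n - qv ^- n) / (qv - qv^-1).
Definition qfact (n : nat) : Qq := \prod_(1 <= k < n.+1) qint k.

(* U_q(gl_{>0}) is the quotient by [uideal] of the free algebra [Ufree] on
   e_i = [gen true i], f_i = [gen false i] and q^h = [qpow h]; it is handled
   through the congruence [ueq]. *)
Notation ugen := (bool * nat + weight)%type.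

Notation Ufree := {malg Qq[{fmonom ugen}]}.

Definition gen (s : bool) (i : nat) : Ufree := << fmu (inl (s, i) : ugen) >>.
Definition qpow (h : weight) : Ufree := << fmu (inr h : ugen) >>.

Definition sgnb (s : bool) : int := if s then 1 else - 1.

Inductive urel : Ufree -> Prop :=
| urel_q0 : urel (qpow 0 - 1)
| urel_qD h h' : urel (qpow (h + h') - qpow h * qpow h')
| urel_qx s h i :
    urel (qpow h * gen s i
          - qv ^ (sgnb s * pairing h (alpha i)) *: (gen s i * qpow h))
| urel_ef i j :
    urel (gen true i * gen false j - gen false j * gen true i
          - (if i == j
             then (qv - qv^-1)^-1 *: (qpow (coroot i) - qpow (- coroot i))
             else 0))
| urel_far s i j : (i.+1 < j)%N -> urel (gen s i * gen s j - gen s j * gen s i)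
| urel_near s i j : (i == j.+1) || (j == i.+1) ->
    urel (gen s i ^+ 2 * gen s j
          - (qv + qv^-1) *: (gen s i * gen s j * gen s i)
          + gen s j * gen s i ^+ 2).

Inductive uideal : Ufree -> Prop :=
| uideal0 : uideal 0
| uidealD x a r b : uideal x -> urel r -> uideal (x + a * r * b).

Definition ueq (x y : Ufree) : Prop := uideal (x - y).

(* The positive part ([s = true]) and the negative part ([s = false]). *)
Inductive half (s : bool) : Ufree -> Prop :=
| half1 : half s 1
| half_gen i : half s (gen s i)
| halfZ a x : half s x -> half s (a *: x)
| halfD x y : half s x -> half s y -> half s (x + y)
| halfM x y : half s x -> half s y -> half s (x * y)
| half_eq x y : half s x -> ueq x y -> half s y.

(* Kashiwara's construction for the negative part, with t_i = q^{h_i}; the one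
   for the positive part is its image under the automorphism of U_q(gl_{>0})
   exchanging e_i and f_i and sending q^h to q^{-h}. *)
Section Half.
Variable s : bool.

Definition tpow (i : nat) (sg : bool) : Ufree :=
  qpow (if s == sg then - coroot i else coroot i).

(* For s = false this is e'_i(P) = R, where
   [e_i, P] = (t_i e''_i(P) - t_i^{-1} e'_i(P)) / (q - q^{-1}). *)
Definition eprime (i : nat) (P R : Ufree) : Prop :=
  [/\ half s P, half s R & exists2 Q, half s Q &
    ueq (gen (~~ s) i * P - P * gen (~~ s) i)
        ((qv - qv^-1)^-1 *: (tpow i true * Q - tpow i false * R))].

Definition divpow (i n : nat) : Ufree := (qfact n)^-1 *: gen s i ^+ n.

(* x = \sum_(k < n) f_i^(k) u_k with all u_k in the kernel of e'_i *)
Definition string_dec (i : nat) (x : Ufree) (n : nat) (u : nat -> Ufree) :=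
  (forall k, eprime i (u k) 0) /\ ueq x (\sum_(0 <= k < n) divpow i k * u k).

Definition raises (i : nat) (x y : Ufree) : Prop :=
  exists n u, string_dec i x n u /\
    ueq y (\sum_(0 <= k < n) divpow i k.+1 * u k).
Definition lowers (i : nat) (x y : Ufree) : Prop :=
  exists n u, string_dec i x n u /\
    ueq y (\sum_(1 <= k < n) divpow i k.-1 * u k).

Inductive generated : Ufree -> Prop :=
| generated1 x : ueq x 1 -> generated x
| generated_raise i x y : generated x -> raises i x y -> generated y.

Inductive lattice : Ufree -> Prop :=
| lattice0 x : ueq x 0 -> lattice x
| latticeD x a z y :
    lattice x -> regular0 a -> generated z -> ueq y (x + a *: z) -> lattice y.

Definition qlattice (x : Ufree) : Prop :=
  exists2 y, lattice y & ueq x (qv *: y).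

(* The nonzero classes modulo q times the lattice of the elements obtained from
   1 by raising operators; a class is represented as a subset of the lattice. *)
Definition Binf : Type :=
  {b : set Ufree | exists x,
     [/\ generated x, ~ qlattice x & b = [set y | qlattice (y - x)]%classic]}.

Definition Binf_op (R : Ufree -> Ufree -> Prop) (b : Binf) : option Binf :=
  some_such (fun b' : Binf =>
    exists x y, [/\ proj1_sig b x, proj1_sig b' y & R x y]).

Definition Binf_raise (i : nat) : Binf -> option Binf := Binf_op (raises i).
Definition Binf_lower (i : nat) : Binf -> option Binf := Binf_op (lowers i).

Definition Binf_depth (i : nat) (b : Binf) : nat :=
  xget 0%N [set k | isSome (iter k (obind (Binf_lower i)) (Some b))
                 /\ ~ isSome (iter k.+1 (obind (Binf_lower i)) (Some b))]%classic.

Definition Binf_wt (b : Binf) : weight :=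
  xget 0 [set la | exists2 x, proj1_sig b x &
    forall h, ueq (qpow h * x) (qv ^ pairing h la *: (x * qpow h))]%classic.

End Half.

(* B(oo), of the negative part, and B(-oo), of the positive part *)
Definition Bpoo_crystal : crystal (Binf false) :=
  {| wt := @Binf_wt false;
     veps i b := Some (Binf_depth i b)%:Z;
     vphi i b := Some ((Binf_depth i b)%:Z + pairing (coroot i) (Binf_wt b));
     ke := @Binf_lower false;
     kf := @Binf_raise false |}.

Definition Bnoo_crystal : crystal (Binf true) :=
  {| wt := @Binf_wt true;
     veps i b := Some ((Binf_depth i b)%:Z - pairing (coroot i) (Binf_wt b));
     vphi i b := Some (Binf_depth i b)%:Z;
     ke := @Binf_raise true;
     kf := @Binf_lower true |}.

Definition T_crystal (om : weight) : crystal unit :=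
  {| wt _ := om;
     veps _ _ := None;
     vphi _ _ := None;
     ke _ _ := None;
     kf _ _ := None |}.

Definition BU : Type := {om : weight & (Binf false * unit * Binf true)%type}.

Definition BU_crystal : crystal BU :=
  crystal_sum (fun om => tensor (tensor Bpoo_crystal (T_crystal om)) Bnoo_crystal).

Definition PW : Type :=
  {mn : partition * partition & (B2 mn.1 mn.2 * B2 mn.1 mn.2)%type}.

Definition PW_crystal_l : crystal PW :=
  crystal_sum (fun mn => act_fst (B2 mn.1 mn.2) (B2_crystal mn.1 mn.2)).
Definition PW_crystal_r : crystal PW :=
  crystal_sum (fun mn => act_snd (B2 mn.1 mn.2) (B2_crystal mn.1 mn.2)).

(* Main.v *)
From mathcomp Require Import all_boot all_order all_algebra.
From mathcomp Require Import finmap boolp monalg zify.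
Require Import Defs.

(* RSK without insertion.  On matrices the operators of one structure commute with
   those of the other and preserve its epsilon, so an operator of the second
   structure is an isomorphism between components of the first one.  A matrix
   killed by all raising operators of both structures is diagonal, hence determined
   by its weight.  It follows that highest weight elements of equal weight generate
   isomorphic crystals, that every matrix A corresponds to a unique tableau P(A) in
   the first structure and Q(A) in the second one, of the same shape, and that
   A |-> (P(A), Q(A)) is an isomorphism of bicrystals.

   Hence M^vee (x) M is the union over mu, nu of the squares of
   B_nu^vee (x) B_mu.  This crystal is connected: raising by e_i with i < n, for n
   large, leads to E_nu(n) (x) H_mu.  Moving every letter to the left of all the
   dual letters, by the strict embedding N^vee (x) N -> N (x) N^vee, identifies it
   with a component of B_mu (x) B_nu^vee; as E_nu(s) and H_mu have no letter in
   common for s = l(mu) + l(nu), its base point is sent to H_mu (x) E_nu(s), and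
   the component is B_{mu,nu}. *)

(** In a seminormal crystal epsilon and phi are lengths of strings, so a map need only respect
    weights and operators. This allows tableaux to be attached to matrices through [sim], that is,
    through the paths that are defined, with no formula for P(A) or Q(A). Uniqueness rests on the
    fact that paths can be reversed and that raising a word stops, since each step lowers a letter.
    Termination fails for the mixed product: e_i moves a dual letter up, so raising may go on for
    ever and there need be no highest weight element. Hence the correspondence is applied to each
    factor of M^vee (x) M separately, and the connectedness of B_nu^vee (x) B_mu is proved with
    operators of bounded index. The dual factor comes on the left, whereas B_{mu,nu} has it on the
    right. Plainly exchanging the factors goes wrong where a letter meets its own dual; the
    correction made there turns the exchange into an embedding that is not onto. *)

Set Implicit Arguments.
Unset Strict Implicit.
Unset Printing Implicit Defensive.

Import Order.TTheory GRing.Theory Num.Theory.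
Local Open Scope ring_scope.

(** * Seminormal crystals and their tensor products *)

(* [la@_k] at the syntactic type [int], the form understood by [lia]. *)
Definition wcoef (la : weight) (k : nat) : int := la@_k.

Lemma wcoefD la mu k : wcoef (la + mu) k = wcoef la k + wcoef mu k.
Proof. exact: mcoeffD. Qed.

Lemma wcoefN la k : wcoef (- la) k = - wcoef la k.
Proof. exact: mcoeffN. Qed.

Lemma wcoefB la mu k : wcoef (la - mu) k = wcoef la k - wcoef mu k.
Proof. exact: mcoeffB. Qed.

Lemma wcoefU k j : wcoef (epsw k) j = (k == j)%:Z.
Proof. by rewrite /wcoef /epsw mcoeffU; case: eqP. Qed.

Lemma wcoefP la mu : (forall k, wcoef la k = wcoef mu k) -> la = mu.
Proof. by move=> h; apply/malgP. Qed.

Lemma pairing_coroot i (la : weight) :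
  pairing (coroot i) la = wcoef la i - wcoef la i.+1.
Proof.
have sub : (msupp (coroot i) `<=` [fset i; i.+1])%fset.
  apply: (fsubset_trans (msuppB_le _ _)).
  by rewrite fsubUset !(fsubset_trans msuppU_le) // fsub1set !inE eqxx ?orbT.
rewrite /pairing (big_fset_incl _ sub) => [|k _ /mcoeff_outdom ->]; last first.
  by rewrite mul0r.
rewrite big_fsetU1 ?inE ?big_seq_fset1 /=; last by rewrite neq_ltn ltnSn.
rewrite -![(coroot i)@_ _]/(wcoef _ _) /coroot !wcoefB !wcoefU !eqxx.
by rewrite [i.+1 == i]gtn_eqF // [i == i.+1]ltn_eqF // subr0 mul1r sub0r mulN1r.
Qed.

Lemma alpha_coef i : wcoef (alpha i) i = 1 /\ wcoef (alpha i) i.+1 = -1.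
Proof.
rewrite /alpha !wcoefB !wcoefU !eqxx.
by rewrite [i.+1 == i]gtn_eqF // [i == i.+1]ltn_eqF // subr0 sub0r.
Qed.

Lemma wcoef_addalpha la i : wcoef (la + alpha i) i = wcoef la i + 1 /\
  wcoef (la + alpha i) i.+1 = wcoef la i.+1 - 1.
Proof. by rewrite !(wcoefD la); have [-> ->] := alpha_coef i. Qed.

Lemma wcoef_subalpha la i : wcoef (la - alpha i) i = wcoef la i - 1 /\
  wcoef (la - alpha i) i.+1 = wcoef la i.+1 + 1.
Proof. by rewrite !(wcoefB la); have [-> ->] := alpha_coef i; rewrite opprK. Qed.

Section Seminormal.
Variables (T : Type) (C : crystal T).

(** Natural numbers, so that truncated subtraction can express the tensor product rule. The values
    on negative or infinite arguments are junk, which [sn_eps] and [sn_phi] exclude. *)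
Definition neps (i : nat) (b : T) : nat := absz (odflt 0 (veps C i b)).
Definition nphi (i : nat) (b : T) : nat := absz (odflt 0 (vphi C i b)).

(* Pointwise form of "[C] is a crystal in which epsilon_i and phi_i are the
   lengths of the i-strings", so that words can be treated by induction. *)
Record seminormal_at (b : T) : Prop := SeminormalAt {
  sn_eps : forall i, veps C i b = Some (neps i b)%:Z;
  sn_phi : forall i, vphi C i b = Some (nphi i b)%:Z;
  sn_wt : forall i, (nphi i b)%:Z = (neps i b)%:Z + wcoef (wt C b) i - wcoef (wt C b) i.+1;
  sn_e0 : forall i, ke C i b = None <-> neps i b = 0%N;
  sn_f0 : forall i, kf C i b = None <-> nphi i b = 0%N;
  sn_e : forall i b', ke C i b = Some b' ->
    [/\ wt C b' = wt C b + alpha i, veps C i b' = Some (neps i b).-1%:Z,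
        vphi C i b' = Some (nphi i b).+1%:Z & kf C i b' = Some b];
  sn_f : forall i b', kf C i b = Some b' ->
    [/\ wt C b' = wt C b - alpha i, veps C i b' = Some (neps i b).+1%:Z,
        vphi C i b' = Some (nphi i b).-1%:Z & ke C i b' = Some b] }.

Definition seminormal := forall b, seminormal_at b.

Lemma nepsE i b (n : nat) : veps C i b = Some n%:Z -> neps i b = n.
Proof. by rewrite /neps => ->. Qed.

Lemma nphiE i b (n : nat) : vphi C i b = Some n%:Z -> nphi i b = n.
Proof. by rewrite /nphi => ->. Qed.

Lemma sn_eP b : seminormal_at b -> forall i,
  ke C i b = None /\ neps i b = 0%N \/
  exists c, ke C i b = Some c /\ (0 < neps i b)%N.
Proof.
move=> s i; have := sn_e0 s i; case: (ke C i b) => [c|] h; [right|left].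
  by exists c; split=> //; rewrite lt0n; apply/eqP => /h.
by split=> //; apply/h.
Qed.

Lemma sn_fP b : seminormal_at b -> forall i,
  kf C i b = None /\ nphi i b = 0%N \/
  exists c, kf C i b = Some c /\ (0 < nphi i b)%N.
Proof.
move=> s i; have := sn_f0 s i; case: (kf C i b) => [c|] h; [right|left].
  by exists c; split=> //; rewrite lt0n; apply/eqP => /h.
by split=> //; apply/h.
Qed.

Lemma seminormal_crystal : seminormal -> is_crystal C.
Proof.
move=> snC; split.
- by move=> i b; rewrite (sn_eps (snC b)) (sn_phi (snC b)) pairing_coroot /=
    (sn_wt (snC b)) addrA.
- move=> i b b' eb; have [-> -> -> _] := sn_e (snC b) eb; split=> //.
  + rewrite (sn_eps (snC b)) /=; congr Some.
    have : neps i b <> 0%N by move/(sn_e0 (snC b)); rewrite eb.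
    lia.
  + rewrite (sn_phi (snC b)) /=; congr Some; lia.
- move=> i b b' fb; have [-> -> -> _] := sn_f (snC b) fb; split=> //.
  + rewrite (sn_eps (snC b)) /=; congr Some; lia.
  + rewrite (sn_phi (snC b)) /=; congr Some.
    have : nphi i b <> 0%N by move/(sn_f0 (snC b)); rewrite fb.
    lia.
- move=> i b b'; split=> [/(sn_f (snC b))[]|/(sn_e (snC b'))[]] //.
- by move=> i b; rewrite (sn_phi (snC b)).
Qed.

End Seminormal.

(** The hypothesis replaces the pairing in max(e1, e2 - <h_i, w>) by p1 - e1, which gives e1 +
    max(0, e2 - p1). This is the bracketing rule: lowering letters of the first factor cancel
    raising letters of the second. *)
Lemma tens_epsE i (w : weight) (e1 p1 e2 : nat) :
  p1%:Z = e1%:Z + wcoef w i - wcoef w i.+1 ->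
  tens_eps i w (Some e1%:Z) (Some e2%:Z) = Some (e1 + (e2 - p1))%N%:Z.
Proof.
move=> E; rewrite /tens_eps /addz /maxz /= pairing_coroot.
by case: ifP => h; congr Some; lia.
Qed.

Lemma tens_phiE i (w : weight) (p1 p2 e2 : nat) :
  p2%:Z = e2%:Z + wcoef w i - wcoef w i.+1 ->
  tens_phi i w (Some p1%:Z) (Some p2%:Z) = Some (p2 + (p1 - e2))%N%:Z.
Proof.
move=> E; rewrite /tens_phi /addz /maxz /= pairing_coroot.
by case: ifP => h; congr Some; lia.
Qed.

Section Tensor.
Variables (T1 T2 : Type) (C1 : crystal T1) (C2 : crystal T2).

Lemma tensor_at (b1 : T1) (b2 : T2) : seminormal_at C1 b1 -> seminormal_at C2 b2 ->
  [/\ forall i, veps (tensor C1 C2) i (b1, b2) =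
        Some (neps C1 i b1 + (neps C2 i b2 - nphi C1 i b1))%N%:Z,
      forall i, vphi (tensor C1 C2) i (b1, b2) =
        Some (nphi C2 i b2 + (nphi C1 i b1 - neps C2 i b2))%N%:Z,
      forall i, ke (tensor C1 C2) i (b1, b2) =
        if (neps C2 i b2 <= nphi C1 i b1)%N
        then omap (fun c => (c, b2)) (ke C1 i b1)
        else omap (fun c => (b1, c)) (ke C2 i b2)
    & forall i, kf (tensor C1 C2) i (b1, b2) =
        if (neps C2 i b2 < nphi C1 i b1)%N
        then omap (fun c => (c, b2)) (kf C1 i b1)
        else omap (fun c => (b1, c)) (kf C2 i b2)].
Proof.
move=> s1 s2; split=> i /=.
- by rewrite (sn_eps s1) (sn_eps s2); apply: tens_epsE; apply: (sn_wt s1).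
- by rewrite (sn_phi s1) (sn_phi s2); apply: tens_phiE; apply: (sn_wt s2).
- by rewrite (sn_phi s1) (sn_eps s2).
- by rewrite (sn_phi s1) (sn_eps s2) /ltz /= ltnNge.
Qed.

Lemma tensor_seminormal_at (b1 : T1) (b2 : T2) :
  seminormal_at C1 b1 -> seminormal_at C2 b2 ->
  seminormal_at (tensor C1 C2) (b1, b2).
Proof.
move=> s1 s2; have [tE tP te tf] := tensor_at s1 s2.
have nE i := nepsE (tE i); have nP i := nphiE (tP i).
have w1 := sn_wt s1; have w2 := sn_wt s2.
split=> [i|i|i|i|i|i [c1 c2]|i [c1 c2]].
- by rewrite tE nE.
- by rewrite tP nP.
- rewrite nE nP /= !wcoefD; move: (w1 i) (w2 i); lia.
- rewrite te nE; case: leqP => h.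
    by case: (sn_eP s1 i) => [[-> h1]|[c [-> h1]]] /=; split=> //; lia.
  by case: (sn_eP s2 i) => [[-> h1]|[c [-> h1]]] /=; split=> //; lia.
- rewrite tf nP; case: ltnP => h.
    by case: (sn_fP s1 i) => [[-> h1]|[c [-> h1]]] /=; split=> //; lia.
  by case: (sn_fP s2 i) => [[-> h1]|[c [-> h1]]] /=; split=> //; lia.
- rewrite te nE nP; case: leqP => h.
    case: (sn_eP s1 i) => [[-> h1]|[c [eb h1]]] //=; rewrite eb /= => -[<- <-].
    have [cw ce cp cf] := sn_e s1 eb.
    have w1c : (nphi C1 i b1).+1%:Z
        = (neps C1 i b1).-1%:Z + wcoef (wt C1 c) i - wcoef (wt C1 c) i.+1.
      by rewrite cw; have [-> ->] := wcoef_addalpha (wt C1 b1) i; move: (w1 i); lia.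
    split.
    + by rewrite /= cw addrAC.
    + by rewrite /= ce (sn_eps s2) (tens_epsE _ w1c); congr Some; lia.
    + by rewrite /= cp (sn_phi s2) (tens_phiE _ (w2 i)); congr Some; lia.
    (* Raising the first factor increased its phi by one, so the weak inequality [h] becomes the
       strict one under which f_i returns to the same factor. *)
    + by rewrite /= (sn_eps s2) cp /ltz /= lez_nat -ltnNge ltnS h cf.
  case: (sn_eP s2 i) => [[-> h1]|[c [eb h1]]] //=; rewrite eb /= => -[<- <-].
  have [cw ce cp cf] := sn_e s2 eb.
  have w2c : (nphi C2 i b2).+1%:Z
      = (neps C2 i b2).-1%:Z + wcoef (wt C2 c) i - wcoef (wt C2 c) i.+1.
    by rewrite cw; have [-> ->] := wcoef_addalpha (wt C2 b2) i; move: (w2 i); lia.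
  split.
  + by rewrite /= cw addrA.
  + by rewrite /= ce (sn_eps s1) (tens_epsE _ (w1 i)); congr Some; lia.
  + by rewrite /= cp (sn_phi s1) (tens_phiE _ w2c); congr Some; lia.
  + rewrite /= (sn_phi s1) ce /ltz /= lez_nat -ltnNge cf.
    by have -> : (((neps C2 i b2).-1 < nphi C1 i b1) = false)%N by lia.
- rewrite tf nE nP; case: ltnP => h.
    case: (sn_fP s1 i) => [[-> h1]|[c [eb h1]]] //=; rewrite eb /= => -[<- <-].
    have [cw ce cp cf] := sn_f s1 eb.
    have w1c : (nphi C1 i b1).-1%:Z
        = (neps C1 i b1).+1%:Z + wcoef (wt C1 c) i - wcoef (wt C1 c) i.+1.
      by rewrite cw; have [-> ->] := wcoef_subalpha (wt C1 b1) i; move: (w1 i); lia.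
    split.
    + by rewrite /= cw addrAC.
    + by rewrite /= ce (sn_eps s2) (tens_epsE _ w1c); congr Some; lia.
    + by rewrite /= cp (sn_phi s2) (tens_phiE _ (w2 i)); congr Some; lia.
    + rewrite /= (sn_eps s2) cp /= lez_nat cf.
      by have -> : (neps C2 i b2 <= (nphi C1 i b1).-1)%N by lia.
  case: (sn_fP s2 i) => [[-> h1]|[c [eb h1]]] //=; rewrite eb /= => -[<- <-].
  have [cw ce cp cf] := sn_f s2 eb.
  have w2c : (nphi C2 i b2).-1%:Z
      = (neps C2 i b2).+1%:Z + wcoef (wt C2 c) i - wcoef (wt C2 c) i.+1.
    by rewrite cw; have [-> ->] := wcoef_subalpha (wt C2 b2) i; move: (w2 i); lia.
  split.
  + by rewrite /= cw addrA.
  + by rewrite /= ce (sn_eps s1) (tens_epsE _ (w1 i)); congr Some; lia.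
  + by rewrite /= cp (sn_phi s1) (tens_phiE _ w2c); congr Some; lia.
  + rewrite /= (sn_phi s1) ce /= lez_nat cf.
    by have -> : (((neps C2 i b2).+1 <= nphi C1 i b1) = false)%N by lia.
Qed.

End Tensor.

(** * Strict maps *)

Lemma dual_seminormal_at (T : Type) (C : crystal T) b :
  seminormal_at C b -> seminormal_at (dual C) b.
Proof.
move=> s; split=> [i|i|i|i|i|i c|i c].
- exact: sn_phi s i.
- exact: sn_eps s i.
- by have /= := sn_wt s i; rewrite /= !wcoefN /neps /nphi /=; lia.
- exact: sn_f0 s i.
- exact: sn_e0 s i.
- by case/(sn_f s) => cw ce cp cf; split=> //=; rewrite cw opprB addrC.
- by case/(sn_e s) => cw ce cp cf; split=> //=; rewrite cw opprD.
Qed.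

Section Strict.
Variables (T T' : Type) (C : crystal T) (C' : crystal T').

(** Stated at one element, because the composites built by induction on words are known to be strict
    only at the word at hand. *)
Record strict_at (f : T -> T') (b : T) : Prop := StrictAt {
  strict_wt : wt C' (f b) = wt C b;
  strict_eps : forall i, veps C' i (f b) = veps C i b;
  strict_phi : forall i, vphi C' i (f b) = vphi C i b;
  strict_e : forall i, ke C' i (f b) = omap f (ke C i b);
  strict_f : forall i, kf C' i (f b) = omap f (kf C i b) }.

Definition strict (f : T -> T') := forall b, strict_at f b.

Lemma strict_neps f b i : strict_at f b -> neps C' i (f b) = neps C i b.
Proof. by move=> s; rewrite /neps (strict_eps s). Qed.

Lemma strict_nphi f b i : strict_at f b -> nphi C' i (f b) = nphi C i b.
Proof. by move=> s; rewrite /nphi (strict_phi s). Qed.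

(** Apart from [b] itself, only its neighbours enter the definition. This serves composites written
    with [head] and [behead], which may differ from the intended map on empty words. *)
Lemma strict_at_ext f g b : f b = g b ->
  (forall i c, ke C i b = Some c \/ kf C i b = Some c -> f c = g c) ->
  strict_at f b -> strict_at g b.
Proof.
move=> fg fg' s; split=> [|i|i|i|i]; rewrite -fg.
- exact: strict_wt.
- exact: strict_eps.
- exact: strict_phi.
- rewrite (strict_e s); have := fg' i; case: (ke C i b) => [c|] //= h.
  by rewrite (h c) //; left.
- rewrite (strict_f s); have := fg' i; case: (kf C i b) => [c|] //= h.
  by rewrite (h c) //; right.
Qed.

Lemma strict_seminormal f b : strict f -> seminormal_at C b -> seminormal_at C' (f b).
Proof.
move=> sf s; have sb := sf b.
split=> [i|i|i|i|i|i c|i c].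
- by rewrite (strict_eps sb) (strict_neps _ sb) (sn_eps s).
- by rewrite (strict_phi sb) (strict_nphi _ sb) (sn_phi s).
- by rewrite (strict_wt sb) (strict_nphi _ sb) (strict_neps _ sb) (sn_wt s).
- by rewrite (strict_e sb) (strict_neps _ sb) -(sn_e0 s); case: (ke C i b).
- by rewrite (strict_f sb) (strict_nphi _ sb) -(sn_f0 s); case: (kf C i b).
- rewrite (strict_e sb); case eb: (ke C i b) => [b'|] //= [<-].
  have [cw ce cp cf] := sn_e s eb; have sb' := sf b'.
  rewrite (strict_wt sb') (strict_eps sb') (strict_phi sb') (strict_f sb').
  by rewrite (strict_wt sb) (strict_neps _ sb) (strict_nphi _ sb) cf.
- rewrite (strict_f sb); case eb: (kf C i b) => [b'|] //= [<-].
  have [cw ce cp cf] := sn_f s eb; have sb' := sf b'.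
  rewrite (strict_wt sb') (strict_eps sb') (strict_phi sb') (strict_e sb').
  by rewrite (strict_wt sb) (strict_neps _ sb) (strict_nphi _ sb) cf.
Qed.

(** Injectivity brings the inverse relation between e_i and f_i back from [C'] to [C]. Matrices,
    tableaux and components inherit seminormality in this way. *)
Lemma strict_inj_seminormal f b : strict f -> injective f ->
  seminormal_at C' (f b) -> seminormal_at C b.
Proof.
move=> sf fI s; have sb := sf b.
split=> [i|i|i|i|i|i c|i c].
- by rewrite -(strict_eps sb) -(strict_neps _ sb) (sn_eps s).
- by rewrite -(strict_phi sb) -(strict_nphi _ sb) (sn_phi s).
- by rewrite -(strict_wt sb) -(strict_nphi _ sb) -(strict_neps _ sb) (sn_wt s).
- by rewrite -(strict_neps _ sb) -(sn_e0 s) (strict_e sb); case: (ke C i b).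
- by rewrite -(strict_nphi _ sb) -(sn_f0 s) (strict_f sb); case: (kf C i b).
- move=> eb; have := strict_e sb i; rewrite eb /= => /(sn_e s).
  have sc := sf c.
  rewrite (strict_wt sc) (strict_eps sc) (strict_phi sc) (strict_f sc).
  rewrite (strict_wt sb) (strict_neps _ sb) (strict_nphi _ sb) => -[-> -> -> h].
  by split=> //; case: (kf C i c) h => //= c' [/fI->].
- move=> eb; have := strict_f sb i; rewrite eb /= => /(sn_f s).
  have sc := sf c.
  rewrite (strict_wt sc) (strict_eps sc) (strict_phi sc) (strict_e sc).
  rewrite (strict_wt sb) (strict_neps _ sb) (strict_nphi _ sb) => -[-> -> -> h].
  by split=> //; case: (ke C i c) h => //= c' [/fI->].
Qed.

Lemma strict_bij_iso f : strict f -> bijective f -> crystal_iso C C' f.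
Proof.
move=> s bf; split=> //.
- by move=> b; apply: strict_wt.
- by move=> i b; apply: strict_eps.
- by move=> i b; apply: strict_phi.
- by move=> i b; apply: strict_e.
- by move=> i b; apply: strict_f.
Qed.

Lemma iso_strict f : crystal_iso C C' f -> strict f.
Proof. by case=> _ h1 h2 h3 h4 h5 b; split. Qed.

End Strict.

Lemma strict_at_comp (T T' T'' : Type) (C : crystal T) (C' : crystal T')
    (C'' : crystal T'') f g b :
  strict_at C C' f b -> strict_at C' C'' g (f b) ->
  strict_at C C'' (fun x => g (f x)) b.
Proof.
move=> sf sg; split=> [|i|i|i|i].
- by rewrite (strict_wt sg) (strict_wt sf).
- by rewrite (strict_eps sg) (strict_eps sf).
- by rewrite (strict_phi sg) (strict_phi sf).
- by rewrite (strict_e sg) (strict_e sf); case: (ke C i b).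
- by rewrite (strict_f sg) (strict_f sf); case: (kf C i b).
Qed.

Lemma dual_strict_at (T T' : Type) (C : crystal T) (C' : crystal T') f b :
  strict_at C C' f b -> strict_at (dual C) (dual C') f b.
Proof. by case=> h1 h2 h3 h4 h5; split=> //=; rewrite h1. Qed.

Lemma tensor_strict_at (T1 T1' T2 T2' : Type) (C1 : crystal T1) (C1' : crystal T1')
    (C2 : crystal T2) (C2' : crystal T2') f1 f2 b1 b2 :
  strict_at C1 C1' f1 b1 -> strict_at C2 C2' f2 b2 ->
  strict_at (tensor C1 C2) (tensor C1' C2') (fun p => (f1 p.1, f2 p.2)) (b1, b2).
Proof.
case=> w1 e1 p1 ke1 kf1 [w2 e2 p2 ke2 kf2].
split=> [|i|i|i|i] /=; rewrite ?w1 ?e1 ?p1 ?w2 ?e2 ?p2 //.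
- by rewrite ke1 ke2; case: ifP => _; [case: (ke C1 i b1)|case: (ke C2 i b2)].
- by rewrite kf1 kf2; case: ifP => _; [case: (kf C1 i b1)|case: (kf C2 i b2)].
Qed.

Lemma tensor_neps (T1 T2 : Type) (C1 : crystal T1) (C2 : crystal T2) b1 b2 i :
  seminormal_at C1 b1 -> seminormal_at C2 b2 ->
  neps (tensor C1 C2) i (b1, b2) =
    (neps C1 i b1 + (neps C2 i b2 - nphi C1 i b1))%N.
Proof. by move=> s1 s2; have [h _ _ _] := tensor_at s1 s2; apply: nepsE. Qed.

Lemma tensor_nphi (T1 T2 : Type) (C1 : crystal T1) (C2 : crystal T2) b1 b2 i :
  seminormal_at C1 b1 -> seminormal_at C2 b2 ->
  nphi (tensor C1 C2) i (b1, b2) =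
    (nphi C2 i b2 + (nphi C1 i b1 - neps C2 i b2))%N.
Proof. by move=> s1 s2; have [_ h _ _] := tensor_at s1 s2; apply: nphiE. Qed.

Lemma tensor_ke (T1 T2 : Type) (C1 : crystal T1) (C2 : crystal T2) b1 b2 i :
  seminormal_at C1 b1 -> seminormal_at C2 b2 ->
  ke (tensor C1 C2) i (b1, b2) =
    if (neps C2 i b2 <= nphi C1 i b1)%N
    then omap (fun c => (c, b2)) (ke C1 i b1)
    else omap (fun c => (b1, c)) (ke C2 i b2).
Proof. by move=> s1 s2; have [_ _ h _] := tensor_at s1 s2; apply: h. Qed.

Lemma tensor_kf (T1 T2 : Type) (C1 : crystal T1) (C2 : crystal T2) b1 b2 i :
  seminormal_at C1 b1 -> seminormal_at C2 b2 ->
  kf (tensor C1 C2) i (b1, b2) =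
    if (neps C2 i b2 < nphi C1 i b1)%N
    then omap (fun c => (c, b2)) (kf C1 i b1)
    else omap (fun c => (b1, c)) (kf C2 i b2).
Proof. by move=> s1 s2; have [_ _ _ h] := tensor_at s1 s2; apply: h. Qed.

Section Assoc.
Variables (T1 T2 T3 : Type).
Variables (C1 : crystal T1) (C2 : crystal T2) (C3 : crystal T3).

Lemma assoc_strict_at b1 b2 b3 :
  seminormal_at C1 b1 -> seminormal_at C2 b2 -> seminormal_at C3 b3 ->
  strict_at (tensor (tensor C1 C2) C3) (tensor C1 (tensor C2 C3))
    (fun p => (p.1.1, (p.1.2, p.2))) ((b1, b2), b3).
Proof.
move=> s1 s2 s3; have s12 := tensor_seminormal_at s1 s2.
have s23 := tensor_seminormal_at s2 s3.
have sl := tensor_seminormal_at s12 s3; have sr := tensor_seminormal_at s1 s23.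
split=> [|i|i|i|i]; rewrite [(b1, b2, b3).1]/= [(b1, b2, b3).2]/=
  [(b1, b2).1]/= [(b1, b2).2]/=.
- by rewrite /= addrA.
- rewrite (sn_eps sl) (sn_eps sr) (tensor_neps _ s12) // (tensor_neps _ s1) //.
  by rewrite !tensor_neps // !tensor_nphi //; congr Some; lia.
- rewrite (sn_phi sl) (sn_phi sr) (tensor_nphi _ s12) // (tensor_nphi _ s1) //.
  by rewrite !tensor_neps // !tensor_nphi //; congr Some; lia.
- rewrite (tensor_ke _ s12) // (tensor_ke _ s1) // !tensor_ke //.
  rewrite !tensor_neps // !tensor_nphi //.
  case: (leqP (neps C2 i b2) (nphi C1 i b1)) => h1;
    case: (leqP (neps C3 i b3) (nphi C2 i b2)) => h2.
  + rewrite !ifT; [by case: (ke C1 i b1)|lia|lia].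
  + case: leqP => h3; [rewrite ifT; last by lia|rewrite ifF; last by lia].
      by case: (ke C1 i b1).
    by case: (ke C3 i b3).
  + rewrite ifF ?ifT; [|lia|lia].
    by case: (ke C2 i b2).
  + rewrite !ifF; [by case: (ke C3 i b3)|lia|lia].
- rewrite (tensor_kf _ s12) // (tensor_kf _ s1) // !tensor_kf //.
  rewrite !tensor_neps // !tensor_nphi //.
  case: (ltnP (neps C2 i b2) (nphi C1 i b1)) => h1;
    case: (ltnP (neps C3 i b3) (nphi C2 i b2)) => h2.
  + rewrite !ifT; [by case: (kf C1 i b1)|lia|lia].
  + case: ltnP => h3; [rewrite ifT; last by lia|rewrite ifF; last by lia].
      by case: (kf C1 i b1).
    by case: (kf C3 i b3).
  + rewrite ifF ?ifT; [|lia|lia].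
    by case: (kf C2 i b2).
  + rewrite !ifF; [by case: (kf C3 i b3)|lia|lia].
Qed.

End Assoc.

Lemma strict_at_inv (T T' : Type) (C : crystal T) (C' : crystal T') f g b :
  strict_at C C' f b -> cancel f g -> strict_at C' C g (f b).
Proof.
move=> s fK; split=> [|i|i|i|i]; rewrite fK.
- by rewrite (strict_wt s).
- by rewrite (strict_eps s).
- by rewrite (strict_phi s).
- by rewrite (strict_e s); case: (ke C i b) => //= c; rewrite fK.
- by rewrite (strict_f s); case: (kf C i b) => //= c; rewrite fK.
Qed.

Lemma assoc_inv_strict_at (T1 T2 T3 : Type)
    (C1 : crystal T1) (C2 : crystal T2) (C3 : crystal T3) b1 b2 b3 :
  seminormal_at C1 b1 -> seminormal_at C2 b2 -> seminormal_at C3 b3 ->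
  strict_at (tensor C1 (tensor C2 C3)) (tensor (tensor C1 C2) C3)
    (fun p => ((p.1, p.2.1), p.2.2)) (b1, (b2, b3)).
Proof.
move=> s1 s2 s3.
have K : cancel (fun p : (T1 * T2) * T3 => (p.1.1, (p.1.2, p.2)))
    (fun p => ((p.1, p.2.1), p.2.2)) by case=> -[].
exact: (strict_at_inv (assoc_strict_at s1 s2 s3) K).
Qed.

(** Duality turns the strict test for f_i into the negation of the weak test for e_i, so the factors
    have to change places. *)
Lemma dual_tensor_strict_at (T1 T2 : Type) (C1 : crystal T1) (C2 : crystal T2) b1 b2 :
  seminormal_at C1 b1 -> seminormal_at C2 b2 ->
  strict_at (dual (tensor C1 C2)) (tensor (dual C2) (dual C1))
    (fun p => (p.2, p.1)) (b1, b2).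
Proof.
move=> s1 s2; have s12 := tensor_seminormal_at s1 s2.
have d1 := dual_seminormal_at s1; have d2 := dual_seminormal_at s2.
have d12 := dual_seminormal_at s12; have d21 := tensor_seminormal_at d2 d1.
split=> [|i|i|i|i]; rewrite [(_, _).1]/= [(_, _).2]/=.
- by rewrite /= opprD addrC.
- rewrite (sn_eps d21) [RHS](sn_phi s12) tensor_neps // tensor_nphi //.
- rewrite (sn_phi d21) [RHS](sn_eps s12) tensor_nphi // tensor_neps //.
- rewrite (tensor_ke i d2 d1).
  have -> : ke (dual (tensor C1 C2)) i (b1, b2) = kf (tensor C1 C2) i (b1, b2) by [].
  rewrite (tensor_kf i s1 s2) [neps (dual _) _ _]/(nphi C1 i b1).
  rewrite [nphi (dual _) _ _]/(neps C2 i b2).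
  by rewrite leqNgt /=; case: ltnP => _ /=;
    [case: (kf C1 i b1)|case: (kf C2 i b2)].
- rewrite (tensor_kf i d2 d1).
  have -> : kf (dual (tensor C1 C2)) i (b1, b2) = ke (tensor C1 C2) i (b1, b2) by [].
  rewrite (tensor_ke i s1 s2) [neps (dual _) _ _]/(nphi C1 i b1).
  rewrite [nphi (dual _) _ _]/(neps C2 i b2).
  by rewrite ltnNge /=; case: leqP => _ /=;
    [case: (ke C1 i b1)|case: (ke C2 i b2)].
Qed.

Lemma natural_seminormal : seminormal natural.
Proof.
move=> k; split=> [i|i|i|i|i|i c|i c] //=; rewrite /neps /nphi /=.
- by rewrite !wcoefU; case: eqP; case: eqP; lia.
- by case: eqP.
- by case: eqP.
- case: eqP => // -> [<-]; rewrite !eqxx [i == i.+1]ltn_eqF // [i.+1 == i]gtn_eqF //=.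
  by split=> //; rewrite /alpha addrCA subrr addr0.
- case: eqP => // -> [<-]; rewrite !eqxx [i == i.+1]ltn_eqF // [i.+1 == i]gtn_eqF //=.
  by split=> //; rewrite /alpha opprB addrCA subrr addr0.
Qed.

(** * Finite tensor products and concatenation *)

Section SeqCrystal.
Variables (T : Type) (C : crystal T).
Hypothesis snC : seminormal C.

Lemma cons_strict : strict (tensor C (seq_crystal C)) (seq_crystal C)
  (fun p => p.1 :: p.2).
Proof.
move=> [b w]; split=> [|i|i|i|i] //=; first by rewrite /seq_wt big_cons.
- by case: ifP => _; [case: (ke C i b)|case: (seq_e C i w)].
- by case: ifP => _; [case: (kf C i b)|case: (seq_f C i w)].
Qed.

Lemma uncons_strict_at (x0 : T) b w :
  strict_at (seq_crystal C) (tensor C (seq_crystal C))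
    (fun w => (head x0 w, behead w)) (b :: w).
Proof. by apply: (strict_at_inv (cons_strict (b, w))); case. Qed.

Lemma seq_seminormal : seminormal (seq_crystal C).
Proof.
elim=> [|b w IH]; last first.
  exact: (strict_seminormal cons_strict (tensor_seminormal_at (snC b) IH)).
split=> //= i; rewrite /neps /nphi //=.
by rewrite /seq_wt big_nil /wcoef !mcoeff0.
Qed.

Lemma seq_neps_cons i b w : neps (seq_crystal C) i (b :: w) =
  (neps C i b + (neps (seq_crystal C) i w - nphi C i b))%N.
Proof. exact: (tensor_neps i (snC b) (seq_seminormal w)). Qed.

Lemma seq_nphi_cons i b w : nphi (seq_crystal C) i (b :: w) =
  (nphi (seq_crystal C) i w + (nphi C i b - neps (seq_crystal C) i w))%N.
Proof. exact: (tensor_nphi i (snC b) (seq_seminormal w)). Qed.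

Lemma seq_ke_cons i b w : ke (seq_crystal C) i (b :: w) =
  if (neps (seq_crystal C) i w <= nphi C i b)%N
  then omap (fun c => c :: w) (ke C i b)
  else omap (fun v => b :: v) (ke (seq_crystal C) i w).
Proof.
rewrite (strict_e (cons_strict (b, w))) tensor_ke //; last exact: seq_seminormal.
by case: ifP => _; [case: (ke C i b)|case: (ke _ i w)].
Qed.

Lemma seq_kf_cons i b w : kf (seq_crystal C) i (b :: w) =
  if (neps (seq_crystal C) i w < nphi C i b)%N
  then omap (fun c => c :: w) (kf C i b)
  else omap (fun v => b :: v) (kf (seq_crystal C) i w).
Proof.
rewrite (strict_f (cons_strict (b, w))) tensor_kf //; last exact: seq_seminormal.
by case: ifP => _; [case: (kf C i b)|case: (kf _ i w)].
Qed.

Lemma cat_strict : strict (tensor (seq_crystal C) (seq_crystal C)) (seq_crystal C)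
  (fun p => p.1 ++ p.2).
Proof.
have sn := seq_seminormal.
move=> [u v]; elim: u => [|b u IH].
  have s0 := sn [::]; have [h1 h2 h3 h4] := tensor_at s0 (sn v).
  split=> [|i|i|i|i]; rewrite [(_, _).1]/= [(_, _).2]/= cat0s.
  - by rewrite /= [seq_wt _ [::]]/seq_wt big_nil add0r.
  - by rewrite h1 (sn_eps (sn v)) add0n subn0.
  - by rewrite h2 (sn_phi (sn v)) addn0.
  - rewrite h3 /= leqn0; case: eqP => [/(sn_e0 (sn v))|_] //=.
    by case: (seq_e C i v).
  - by rewrite h4 ltn0 /=; case: (seq_f C i v).
have s1 : strict_at (tensor (seq_crystal C) (seq_crystal C))
    (tensor (tensor C (seq_crystal C)) (seq_crystal C))
    (fun p => ((head b p.1, behead p.1), p.2)) (b :: u, v).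
  by apply: (tensor_strict_at (f2 := id)) (uncons_strict_at b b u) _; split=> // i; case: (_ i v).
have s2 := strict_at_comp s1 (assoc_strict_at (snC b) (sn u) (sn v)).
have s3 : strict_at (tensor C (tensor (seq_crystal C) (seq_crystal C)))
    (tensor C (seq_crystal C)) (fun p => (p.1, p.2.1 ++ p.2.2)) (b, (u, v)).
  by apply: (tensor_strict_at (f1 := id)) _ IH; split=> // i; case: (_ i b).
have s4 := strict_at_comp (strict_at_comp s2 s3) (cons_strict (b, u ++ v)).
(* The composite [s4] splits the first word with [head] and [behead], so it is concatenation only
   where that word is nonempty; the operators leave it nonempty. *)
apply: strict_at_ext s4 => // i [w1 w2]; rewrite tensor_ke // tensor_kf //.
rewrite seq_ke_cons seq_kf_cons => H.
suff : exists c w, w1 = c :: w by move=> [c [w ->]].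
case: H; (case: ifP => _; [case: ifP => _ |]).
- by case: (ke C i b) => //= c [<- _]; exists c, u.
- by case: (ke _ i u) => //= w [<- _]; exists b, w.
- by case: (ke _ i v) => //= c [<- _]; exists b, u.
- by case: (kf C i b) => //= c [<- _]; exists c, u.
- by case: (kf _ i u) => //= w [<- _]; exists b, w.
- by case: (kf _ i v) => //= c [<- _]; exists b, u.
Qed.

Lemma singleton_strict : strict C (seq_crystal C) (fun x => [:: x]).
Proof.
move=> b; have sn := seq_seminormal [:: b].
split=> [|i|i|i|i].
- by rewrite /= /seq_wt big_seq1.
- by rewrite (sn_eps sn) seq_neps_cons (sn_eps (snC b)) addn0.
- by rewrite (sn_phi sn) seq_nphi_cons (sn_phi (snC b)) subn0.
- by rewrite seq_ke_cons; case: (ke C i b).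
- rewrite seq_kf_cons; case: (sn_fP (snC b) i) => [[-> ->]|[c [-> ->]]] //.
Qed.

End SeqCrystal.

Lemma map_strict (T T' : Type) (C : crystal T) (C' : crystal T') f :
  strict C C' f -> strict (seq_crystal C) (seq_crystal C') (map f).
Proof.
move=> sf; elim=> [|b w IH].
  by split=> //=; rewrite /seq_wt !big_nil.
case: IH => w1 e1 p1 ke1 kf1; case: (sf b) => w2 e2 p2 ke2 kf2.
split=> [|i|i|i|i].
- by move: w1; rewrite /= /seq_wt !big_cons w2 => ->.
- by move: (e1 i) => /= ->; rewrite w2 e2.
- by move: (p1 i) w1 => /= -> ->; rewrite p2.
- move: (e1 i) (ke1 i) => /= -> ->; rewrite p2 ke2; case: ifP => _.
    by case: (ke C i b).
  by case: (seq_e C i w).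
- move: (e1 i) (kf1 i) => /= -> ->; rewrite p2 kf2; case: ifP => _.
    by case: (kf C i b).
  by case: (seq_f C i w).
Qed.

Lemma some_suchP (T : Type) (P : T -> Prop) :
  (exists2 x, P x & some_such P = Some x) \/
  (some_such P = None /\ forall x, ~ P x).
Proof.
rewrite /some_such; case: pselect => h; first by left; case: (cid h) => x Px; exists x.
by right; split=> // x Px; apply: h; exists x.
Qed.

(** * Stable subsets and connected components *)

Section Pullback.
Variables (S T : Type) (iota : S -> T) (C : crystal T).
Hypothesis iotaI : injective iota.
Hypothesis closed_e : forall i b c, ke C i (iota b) = Some c -> exists b', c = iota b'.
Hypothesis closed_f : forall i b c, kf C i (iota b) = Some c -> exists b', c = iota b'.

(** Stability settles the case in which [some_such] finds no preimage: the operator of [C] must then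
    give 0. *)
Lemma pullback_strict : strict (pullback iota C) C iota.
Proof.
move=> b; split=> //= i.
- case: (some_suchP (fun x => ke C i (iota b) = Some (iota x))) => [[c h ->]|[-> h]] //=.
  case eb: ke => [d|] //; have [c ec] := closed_e eb.
  by case: (h c); rewrite -ec.
- case: (some_suchP (fun x => kf C i (iota b) = Some (iota x))) => [[c h ->]|[-> h]] //=.
  case eb: kf => [d|] //; have [c ec] := closed_f eb.
  by case: (h c); rewrite -ec.
Qed.

End Pullback.

Section Component.
Variables (T : Type) (C : crystal T) (b0 : T).

Lemma sval_component_strict :
  strict (component_crystal C b0) C (fun b => proj1_sig b).
Proof.
apply: pullback_strict => i [b cb] c /= h.
  by exists (exist _ c (connected_e cb h)).
by exists (exist _ c (connected_f cb h)).
Qed.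

Lemma component_inj (x y : component C b0) : proj1_sig x = proj1_sig y -> x = y.
Proof.
case: x y => x hx [y hy] /= E; case: y / E hy => hy.
by congr exist; apply: Prop_irrelevance.
Qed.

Lemma connected_trans b b' : connected C b0 b -> connected C b b' -> connected C b0 b'.
Proof.
move=> h; elim=> // i c c' _ IH; [exact: connected_e|exact: connected_f].
Qed.

End Component.

Lemma connected_sym (T : Type) (C : crystal T) b b' : seminormal C ->
  connected C b b' -> connected C b' b.
Proof.
move=> sn; elim=> [|i c c' _ IH h|i c c' _ IH h]; first exact: connected_refl.
- have [_ _ _ hf] := sn_e (sn c) h.
  exact: connected_trans (connected_f (connected_refl _ _) hf) IH.
- have [_ _ _ hf] := sn_f (sn c) h.
  exact: connected_trans (connected_e (connected_refl _ _) hf) IH.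
Qed.

(** * Words *)

(* Height of the prefix that ends with the raising letters of the k-th factor,
   in a product of factors with epsilon = e l and phi = p l. *)
Fixpoint peak (e p : nat -> nat) (k : nat) : int :=
  if k is k'.+1 then peak e p k' + (e k)%:Z - (p k')%:Z else (e 0%N)%:Z.

Arguments peak : simpl never.

Lemma peakS e p k : peak e p k.+1 = peak e p k + (e k.+1)%:Z - (p k)%:Z.
Proof. by []. Qed.

Lemma peak0 e p : peak e p 0 = (e 0%N)%:Z.
Proof. by []. Qed.

Lemma peakSl e p k : peak e p k.+1 =
  (e 0%N)%:Z - (p 0%N)%:Z + peak (fun l => e l.+1) (fun l => p l.+1) k.
Proof. by elim: k => [|k IH]; [rewrite peakS !peak0|rewrite peakS IH [in RHS]peakS]; lia. Qed.

Lemma eq_peak e p e' p' k : (forall l, (l <= k)%N -> e l = e' l) ->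
  (forall l, (l < k)%N -> p l = p' l) -> peak e p k = peak e' p' k.
Proof.
elim: k => [|k IH] he hp; first by rewrite !peak0 he.
by rewrite !peakS IH ?he ?hp // => l hl; rewrite ?he ?hp //; lia.
Qed.

Section SeqPeak.
Variables (T : Type) (C : crystal T).
Hypothesis snC : seminormal C.
Let K := seq_crystal C.

Lemma neps_cat i u v :
  neps K i (u ++ v) = (neps K i u + (neps K i v - nphi K i u))%N.
Proof.
rewrite (strict_neps i (cat_strict snC (u, v))).
by rewrite tensor_neps //; apply: seq_seminormal.
Qed.

Lemma nphi_cat i u v :
  nphi K i (u ++ v) = (nphi K i v + (nphi K i u - neps K i v))%N.
Proof.
rewrite (strict_nphi i (cat_strict snC (u, v))).
by rewrite tensor_nphi //; apply: seq_seminormal.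
Qed.

(** The inequalities describe the bracketing: the raising letters of [b] outnumber the free lowering
    letters of [u], and the lowering letters of [b] absorb all free raising letters of [v]. *)
Lemma seq_ke_split i w w' : ke K i w = Some w' ->
  exists u b c v, [/\ w = u ++ b :: v, w' = u ++ c :: v, ke C i b = Some c,
    (nphi K i u < neps C i b)%N & (neps K i v <= nphi C i b)%N].
Proof.
elim: w w' => [|b w IH] w' //; rewrite seq_ke_cons //; case: leqP => h.
  case eb: (ke C i b) => [c|] //= [<-]; exists [::], b, c, w; split=> //.
  by case: (sn_eP (snC b) i) => [[]|[_ [_]]] //; rewrite eb.
case ew: (ke K i w) => [w1|] //= [<-].
have [u [b' [c [v [ewu -> eb' h1 h2]]]]] := IH _ ew.
exists (b :: u), b', c, v; split=> //; first by rewrite ewu.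
move: h; rewrite ewu neps_cat -/K !(seq_neps_cons snC) !(seq_nphi_cons snC) -/K; lia.
Qed.

Lemma seq_kf_split i w w' : kf K i w = Some w' ->
  exists u b c v, [/\ w = u ++ b :: v, w' = u ++ c :: v, kf C i b = Some c,
    (nphi K i u <= neps C i b)%N & (neps K i v < nphi C i b)%N].
Proof.
elim: w w' => [|b w IH] w' //; rewrite seq_kf_cons //; case: ltnP => h.
  by case eb: (kf C i b) => [c|] //= [<-]; exists [::], b, c, w.
case ew: (kf K i w) => [w1|] //= [<-].
have [u [b' [c [v [ewu -> eb' h1 h2]]]]] := IH _ ew.
exists (b :: u), b', c, v; split=> //; first by rewrite ewu.
move: h; rewrite ewu neps_cat -/K !(seq_neps_cons snC) !(seq_nphi_cons snC) -/K; lia.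
Qed.

(** Epsilon of a nonempty product is the maximum of the heights. This is the upper bound;
    [seq_ke_peak] shows that it is attained when epsilon is positive. *)
Lemma peak_le_neps x0 i w k : (k < size w)%N ->
  peak (fun l => neps C i (nth x0 w l)) (fun l => nphi C i (nth x0 w l)) k
    <= (neps K i w)%:Z.
Proof.
elim: w k => [|b w IH] [|k] //= h; rewrite seq_neps_cons -/K //.
  by rewrite peak0 /=; lia.
by rewrite peakSl /=; have := IH k h; lia.
Qed.

Lemma peak_size x0 i u b v :
  peak (fun l => neps C i (nth x0 (u ++ b :: v) l))
       (fun l => nphi C i (nth x0 (u ++ b :: v) l)) (size u)
  = (neps K i u)%:Z - (nphi K i u)%:Z + (neps C i b)%:Z.
Proof.
elim: u => [|a u IH]; first by rewrite peak0 /= /neps /nphi /=; lia.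
rewrite peakSl /= IH !(seq_neps_cons snC) !(seq_nphi_cons snC) -/K; lia.
Qed.

(** In the decomposition of [seq_ke_split] the factor that changes has height epsilon, while the
    earlier ones have at most epsilon of [u], which is smaller. So e_i acts at the first maximum. *)
Lemma seq_ke_peak x0 i w w' : ke K i w = Some w' ->
  let p := peak (fun l => neps C i (nth x0 w l)) (fun l => nphi C i (nth x0 w l)) in
  exists r c, [/\ (r < size w)%N, ke C i (nth x0 w r) = Some c,
    w' = set_nth x0 w r c, p r = (neps K i w)%:Z &
    forall k, (k < r)%N -> p k < (neps K i w)%:Z].
Proof.
move=> ew /=; have [u [b [c [v [-> -> eb h1 h2]]]]] := seq_ke_split ew.
exists (size u), c; rewrite size_cat /= addnS ltnS leq_addr nth_cat ltnn subnn.
split=> //.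
- elim: u {ew h1} => //= a u IH; congr (_ :: _); exact: IH.
- rewrite peak_size neps_cat (seq_neps_cons snC) -/K; lia.
- move=> k hk; rewrite neps_cat (seq_neps_cons snC) -/K.
  have := peak_le_neps x0 i hk.
  have -> : peak (fun l => neps C i (nth x0 u l)) (fun l => nphi C i (nth x0 u l)) k =
    peak (fun l => neps C i (nth x0 (u ++ b :: v) l))
      (fun l => nphi C i (nth x0 (u ++ b :: v) l)) k.
    by apply: eq_peak => l hl; rewrite nth_cat ifT //; lia.
  lia.
Qed.

End SeqPeak.

Local Notation words := (seq_crystal natural).

Lemma words_seminormal : seminormal words.
Proof. exact: seq_seminormal natural_seminormal. Qed.

Lemma words_seq_seminormal : seminormal (seq_crystal words).
Proof. exact: seq_seminormal words_seminormal. Qed.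

Lemma natural_neps i k : neps natural i k = (k == i.+1).
Proof. by []. Qed.

Lemma natural_nphi i k : nphi natural i k = (k == i).
Proof. by []. Qed.

(** A letter i+1 has epsilon 1 and phi 0, so the inequalities of [seq_ke_split] leave no free i
    before it and no free i+1 after it. *)
Lemma words_ke_split i w w' : ke words i w = Some w' ->
  exists u v, [/\ w = u ++ i.+1 :: v, w' = u ++ i :: v,
    nphi words i u = 0%N & neps words i v = 0%N].
Proof.
move/(seq_ke_split natural_seminormal) => [u [b [c [v [-> -> eb h1 h2]]]]].
exists u, v; move: eb h1 h2; rewrite natural_neps natural_nphi /=.
case: eqP => // -> [<-]; rewrite [i.+1 == i]gtn_eqF //; split=> //; lia.
Qed.

Lemma words_kf_split i w w' : kf words i w = Some w' ->
  exists u v, [/\ w = u ++ i :: v, w' = u ++ i.+1 :: v,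
    nphi words i u = 0%N & neps words i v = 0%N].
Proof.
move/(seq_kf_split natural_seminormal) => [u [b [c [v [-> -> eb h1 h2]]]]].
exists u, v; move: eb h1 h2; rewrite natural_neps natural_nphi /=.
case: eqP => // -> [<-]; rewrite [i == i.+1]ltn_eqF //; split=> //; lia.
Qed.

Lemma words_neps_cons i x w : neps words i (x :: w) =
  ((x == i.+1) + (neps words i w - (x == i)))%N.
Proof. exact: seq_neps_cons natural_seminormal _ _ _. Qed.

Lemma words_nphi_cons i x w : nphi words i (x :: w) =
  (nphi words i w + ((x == i) - neps words i w))%N.
Proof. exact: seq_nphi_cons natural_seminormal _ _ _. Qed.

Lemma words_wt w k : wcoef (wt words w) k = (count_mem k w)%:Z.
Proof.
elim: w => [|x w IH]; first by rewrite /= /seq_wt big_nil /wcoef mcoeff0.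
by move: IH; rewrite /= /seq_wt big_cons wcoefD wcoefU => ->; lia.
Qed.

Lemma words_eps_notin i w : i.+1 \notin w -> neps words i w = 0%N.
Proof.
elim: w => [|x w IH] //; rewrite inE negb_or words_neps_cons => /andP[h /IH ->].
by rewrite eq_sym (negbTE h).
Qed.

Lemma words_phi_notin i w : i \notin w -> nphi words i w = 0%N.
Proof.
elim: w => [|x w IH] //; rewrite inE negb_or words_nphi_cons => /andP[h /IH ->].
by rewrite eq_sym (negbTE h).
Qed.

Lemma words_phi_eps i w :
  (nphi words i w + count_mem i.+1 w = neps words i w + count_mem i w)%N.
Proof. have := sn_wt (words_seminormal w) i; rewrite !words_wt; lia. Qed.

(** A letter i cancels only letters i+1 to its right, and a decreasing word has none there. *)
Lemma words_eps_geq i w : sorted geq w -> neps words i w = count_mem i.+1 w.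
Proof.
elim: w => [|x w IH] //= h; rewrite words_neps_cons IH ?(path_sorted h) //.
case: (eqVneq x i) => [E|_]; last by rewrite subn0.
rewrite (_ : count_mem i.+1 w = 0%N) //; apply/count_memPn/negP => hi.
have geq_trans : transitive geq by move=> a b c /= h1 h2; exact: leq_trans h2 h1.
have := order_path_min geq_trans h => /allP /(_ _ hi) /=; lia.
Qed.

Lemma words_phi_geq i w : sorted geq w -> nphi words i w = count_mem i w.
Proof. by move=> /(words_eps_geq i); have := words_phi_eps i w; lia. Qed.

Lemma words_ke_geq i w w' : sorted geq w -> ke words i w = Some w' -> sorted geq w'.
Proof.
move=> sw /words_ke_split[u [v [ew -> _ h]]]; move: sw; rewrite ew.
have geq_trans : transitive geq by move=> a b c /= h1 h2; exact: leq_trans h2 h1.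
rewrite !(sorted_pairwise geq_trans) !pairwise_cat /= => /and4P[h1 h2 h3 h4].
rewrite h2 h4 andbT /=.
(* As nothing cancels in a decreasing word, epsilon 0 means that no i+1 is left: the letter that is
   lowered is the last i+1. *)
have : i.+1 \notin v.
  by rewrite -has_pred1 has_count -words_eps_geq ?h // (sorted_pairwise geq_trans).
move=> hv; apply/andP; split.
  apply/allrelP => a b ha; rewrite inE => /orP[/eqP->|hb].
    by have /= := allrelP h1 a i.+1 ha (mem_head _ _); lia.
  by apply: (allrelP h1 a b ha); rewrite inE hb orbT.
apply/allP => a ha /=; have := allP h3 a ha => /= h5.
have : a != i.+1 by apply: contraNneq hv => <-.
lia.
Qed.

Lemma words_kf_geq i w w' : sorted geq w -> kf words i w = Some w' -> sorted geq w'.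
Proof.
move=> sw /words_kf_split[u [v [ew -> h _]]]; move: sw; rewrite ew.
have geq_trans : transitive geq by move=> a b c /= h1 h2; exact: leq_trans h2 h1.
rewrite !(sorted_pairwise geq_trans) !pairwise_cat /= => /and4P[h1 h2 h3 h4].
rewrite h2 h4 andbT /=.
have : i \notin u.
  by rewrite -has_pred1 has_count -words_phi_geq ?h // (sorted_pairwise geq_trans).
move=> hu; apply/andP; split.
  apply/allrelP => a b ha; rewrite inE => /orP[/eqP->|hb].
    have /= h5 := allrelP h1 a i ha (mem_head _ _).
    have : a != i by apply: contraNneq hu => <-.
    lia.
  by apply: (allrelP h1 a b ha); rewrite inE hb orbT.
by apply/allP => a ha /=; have /= := allP h3 a ha; lia.
Qed.

Lemma reading_row r : reading [:: r] = rev r.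
Proof.
rewrite /reading /= map_rev.
have -> : [seq column [:: r] j | j <- iota 0 (size r)] = [seq [:: x] | x <- r].
  apply: (@eq_from_nth _ [::]); rewrite !size_map size_iota // => j hj.
  rewrite (nth_map 0%N) ?size_iota // (nth_map 0%N) // nth_iota // add0n.
  by rewrite /column /= hj.
by rewrite -map_rev; elim: (rev r) => //= x s ->.
Qed.

(** * The crystal of matrices *)

Lemma count_flatten_nseq (f : nat -> nat) s j : uniq s ->
  count_mem j (flatten [seq nseq (f x) x | x <- s]) = ((j \in s) * f j)%N.
Proof.
elim: s => [|x s IH] //= /andP[xs us]; rewrite count_cat count_nseq IH // in_cons /= eq_sym.
by case: (eqVneq j x) xs => [->|_ _]; [move/negbTE ->; lia|case: (j \in s); lia].
Qed.

Lemma sorted_flatten_nseq (f : nat -> nat) m n :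
  sorted leq (flatten [seq nseq (f x) x | x <- iota m n]).
Proof.
elim: n m => [|n IH] m //=; rewrite (sorted_pairwise leq_trans) pairwise_cat.
rewrite -!(sorted_pairwise leq_trans) IH andbT; apply/andP; split.
  apply/allrelP => a b /nseqP[-> _] /flatten_mapP[x].
  by rewrite mem_iota => h /nseqP[-> _]; lia.
by elim: (f m) => //= k; case: k => //= k ->; rewrite leqnn.
Qed.

Lemma sorted_count_inj (s t : seq nat) : sorted leq s -> sorted leq t ->
  (forall j, count_mem j s = count_mem j t) -> s = t.
Proof.
move=> hs ht h; apply: (sorted_eq leq_trans anti_leq hs ht).
by rewrite /perm_eq; apply/allP => x _ /=; rewrite h.
Qed.

Lemma sorted_geq_rev s : sorted geq (rev s) = sorted leq s.
Proof. by rewrite rev_sorted. Qed.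

Lemma mat_lt (A : Mat) k j : A (k, j) <> 0%N -> (k < nrows A)%N /\ (j < ncols A)%N.
Proof.
move=> /eqP; rewrite -mem_finsupp => h; split.
  by have /bigmax_leqP_seq/(_ (k, j) h isT) := leqnn (nrows A).
by have /bigmax_leqP_seq/(_ (k, j) h isT) := leqnn (ncols A).
Qed.

Lemma nrows_leP (A : Mat) n :
  (forall k j, (n <= k)%N -> A (k, j) = 0%N) -> (nrows A <= n)%N.
Proof.
move=> h; apply/bigmax_leqP_seq => -[k j] /=; rewrite mem_finsupp => h' _.
by rewrite ltnNge; apply: contra h' => /h ->.
Qed.

Lemma mat_row_count (A : Mat) k j : count_mem j (mat_row A k) = A (k, j).
Proof.
rewrite /mat_row (@count_flatten_nseq (fun j => A (k, j))) ?iota_uniq //.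
rewrite mem_iota add0n /=; case: ltnP => h; first by rewrite mul1n.
by case: (A (k, j) =P 0%N) => [->//|/mat_lt[]]; lia.
Qed.

Lemma mat_row_sorted (A : Mat) k : sorted leq (mat_row A k).
Proof. exact: sorted_flatten_nseq. Qed.

Definition mat_of (ws : seq (seq nat)) : Mat :=
  [fsfun kj in [fset kj : nat * nat in
       [seq (k, j) | k <- iota 0 (size ws), j <- flatten ws]]%fset =>
     count_mem kj.2 (nth [::] ws kj.1)].

Lemma mat_ofE ws k j : mat_of ws (k, j) = count_mem j (nth [::] ws k).
Proof.
rewrite /mat_of fsfun_fun; case: ifP => //= h; apply/esym/count_memPn/negP => hj.
have hk : (k < size ws)%N.
  by case: ltnP hj => // hk; rewrite nth_default.
move/negP: h; apply; rewrite in_fset /=; apply/allpairsP; exists (k, j).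
split=> //=; first by rewrite mem_iota.
by apply/flattenP; exists (nth [::] ws k) => //; apply: mem_nth.
Qed.

(** The image of [mat_rows]. The default [[:: 0]] of [last] is nonempty, which admits the empty
    list, the image of the zero matrix. *)
Definition mat_words (ws : seq (seq nat)) : bool :=
  all (sorted geq) ws && (last [:: 0%N] ws != [::]).

Lemma size_mat_rows A : size (mat_rows A) = nrows A.
Proof. by rewrite size_map size_iota. Qed.

Lemma nth_mat_rows (A : Mat) k : nth [::] (mat_rows A) k = rev (mat_row A k).
Proof.
case: (ltnP k (nrows A)) => h.
  by rewrite (nth_map 0%N) ?size_iota // nth_iota // reading_row.
rewrite nth_default ?size_mat_rows //.
rewrite (@sorted_count_inj (mat_row A k) [::]) ?mat_row_sorted // => j.
rewrite mat_row_count /=.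
by case: (A (k, j) =P 0%N) => // /mat_lt[]; lia.
Qed.

Lemma mat_rows_words A : mat_words (mat_rows A).
Proof.
apply/andP; split.
  by apply/allP => _ /mapP[k _ ->]; rewrite reading_row sorted_geq_rev mat_row_sorted.
case E: (nrows A) => [|n].
  by rewrite (size0nil (s := mat_rows A)) // size_mat_rows.
have h : (0 < size (mat_rows A))%N by rewrite size_mat_rows E.
rewrite (last_nth [::]) size_mat_rows E -[_ :: _]cat1s nth_cat /= subn1 /=.
rewrite nth_mat_rows; apply/eqP => r0.
suff : (nrows A <= n)%N by rewrite E ltnn.
apply: nrows_leP => k j hk; rewrite -mat_row_count.
case: (eqVneq k n) => [->|ne].
  by rewrite -[mat_row A n]revK r0.
rewrite mat_row_count; case: (A (k, j) =P 0%N) => // /mat_lt[]; lia.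
Qed.

Lemma mat_rowsK : cancel mat_rows mat_of.
Proof.
move=> A; apply/fsfunP => -[k j].
by rewrite mat_ofE nth_mat_rows count_rev mat_row_count.
Qed.

Lemma mat_ofK ws : mat_words ws -> mat_rows (mat_of ws) = ws.
Proof.
case/andP => srt lst.
have nr : nrows (mat_of ws) = size ws.
  apply/eqP; rewrite eqn_leq; apply/andP; split.
    by apply: nrows_leP => k j hk; rewrite mat_ofE nth_default.
  case: (lastP ws) lst => // ws' w; rewrite last_rcons size_rcons.
  case: w => // x w _.
  have /mat_lt[] // : mat_of (rcons ws' (x :: w)) (size ws', x) <> 0%N.
  by rewrite mat_ofE nth_rcons ltnn eqxx /= eqxx.
apply: (@eq_from_nth _ [::]); rewrite size_mat_rows nr // => k hk.
rewrite nth_mat_rows -[RHS]revK; congr rev; apply: sorted_count_inj.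
- exact: mat_row_sorted.
- by rewrite -sorted_geq_rev revK; apply: (allP srt); apply: mem_nth.
- by move=> j; rewrite mat_row_count mat_ofE count_rev.
Qed.

Lemma words_size_e i w w' : ke words i w = Some w' -> size w' = size w.
Proof. by move=> /words_ke_split[u [v [-> -> _ _]]]; rewrite !size_cat. Qed.

Lemma words_size_f i w w' : kf words i w = Some w' -> size w' = size w.
Proof. by move=> /words_kf_split[u [v [-> -> _ _]]]; rewrite !size_cat. Qed.

Lemma mat_words_replace u b c v : sorted geq c -> size c = size b ->
  mat_words (u ++ b :: v) -> mat_words (u ++ c :: v).
Proof.
rewrite /mat_words !all_cat /= !last_cat /= => -> sz /andP[/and3P[-> _ ->] /=].
by case: v => //=; rewrite -!size_eq0 sz.
Qed.

Lemma mat_closed_e i A ws : ke (seq_crystal words) i (mat_rows A) = Some ws ->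
  exists B, ws = mat_rows B.
Proof.
case/(seq_ke_split words_seminormal) => u [b [c [v [E -> eb _ _]]]].
exists (mat_of (u ++ c :: v)); rewrite mat_ofK //.
have h := mat_rows_words A; rewrite E in h.
apply: mat_words_replace h; last exact: words_size_e eb.
apply: words_ke_geq eb; have /andP[/allP h _] := mat_rows_words A.
by apply: h; rewrite E mem_cat mem_head orbT.
Qed.

Lemma mat_closed_f i A ws : kf (seq_crystal words) i (mat_rows A) = Some ws ->
  exists B, ws = mat_rows B.
Proof.
case/(seq_kf_split words_seminormal) => u [b [c [v [E -> eb _ _]]]].
exists (mat_of (u ++ c :: v)); rewrite mat_ofK //.
have h := mat_rows_words A; rewrite E in h.
apply: mat_words_replace h; last exact: words_size_f eb.
apply: words_kf_geq eb; have /andP[/allP h _] := mat_rows_words A.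
by apply: h; rewrite E mem_cat mem_head orbT.
Qed.

Lemma mat_rows_strict : strict mat_crystal (seq_crystal words) mat_rows.
Proof.
apply: pullback_strict; [exact: mat_closed_e|exact: mat_closed_f].
Qed.

Lemma mat_seminormal : seminormal mat_crystal.
Proof.
move=> A; apply: (strict_inj_seminormal mat_rows_strict (can_inj mat_rowsK)).
exact: words_seq_seminormal.
Qed.

Lemma tr_matE (A : Mat) k j : tr_mat A (k, j) = A (j, k).
Proof.
rewrite /tr_mat fsfun_fun; case: ifP => //= /negP h.
case: (A (j, k) =P 0%N) => // /eqP; rewrite -mem_finsupp => hA.
by case: h; apply/imfsetP; exists (j, k).
Qed.

Lemma tr_matK : involutive tr_mat.
Proof. by move=> A; apply/fsfunP => -[k j]; rewrite !tr_matE. Qed.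

Lemma pullback_bij_strict (S T : Type) (f : S -> T) (C : crystal T) :
  bijective f -> strict (pullback f C) C f.
Proof.
case=> g fK gK; apply: pullback_strict => i b c _; by exists (g c).
Qed.

Lemma tr_mat_strict : strict mat_crystal_t mat_crystal tr_mat.
Proof. by apply: pullback_bij_strict; apply: inv_bij tr_matK. Qed.

Lemma tr_mat_strict' : strict mat_crystal mat_crystal_t tr_mat.
Proof.
move=> A; rewrite -{1}[A]tr_matK.
exact: (strict_at_inv (tr_mat_strict (tr_mat A)) tr_matK).
Qed.

Lemma mat_t_seminormal : seminormal mat_crystal_t.
Proof.
move=> A; apply: (strict_inj_seminormal tr_mat_strict (can_inj tr_matK)).
exact: mat_seminormal.
Qed.

(** Row k is read as a decreasing word, with epsilon [A (k, i.+1)] and phi [A (k, i)]. The height is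
    thus the sum of column i+1 down to row k minus the sum of column i above row k. *)
Definition mpeak (A : Mat) (i : nat) : nat -> int :=
  peak (fun k => A (k, i.+1)) (fun k => A (k, i)).

Lemma mat_neps A i : neps mat_crystal i A = neps (seq_crystal words) i (mat_rows A).
Proof. by rewrite (strict_neps i (mat_rows_strict A)). Qed.

Lemma mat_row_neps (A : Mat) i k : neps words i (nth [::] (mat_rows A) k) = A (k, i.+1).
Proof.
by rewrite nth_mat_rows words_eps_geq ?sorted_geq_rev ?mat_row_sorted //
  count_rev mat_row_count.
Qed.

Lemma mat_row_nphi (A : Mat) i k : nphi words i (nth [::] (mat_rows A) k) = A (k, i).
Proof.
by rewrite nth_mat_rows words_phi_geq ?sorted_geq_rev ?mat_row_sorted //
  count_rev mat_row_count.
Qed.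

Lemma mpeakE A i k : mpeak A i k =
  peak (fun l => neps words i (nth [::] (mat_rows A) l))
    (fun l => nphi words i (nth [::] (mat_rows A) l)) k.
Proof. by apply: eq_peak => l _; rewrite ?mat_row_neps ?mat_row_nphi. Qed.

Lemma mpeakS A i k : mpeak A i k.+1 = mpeak A i k + (A (k.+1, i.+1))%:Z - (A (k, i))%:Z.
Proof. exact: peakS. Qed.

Lemma mpeak_le A i k : mpeak A i k <= (neps mat_crystal i A)%:Z.
Proof.
have small l : (l < nrows A)%N -> mpeak A i l <= (neps mat_crystal i A)%:Z.
  move=> h; rewrite mat_neps mpeakE; apply: (peak_le_neps words_seminormal).
  by rewrite size_mat_rows.
have out l j : (nrows A <= l)%N -> A (l, j) = 0%N.
  by move=> h; case: (A (l, j) =P 0%N) => // /mat_lt[]; lia.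
(* Past the last nonempty row the height can only decrease. *)
elim: k => [|k IH]; first by case: (ltnP 0 (nrows A)) => [/small//|/out h]; rewrite /mpeak peak0 h.
case: (ltnP k.+1 (nrows A)) => [/small//|/out h]; rewrite mpeakS h; lia.
Qed.

(** [B] is A - E_{r,i+1} + E_{r,i}, in a form free of subtraction. *)
Definition moved (A B : Mat) (r i : nat) : Prop := forall k j,
  (B (k, j) + ((k == r) && (j == i.+1)) = A (k, j) + ((k == r) && (j == i)))%N.

Lemma mat_ke A B i : ke mat_crystal i A = Some B ->
  exists r, [/\ moved A B r i, mpeak A i r = (neps mat_crystal i A)%:Z &
    forall k, (k < r)%N -> mpeak A i k < (neps mat_crystal i A)%:Z].
Proof.
move=> eA; have := strict_e (mat_rows_strict A) i; rewrite eA /= => eR.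
have [r [c [hr er eB p1 p2]]] := seq_ke_peak words_seminormal [::] eR.
exists r; split; rewrite ?mat_neps ?mpeakE //; last first.
  by move=> k hk; rewrite mpeakE p2.
move=> k j; rewrite -[B]mat_rowsK -[A in RHS]mat_rowsK !mat_ofE eB nth_set_nth /=.
case: (eqVneq k r) => [->|_]; rewrite /= ?addn0 //.
have [u [v [-> -> _ _]]] := words_ke_split er.
by rewrite !count_cat /= ![_ == j]eq_sym; lia.
Qed.

(** * Commutation of the two structures on matrices *)

(** A unit going from column i+1 to column i changes only the partial sum of row r that ends between
    these columns. The transposed height at c contains row j+1 up to c and, with a minus sign, row j
    before c. *)
Lemma mpeak_moved A B r i j c : moved A B r i ->
  mpeak (tr_mat B) j c =
    mpeak (tr_mat A) j c + ((r == j.+1) && (c == i))%:Z - ((r == j) && (c == i.+1))%:Z.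
Proof.
move=> m; elim: c => [|c IH].
  by rewrite /mpeak !peak0 !tr_matE; have := m j.+1 0%N; lia.
rewrite !mpeakS IH !tr_matE; have := m j.+1 c.+1; have := m j c; lia.
Qed.

(* The sign of this common value decides between rows j and j.+1 for the first
   structure and between columns i and i.+1 for the second one: this is why the
   two structures commute. *)
Lemma mpeak_square (A : Mat) i j :
  mpeak A i j.+1 - mpeak A i j = mpeak (tr_mat A) j i.+1 - mpeak (tr_mat A) j i :> int.
Proof.
rewrite !mpeakS !tr_matE.
by move: (A (j.+1, i.+1)) (A (j, i)) => x y; lia.
Qed.

Lemma mat_neps_attained A i : (0 < neps mat_crystal i A)%N ->
  exists r, mpeak A i r = (neps mat_crystal i A)%:Z.
Proof.
case: (sn_eP (mat_seminormal A) i) => [[_ ->]//|[B [/mat_ke[r [_ h _]] _]] _].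
by exists r.
Qed.

(** The transposed heights change at c = i or c = i+1 only. If r = j+1, [mpeak_square] and the
    choice of the first maximum make the height at i smaller than that at i+1, so raising it by one
    creates no new maximum. If r = j, the height at i+1 is at most that at i, so lowering it loses
    none. *)
Lemma mat_neps_tr A B i j : ke mat_crystal i A = Some B ->
  neps mat_crystal j (tr_mat B) = neps mat_crystal j (tr_mat A).
Proof.
move=> /mat_ke[r [m pr lr]]; have sh c := mpeak_moved j c m.
have sq := mpeak_square A i j.
have mx := mpeak_le A i.
have hA := mpeak_le (tr_mat A) j; have hB := mpeak_le (tr_mat B) j.
apply/eqP; rewrite eqn_leq; apply/andP; split.
- case: (posnP (neps mat_crystal j (tr_mat B))) => [->//|/mat_neps_attained[c hc]].
  move: (sh c) (hA c) (hA i.+1) (lr j) (mx j.+1); rewrite hc.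
  case: (eqVneq r j.+1) => [Er|] /=; last by lia.
  case: (eqVneq c i) => [Ec|] /=; last by lia.
  by move: pr; rewrite Er Ec; lia.
- case: (posnP (neps mat_crystal j (tr_mat A))) => [->//|/mat_neps_attained[c hc]].
  move: (sh c) (sh i) (hB c) (hB i) (mx j.+1); rewrite hc.
  case: (eqVneq r j) => [Er|] /=; last by lia.
  case: (eqVneq c i.+1) => [Ec|] /=; last by lia.
  move: pr; rewrite Er; move: sq; rewrite -Ec hc.
  rewrite [j == j.+1]ltn_eqF //= [i == c]ltn_eqF ?Ec //=; lia.
Qed.

Lemma mat_neps_ke_t A B i j : ke mat_crystal_t j A = Some B ->
  neps mat_crystal i B = neps mat_crystal i A.
Proof.
move=> h; have := strict_e (tr_mat_strict A) j; rewrite h /= => /mat_neps_tr.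
by move=> /(_ i); rewrite !tr_matK.
Qed.

Lemma mat_t_neps A j : neps mat_crystal_t j A = neps mat_crystal j (tr_mat A).
Proof. by rewrite (strict_neps j (tr_mat_strict A)). Qed.

Lemma mat_t_neps_ke A B i j : ke mat_crystal i A = Some B ->
  neps mat_crystal_t j B = neps mat_crystal_t j A.
Proof. by rewrite !mat_t_neps; apply: mat_neps_tr. Qed.

Lemma mat_t_ke A B j : ke mat_crystal_t j A = Some B ->
  exists c, [/\ moved (tr_mat A) (tr_mat B) c j,
    mpeak (tr_mat A) j c = (neps mat_crystal_t j A)%:Z &
    forall k, (k < c)%N -> mpeak (tr_mat A) j k < (neps mat_crystal_t j A)%:Z].
Proof.
move=> h; have := strict_e (tr_mat_strict A) j; rewrite h /= => /mat_ke.
by rewrite mat_t_neps.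
Qed.

(* With [a] the value at [i] is raised by one, with [b] the one at [i.+1] is lowered. *)
Lemma first_max_shift (h h' : nat -> int) (N : int) (c c' i : nat) (a b : bool) :
  (forall x, h' x = h x + (a && (x == i))%:Z - (b && (x == i.+1))%:Z) ->
  ~~ (a && b) -> (a -> h i < h i.+1) -> (b -> h i.+1 <= h i) ->
  (forall x, h x <= N) -> (forall x, h' x <= N) ->
  h c = N -> (forall x, (x < c)%N -> h x < N) ->
  h' c' = N -> (forall x, (x < c')%N -> h' x < N) ->
  c' = if [&& a, c == i.+1 & h i + 1 == h i.+1] then i else c.
Proof.
move=> sh nab ha hb hN hN' hc lc hc' lc'.
move: (sh c) (sh c') (sh i) (sh i.+1) (lc c') (lc' c) (lc i) (lc' i) (hN i) (hN i.+1)
  (hN' i) (hN' i.+1) (lc i.+1) (lc' i.+1) hc hc' (hN c') (hN' c).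
case: a b nab ha hb {sh lc lc' hN hN'} => [] [] //= _ ha hb.
- have {hb} ha := ha isT; rewrite !subr0.
  case: (eqVneq c i.+1) => [->|E1] /=; last first.
    by case: (eqVneq c' i) => [->|E2]; case: (eqVneq c i) => [->|E3]; lia.
  rewrite [i.+1 == i]gtn_eqF //=.
  case: (eqVneq c' i) => [->|E2]; first by case: (h i + 1 =P h i.+1); lia.
  by case: (eqVneq c' i.+1) => [->|E3]; case: (h i + 1 =P h i.+1); lia.
- have {ha} hb := hb isT.
  case: (eqVneq c i.+1) => [->|E1] /=; case: (eqVneq c' i.+1) => [->|E2]; try lia.
- lia.
Qed.

(** Each operator leaves the position chosen by the other unchanged, with one exception: r = j+1, c
    = i+1 and heights that differ by one. There both positions change, to j and to i. *)
Lemma mat_ke_comm A B A' B1 B2 i j :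
  ke mat_crystal i A = Some B -> ke mat_crystal_t j A = Some A' ->
  ke mat_crystal_t j B = Some B1 -> ke mat_crystal i A' = Some B2 -> B1 = B2.
Proof.
move=> eB eA' eB1 eB2.
have nB := mat_t_neps_ke j eB; have nA' := mat_neps_ke_t i eA'.
have [r [mr pr lr]] := mat_ke eB; have [c [mc pc lc]] := mat_t_ke eA'.
have [c' [mc' pc' lc']] := mat_t_ke eB1; have [r' [mr' pr' lr']] := mat_ke eB2.
have sq := mpeak_square A i j.
have Ec : c' = if [&& r == j.+1, c == i.+1 &
    mpeak (tr_mat A) j i + 1 == mpeak (tr_mat A) j i.+1] then i else c.
  apply: (@first_max_shift (mpeak (tr_mat A) j) (mpeak (tr_mat B) j)
    (neps mat_crystal_t j A)%:Z c c' i (r == j.+1) (r == j)) => //.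
  - by move=> x; rewrite (mpeak_moved j x mr).
  - by lia.
  - by move=> /eqP E; move: (lr j) pr; rewrite E; lia.
  - by move=> /eqP E; move: (mpeak_le A i j.+1) pr; rewrite E; lia.
  - by move=> x; rewrite mat_t_neps mpeak_le.
  - by move=> x; rewrite -nB mat_t_neps mpeak_le.
  - by rewrite -nB.
  - by rewrite -nB.
have Er : r' = if [&& c == i.+1, r == j.+1 & mpeak A i j + 1 == mpeak A i j.+1]
    then j else r.
  apply: (@first_max_shift (mpeak A i) (mpeak A' i)
    (neps mat_crystal i A)%:Z r r' j (c == i.+1) (c == i)) => //.
  - by move=> x; have := mpeak_moved i x mc; rewrite !tr_matK.
  - by lia.
  - move=> /eqP E; move: (lc i) pc; rewrite E; lia.
  - move=> /eqP E; have := mpeak_le (tr_mat A) j i.+1.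
    by move: pc; rewrite E mat_t_neps; lia.
  - by move=> x; rewrite mpeak_le.
  - by move=> x; rewrite -nA' mpeak_le.
  - by rewrite -nA'.
  - by rewrite -nA'.
(* By [mpeak_square] the exception is the same for both orders of the operators. *)
have {Er} Er : r' = if [&& r == j.+1, c == i.+1 &
    mpeak (tr_mat A) j i + 1 == mpeak (tr_mat A) j i.+1] then j else r.
  by rewrite Er andbCA; congr (if [&& _, _ & _] then _ else _); lia.
(* In the exceptional case both orders carry one unit from (j+1, i+1) to (j, i), one through (j+1,
   i) and the other through (j, i+1). *)
apply/fsfunP => -[k l].
move: (mr k l) (mr' k l) (mc l k) (mc' l k); rewrite !tr_matE Ec Er.
case: ifP => [/and3P[/eqP-> /eqP-> _]|_]; lia.
Qed.

Lemma mat_comm i j : commuting (ke mat_crystal i) (ke mat_crystal_t j).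
Proof.
move=> A.
case: (sn_eP (mat_seminormal A) i) => [[eA n0]|[B [eB n0]]];
  case: (sn_eP (mat_t_seminormal A) j) => [[eA' m0]|[A' [eA' m0]]];
  rewrite ?eA ?eB eA' //.
- by apply/(sn_e0 (mat_seminormal _)); rewrite (mat_neps_ke_t i eA').
- by apply/esym/(sn_e0 (mat_t_seminormal _)); rewrite (mat_t_neps_ke j eB).
- case: (sn_eP (mat_seminormal A') i) => [[_]|[B2 [eB2 _]]].
    by rewrite (mat_neps_ke_t i eA'); lia.
  case: (sn_eP (mat_t_seminormal B) j) => [[_]|[B1 [eB1 _]]].
    by rewrite (mat_t_neps_ke j eB); lia.
  rewrite -[LHS]/(ke mat_crystal i A') -[RHS]/(ke mat_crystal_t j B).
  by rewrite eB1 eB2 (mat_ke_comm eB eA' eB1 eB2).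
Qed.

(** * Similar elements and doubly highest weight matrices *)

Section Run.
Variables (T : Type) (C : crystal T).

Definition step (si : bool * nat) (b : T) : option T :=
  if si.1 then ke C si.2 b else kf C si.2 b.

Fixpoint run (p : seq (bool * nat)) (b : T) : option T :=
  if p is si :: p' then obind (run p') (step si b) else Some b.

Definition flip (si : bool * nat) := (~~ si.1, si.2).

Lemma run_cat p q b : run (p ++ q) b = obind (run q) (run p b).
Proof. by elim: p b => //= si p IH b; case: (step si b). Qed.

Lemma step_flip si b b' : seminormal C -> step si b = Some b' -> step (flip si) b' = Some b.
Proof.
by case: si => -[] i sn /=; rewrite /step /= => h;
  [have [] := sn_e (sn b) h|have [] := sn_f (sn b) h].
Qed.

Lemma run_rev p b b' : seminormal C -> run p b = Some b' ->
  run (rev (map flip p)) b' = Some b.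
Proof.
move=> sn; elim: p b => [|si p IH] b /=; first by case=> ->.
case h: (step si b) => [b1|] //= /IH; rewrite rev_cons -cats1 run_cat => -> /=.
by rewrite (step_flip sn h).
Qed.

Lemma run_inj p x y z : seminormal C ->
  run p x = Some z -> run p y = Some z -> x = y.
Proof. by move=> sn /(run_rev sn) h /(run_rev sn); rewrite h => -[]. Qed.

Definition hw (b : T) := forall i, ke C i b = None.

Lemma reach_hw (m : T -> nat) :
  (forall i b b', ke C i b = Some b' -> (m b' < m b)%N) ->
  forall b, exists p b', run p b = Some b' /\ hw b'.
Proof.
move=> hm b; have [n] := ubnP (m b); elim: n b => // n IH b le_n.
case: (pselect (hw b)) => [h|/existsNP[i]]; first by exists [::], b.
case eb: (ke C i b) => [c|] // _.
have [|p [b' [h1 h2]]] := IH c; first by have := hm _ _ _ eb; lia.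
by exists ((true, i) :: p), b'; rewrite /= /step /= eb.
Qed.

End Run.

Section Sim.
Variables (T T' : Type) (C : crystal T) (C' : crystal T').

(* Every path of operators is defined on both elements or on neither. *)
Definition sim (x : T) (y : T') : Prop :=
  forall p, omap (wt C) (run C p x) = omap (wt C') (run C' p y).

Definition lift (R : T -> T' -> Prop) (o : option T) (o' : option T') : Prop :=
  match o, o' with
  | Some a, Some b => R a b
  | None, None => True
  | _, _ => False
  end.

Lemma sim_wt x y : sim x y -> wt C x = wt C' y.
Proof. by move/(_ [::]) => []. Qed.

Lemma sim_step x y si : sim x y -> lift sim (step C si x) (step C' si y).
Proof.
move=> h; have h1 := h [:: si]; have h2 p := h (si :: p); move: h1 h2 => /=.
by case: (step C si x) => [a|]; case: (step C' si y).
Qed.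

Lemma sim_run x y p : sim x y -> lift sim (run C p x) (run C' p y).
Proof.
elim: p x y => //= si p IH x y /(sim_step si).
by case: (step C si x) => [a|]; case: (step C' si y) => [b|] //= /IH.
Qed.

(** Reduces similarity to a check of single steps, by induction on the path. *)
Lemma bisim (R : T -> T' -> Prop) :
  (forall x y, R x y -> wt C x = wt C' y) ->
  (forall x y si, R x y -> lift R (step C si x) (step C' si y)) ->
  forall x y, R x y -> sim x y.
Proof.
move=> hw hs x y + p; elim: p x y => [|si p IH] x y h /=; first by rewrite (hw x y).
by have := hs x y si h; case: (step C si x) => [a|]; case: (step C' si y) => [b|] //= /IH.
Qed.

Lemma strict_sim f x : strict C C' f -> sim x (f x).
Proof.
move=> sf; apply: (@bisim (fun x y => y = f x)) => // [{}x _ ->|{}x _ [s i] ->].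
  by rewrite (strict_wt (sf x)).
by case: s; rewrite /step /= (strict_e (sf x), strict_f (sf x));
  [case: (ke C i x)|case: (kf C i x)].
Qed.

Lemma sim_hw x y : sim x y -> hw C x -> hw C' y.
Proof.
move=> h hx i; have := sim_step (true, i) h; rewrite /step /= hx.
by case: (ke C' i y).
Qed.

Hypothesis sn : seminormal C.
Hypothesis sn' : seminormal C'.

(** Raising strings in direction i stop on both sides at the same time, and their length is
    epsilon. *)
Lemma sim_neps x y i : sim x y -> neps C i x = neps C' i y.
Proof.
have [n] := ubnP (neps C i x); elim: n x y => // n IH x y le_n h.
have := sim_step (true, i) h; rewrite /step /=.
case: (sn_eP (sn x) i) => [[-> n0]|[x' [ex n0]]];
  case: (sn_eP (sn' y) i) => [[ey m0]|[y' [ey m0]]]; rewrite ?ex ey //= ?n0 ?m0 // => h'.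
have [_ nx _ _] := sn_e (sn x) ex; have [_ ny _ _] := sn_e (sn' y) ey.
have := IH x' y' _ h'; rewrite (nepsE nx) (nepsE ny) => E.
by have := E ltac:(lia); lia.
Qed.

Lemma sim_nphi x y i : sim x y -> nphi C i x = nphi C' i y.
Proof.
move=> h; have := sn_wt (sn x) i; have := sn_wt (sn' y) i.
by rewrite (sim_wt h) (sim_neps i h); lia.
Qed.

End Sim.

Lemma sim_sym (T T' : Type) (C : crystal T) (C' : crystal T') x y :
  sim C C' x y -> sim C' C y x.
Proof. by move=> h p; rewrite h. Qed.

Lemma sim_trans (T T' T'' : Type) (C : crystal T) (C' : crystal T')
    (C'' : crystal T'') x y z : sim C C' x y -> sim C' C'' y z -> sim C C'' x z.
Proof. by move=> h h' p; rewrite h. Qed.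

(** The bound [n] is free, so that two matrices can be compared over the same range of rows. *)
Lemma words_wt_mat (A : Mat) n c : (nrows A <= n)%N ->
  wcoef (wt mat_crystal A) c = (\sum_(k < n) A (nat_of_ord k, c))%N%:Z.
Proof.
move=> hn; rewrite -(strict_wt (mat_rows_strict A)).
have -> : (\sum_(k < n) A (nat_of_ord k, c) = \sum_(w <- mat_rows A) count_mem c w)%N.
  rewrite (big_nth [::]) size_mat_rows big_mkord.
  rewrite (big_ord_widen n (fun k => count_mem c (nth [::] (mat_rows A) k)) hn).
  rewrite [RHS]big_mkcond /=; apply: eq_bigr => k _.
  rewrite nth_mat_rows count_rev mat_row_count; case: ltnP => // h.
  by case: (A (nat_of_ord k, c) =P 0%N) => // /mat_lt[]; rewrite ltnNge h.
elim: (mat_rows A) => [|w ws IH]; first by rewrite /= /seq_wt !big_nil /wcoef mcoeff0.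
have -> : wt (seq_crystal words) (w :: ws) = wt words w + wt (seq_crystal words) ws.
  by rewrite /= /seq_wt big_cons.
by rewrite big_cons wcoefD IH words_wt; lia.
Qed.

Lemma mat_wt_ke_t A B j : ke mat_crystal_t j A = Some B -> wt mat_crystal B = wt mat_crystal A.
Proof.
case/mat_t_ke => r [m _ _]; apply: wcoefP => c.
have [n [nA nB nj]] : exists n, [/\ nrows A <= n, nrows B <= n & j.+1 < n]%N.
  by exists (nrows A + nrows B + j.+2)%N; split; lia.
rewrite (words_wt_mat c nA) (words_wt_mat c nB).
(* A unit goes from row j+1 to row j within column r. The indicators record which of the two rows
   lie among the first [p], and they cancel once p exceeds j+1. *)
suff E p : ((\sum_(k < p) B (nat_of_ord k, c)) + ((c == r) && (j.+1 < p)%N) =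
    (\sum_(k < p) A (nat_of_ord k, c)) + ((c == r) && (j < p)))%N.
  by have := E n; rewrite nj (ltnW nj) => /addIn ->.
elim: p => [|p IH]; first by rewrite !big_ord0 !ltn0.
rewrite !big_ord_recr /=; have := m c p; rewrite !tr_matE; move: IH.
move: (\sum_(k < p) B _)%N (\sum_(k < p) A _)%N (A (p, c)) (B (p, c)); lia.
Qed.

Lemma mat_sim_ke_t A B j : ke mat_crystal_t j A = Some B -> sim mat_crystal mat_crystal A B.
Proof.
have sn := mat_seminormal; have snt := mat_t_seminormal.
apply: (@bisim _ _ _ _ (fun x y => ke mat_crystal_t j x = Some y)) => {A B}
  [A B /mat_wt_ke_t->//|A B [s i] h].
have hwt := mat_wt_ke_t h; have he := mat_neps_ke_t i h.
have h0 : (0 < neps mat_crystal_t j A)%N.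
  by case: (sn_eP (snt A) j) => [[]|[_ [_]]] //; rewrite h.
case: s.
- change (lift (fun x y => ke mat_crystal_t j x = Some y)
    (ke mat_crystal i A) (ke mat_crystal i B)).
  have E : ke mat_crystal i B = obind (ke mat_crystal_t j) (ke mat_crystal i A).
    by rewrite -mat_comm h.
  rewrite E; case eA: (ke mat_crystal i A) => [A'|] //.
  case: (sn_eP (snt A') j) => [[_]|[B' [eB' _]]]; last by rewrite [obind _ _]eB'.
  by rewrite (mat_t_neps_ke j eA); lia.
(* Commutation is known for raising operators only, so f_i is handled backwards: with A' = f_i A and
   B' the image of A' under the transposed e_j, commutation gives e_i B' = B, hence f_i B = B'. *)
- change (lift (fun x y => ke mat_crystal_t j x = Some y)
    (kf mat_crystal i A) (kf mat_crystal i B)).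
  have hp : nphi mat_crystal i B = nphi mat_crystal i A.
    by have := sn_wt (sn A) i; have := sn_wt (sn B) i; rewrite hwt he; lia.
  case: (sn_fP (sn A) i) => [[-> n0]|[A' [fA n0]]].
    by case: (sn_fP (sn B) i) => [[-> //]|[_ [_]]]; lia.
  have [_ _ _ eA'] := sn_f (sn A) fA; rewrite fA.
  case: (sn_eP (snt A') j) => [[_]|[B' [eB' _]]].
    by rewrite -(mat_t_neps_ke j eA'); lia.
  have E : ke mat_crystal i B' = Some B by have := mat_comm i j A'; rewrite eB' eA' -h.
  by have [_ _ _ ->] := sn_e (sn B') E.
Qed.

Lemma mat_sim_run_t A B p : run mat_crystal_t p A = Some B -> sim mat_crystal mat_crystal A B.
Proof.
elim: p A => [|[s j] p IH] A /=; first by case=> ->.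
case h: (step _ _ A) => [A'|] //= /IH; apply: sim_trans.
case: s h; rewrite /step /= => h; first exact: mat_sim_ke_t h.
have [_ _ _ h'] := sn_f (mat_t_seminormal A) h.
exact: sim_sym (mat_sim_ke_t h').
Qed.

Lemma run_strict (T T' : Type) (C : crystal T) (C' : crystal T') f p x :
  strict C C' f -> run C' p (f x) = omap f (run C p x).
Proof.
move=> sf; elim: p x => //= -[s i] p IH x; rewrite /step /=.
by case: s; rewrite (strict_e (sf x), strict_f (sf x));
  [case: (ke C i x)|case: (kf C i x)] => //= c; rewrite IH.
Qed.

Lemma mat_t_sim_run A B p : run mat_crystal p A = Some B ->
  sim mat_crystal_t mat_crystal_t A B.
Proof.
move=> h; have := run_strict p A tr_mat_strict'; rewrite h /= => /mat_sim_run_t h'.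
apply: sim_trans (strict_sim _ tr_mat_strict) _; apply: sim_trans h' _.
exact: sim_sym (strict_sim _ tr_mat_strict).
Qed.

(** All heights are at most 0. By induction the rows before row k vanish above the diagonal, so
    nothing has been subtracted from the height of column i+1 when row k is reached, and that height
    is at least the entry in question. *)
Lemma hw_diag_upper A k l : hw mat_crystal A -> (k < l)%N -> A (k, l) = 0%N.
Proof.
move=> hA; have n0 i : neps mat_crystal i A = 0%N by apply/(sn_e0 (mat_seminormal A)).
have pk i n : mpeak A i n <= 0 by rewrite -[0]/(0%N%:Z) -(n0 i) mpeak_le.
have [m] := ubnP k; elim: m k l => // m IH k [//|i] km ki.
have gen n : (n <= k)%N -> (A (n, i.+1))%:Z <= mpeak A i n /\ 0 <= mpeak A i n.
  elim: n => [|n IHn] hn; first by rewrite /mpeak peak0; lia.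
  by rewrite mpeakS (IH n i); lia.
by have [] := gen k (leqnn k); have := pk i k; lia.
Qed.

Lemma hw_t_tr A : hw mat_crystal_t A -> hw mat_crystal (tr_mat A).
Proof. by move=> h; apply: sim_hw h; apply: strict_sim tr_mat_strict. Qed.

Lemma bihw_diag A k l : hw mat_crystal A -> hw mat_crystal_t A -> k != l -> A (k, l) = 0%N.
Proof.
move=> h /hw_t_tr ht; rewrite neq_ltn => /orP[]; first exact: hw_diag_upper.
by rewrite -tr_matE; apply: hw_diag_upper.
Qed.

Lemma bihw_wt A k : hw mat_crystal A -> hw mat_crystal_t A ->
  wcoef (wt mat_crystal A) k = (A (k, k))%:Z.
Proof.
move=> h ht; pose n := maxn (nrows A) k.+1.
rewrite (@words_wt_mat A n) ?leq_maxl //; congr Posz.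
have kn : (k < n)%N by rewrite /n leq_maxr.
rewrite (bigD1 (Ordinal kn)) //= big1 ?addn0 // => l hl.
by apply: bihw_diag => //; apply: contra hl => /eqP E; apply/eqP/val_inj.
Qed.

Lemma bihw_uniq A B : hw mat_crystal A -> hw mat_crystal_t A ->
  hw mat_crystal B -> hw mat_crystal_t B ->
  wt mat_crystal A = wt mat_crystal B -> A = B.
Proof.
move=> hA hA' hB hB' hwt; apply/fsfunP => -[k l].
case: (eqVneq k l) => [<-|ne]; last by rewrite !bihw_diag.
by have := bihw_wt k hA hA'; rewrite hwt bihw_wt // => -[].
Qed.

Lemma bihw_tr A : hw mat_crystal A -> hw mat_crystal_t A -> tr_mat A = A.
Proof.
move=> h ht; apply/fsfunP => -[k l]; rewrite tr_matE.
case: (eqVneq k l) => [->//|ne]; rewrite !bihw_diag // eq_sym //.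
Qed.

(** The height at row k consists of off-diagonal entries and is 0, so the next one is the difference
    of the two diagonal entries and cannot be positive. Hence the diagonal is a partition. *)
Lemma bihw_decr A k : hw mat_crystal A -> hw mat_crystal_t A ->
  (A (k.+1, k.+1) <= A (k, k))%N.
Proof.
move=> h ht; have n0 : neps mat_crystal k A = 0%N by apply/(sn_e0 (mat_seminormal A)).
have := mpeak_le A k k.+1; rewrite n0 mpeakS.
suff -> : mpeak A k k = 0 by lia.
have up n : (n <= k)%N -> mpeak A k n = 0.
  elim: n => [|n IH] hn; first by rewrite /mpeak peak0 hw_diag_upper.
  rewrite mpeakS IH ?(ltnW hn) // !bihw_diag //; lia.
exact: up.
Qed.

Definition mat_weight (A : Mat) : nat := sumn (map sumn (mat_rows A)).

Lemma words_sumn_e i w w' : ke words i w = Some w' -> (sumn w' < sumn w)%N.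
Proof.
by case/words_ke_split => u [v [-> -> _ _]]; rewrite !sumn_cat /=; lia.
Qed.

Lemma mat_weight_e i A B : ke mat_crystal i A = Some B -> (mat_weight B < mat_weight A)%N.
Proof.
move=> h; have := strict_e (mat_rows_strict A) i; rewrite h /=.
case/(seq_ke_split words_seminormal) => u [b [c [v [E E' eb _ _]]]].
rewrite /mat_weight E E' !map_cat !sumn_cat /=; have := words_sumn_e eb; lia.
Qed.

Lemma mat_reach_hw A : exists p B, run mat_crystal p A = Some B /\ hw mat_crystal B.
Proof. exact: reach_hw mat_weight_e A. Qed.

Lemma mat_t_reach_hw A : exists p B, run mat_crystal_t p A = Some B /\ hw mat_crystal_t B.
Proof.
apply: (@reach_hw _ _ (fun A => mat_weight (tr_mat A))) => i {}A B h.
by have := strict_e (tr_mat_strict A) i; rewrite h /= => /mat_weight_e.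
Qed.

(** Raising in the second structure preserves similarity for the first one, hence also being of
    highest weight there. The path is recorded because it will be reversed. *)
Lemma mat_hw_diag A : hw mat_crystal A ->
  exists D, [/\ hw mat_crystal D, hw mat_crystal_t D, sim mat_crystal mat_crystal A D
    & exists p, run mat_crystal_t p A = Some D].
Proof.
move=> hA; have [p [D [h1 h2]]] := mat_t_reach_hw A; exists D.
have s := mat_sim_run_t h1; split=> //; first exact: sim_hw s hA.
by exists p.
Qed.

(** One letter per row: words become matrices, so that the uniqueness of doubly highest weight
    matrices applies to readings of tableaux. *)
Definition mat_of_word (w : seq nat) : Mat := mat_of [seq [:: x] | x <- w].

Lemma mat_of_word_sim w : sim words mat_crystal w (mat_of_word w).
Proof.
apply: sim_trans (strict_sim _ (map_strict (singleton_strict natural_seminormal))) _.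
have E : mat_rows (mat_of_word w) = [seq [:: x] | x <- w].
  apply: mat_ofK; apply/andP; split; first by apply/allP => _ /mapP[x _ ->].
  by case: (lastP w) => // {}w x; rewrite map_rcons last_rcons.
by rewrite -E; apply: sim_sym; apply: strict_sim mat_rows_strict.
Qed.

Lemma words_hw_diag w : hw words w -> exists D,
  [/\ hw mat_crystal D, hw mat_crystal_t D & sim words mat_crystal w D].
Proof.
move=> h; have [D [h1 h2 h3 _]] := mat_hw_diag (sim_hw (mat_of_word_sim w) h).
by exists D; split=> //; apply: sim_trans (mat_of_word_sim w) h3.
Qed.

(** * Tableaux *)

Local Close Scope ring_scope.

Local Notation part mu k := (nth 0%N (val mu) k).

Lemma geq_trans : transitive geq.
Proof. by move=> a b c /= h1 h2; apply: leq_trans h2 h1. Qed.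

Lemma part_conj (mu : partition) k l : (l < part mu k) = (k < conj_part mu l).
Proof.
rewrite /conj_part; have /andP[] := valP mu; move: (val mu) => s + _.
elim: s k => [|x s IH] k; first by rewrite nth_nil !ltn0.
move=> hs; have hs' := path_sorted hs.
have z : x <= l -> count (fun m => l < m) s = 0.
  move=> h; apply/eqP; rewrite eqn0Ngt -has_count; apply/hasPn => y hy; rewrite -leqNgt.
  by have /allP/(_ y hy) /= := order_path_min geq_trans hs; lia.
case: k => [|k] /=; first by case: ltnP => // /z ->.
by rewrite IH //; case: (ltnP l x) => [_|/z ->]; rewrite ?add1n ?ltnS ?ltn0.
Qed.

Definition entry (t : seq (seq nat)) (k l : nat) : nat := nth 0 (nth [::] t k) l.

(** Only cells of the diagram are constrained; [F] is arbitrary elsewhere. *)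
Definition sst_fun (mu : partition) (F : nat -> nat -> nat) : Prop :=
  (forall k l, l.+1 < part mu k -> F k l <= F k l.+1) /\
  (forall k l, l < part mu k.+1 -> F k l < F k.+1 l).

Lemma nth_fill mu F k : nth [::] (fill mu F) k = mkseq (F k) (part mu k).
Proof.
case: (ltnP k (plength mu)) => h; first by rewrite nth_mkseq.
by rewrite nth_default ?size_mkseq // [part mu k]nth_default.
Qed.

Lemma eq_fill mu F G : (forall k l, l < part mu k -> F k l = G k l) ->
  fill mu F = fill mu G.
Proof.
move=> h; apply: eq_map => k; apply/eq_in_map => l.
by rewrite mem_iota; apply: h.
Qed.

Lemma sst_fillK mu t : is_sst mu t -> t = fill mu (entry t).
Proof.
case/and3P => /eqP sh _ _; have sz : size t = plength mu by rewrite /plength -sh size_map.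
apply: (@eq_from_nth _ [::]); first by rewrite size_mkseq.
move=> k; rewrite sz => hk; rewrite nth_fill.
have sk : size (nth [::] t k) = part mu k by rewrite -sh (nth_map [::]) ?sz.
apply: (@eq_from_nth _ 0); first by rewrite size_mkseq.
by move=> l; rewrite sk => hl; rewrite nth_mkseq.
Qed.

Lemma sst_funP mu t : is_sst mu t -> sst_fun mu (entry t).
Proof.
case/and3P => /eqP sh rows cols.
have sz : size t = plength mu by rewrite /plength -sh size_map.
have sk k : size (nth [::] t k) = part mu k.
  case: (ltnP k (size t)) => h; first by rewrite -sh (nth_map [::]).
  by rewrite [nth [::] t k]nth_default // [part mu k]nth_default // -[size _]sz.
split=> k l h.
- have hk : k < size t.
    by rewrite ltnNge; apply/negP => hk; move: h; rewrite -sk nth_default.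
  have /(sortedP 0) := allP rows _ (mem_nth [::] hk); apply; by rewrite sk.
- have hk : k.+1 < size t.
    by rewrite ltnNge; apply/negP => hk; move: h; rewrite -sk nth_default.
  have /(sortedP [::])/(_ k hk)/allP := cols; apply.
  by rewrite mem_iota sk.
Qed.

Lemma sst_fun_fill mu F : sst_fun mu F -> is_sst mu (fill mu F).
Proof.
case=> hr hc; apply/and3P; split.
- apply/eqP/(@eq_from_nth _ 0); first by rewrite size_map size_mkseq.
  move=> i; rewrite size_map size_mkseq => lt_i.
  by rewrite (nth_map [::]) ?size_mkseq // nth_fill size_mkseq.
- apply/allP => r /mapP[k _ ->]; apply/(sortedP 0) => l; rewrite size_mkseq => h.
  by rewrite !nth_mkseq ?(ltnW h) //; apply: hr.
- apply/(sortedP [::]) => k; rewrite size_mkseq => hk.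
  rewrite !nth_fill; apply/allP => l; rewrite mem_iota add0n size_mkseq /= => h.
  rewrite !nth_mkseq //; first exact: hc.
  by apply: leq_trans h (nth_part_geq _ _).
Qed.

(** * Column readings of fillings *)

Section Columns.
Variable mu : partition.

Definition fcol (F : nat -> nat -> nat) (j : nat) : seq nat :=
  mkseq (fun k => F k j) (conj_part mu j).

Fixpoint fcols F (n : nat) : seq nat :=
  if n is n'.+1 then fcol F n' ++ fcols F n' else [::].

(** For j < n, the part of [fcols F n] that is read before column j. *)
Fixpoint fcols_right F (n j : nat) : seq nat :=
  if n is n'.+1 then if j == n' then [::] else fcol F n' ++ fcols_right F n' j
  else [::].

Lemma column_fill F j : column (fill mu F) j = fcol F j.
Proof.
rewrite /column /fill filter_map -map_comp /fcol /mkseq.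
have -> : filter (preim (fun k => mkseq (F k) (part mu k)) (fun r => j < size r))
    (iota 0 (plength mu)) = iota 0 (conj_part mu j).
  have le : conj_part mu j <= plength mu by apply: count_size.
  rewrite -{1}(subnKC le) iotaD filter_cat [X in _ ++ X](_ : _ = [::]) ?cats0.
    apply/all_filterP/allP => k; rewrite mem_iota add0n /= => h.
    by rewrite size_mkseq part_conj.
  rewrite -(filter_pred0 (iota (0 + conj_part mu j) (plength mu - conj_part mu j))).
  apply: eq_in_filter => k; rewrite mem_iota add0n /= size_mkseq part_conj.
  by case/andP => h _; rewrite ltnNge h.
apply/eq_in_map => k; rewrite mem_iota add0n /= => h.
by rewrite nth_mkseq // part_conj.
Qed.

Lemma reading_fill F : reading (fill mu F) = fcols F (part mu 0).
Proof.
rewrite /reading; have -> : size (head [::] (fill mu F)) = part mu 0.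
  by rewrite -nth0 nth_fill size_mkseq.
elim: (part mu 0) => // n IH; rewrite -(addn1 n) iotaD rev_cat /= addn1 /=.
by rewrite column_fill IH.
Qed.

Lemma fcols_cut F n j : j < n -> fcols F n = fcols_right F n j ++ fcol F j ++ fcols F j.
Proof.
elim: n => // n IH; rewrite ltnS leq_eqVlt /=; case: eqP => [->//|_] /= h.
by rewrite IH // catA.
Qed.

Lemma mem_fcol F j x : reflect (exists2 k, k < conj_part mu j & x = F k j) (x \in fcol F j).
Proof.
apply: (iffP mapP) => -[k]; rewrite ?mem_iota /= => h ->; first by exists k.
by exists k; rewrite ?mem_iota.
Qed.

Lemma mem_fcols_right F n j x : j < n -> x \in fcols_right F n j ->
  exists j' k, [/\ j < j', k < conj_part mu j' & x = F k j'].
Proof.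
elim: n => // n IH; rewrite ltnS leq_eqVlt /=; case: eqP => //= _ h.
rewrite mem_cat => /orP[/mem_fcol[k hk ->]|]; last exact: IH.
by exists n, k.
Qed.

Lemma fcols_right_next F n j : j.+1 < n ->
  exists U, fcols_right F n j = U ++ fcol F j.+1.
Proof.
elim: n => // n IH; rewrite ltnS leq_eqVlt /= => /orP[/eqP <-|h].
  by rewrite [j == j.+1]ltn_eqF //= eqxx cats0; exists [::].
have [U ->] := IH h; rewrite ltn_eqF ?(ltnW h) //.
by exists (fcol F n ++ U); rewrite catA.
Qed.

Lemma eq_fcols F G n : (forall k j, j < n -> F k j = G k j) -> fcols F n = fcols G n.
Proof.
elim: n => //= n IH h; rewrite IH => [|k j hj]; last by rewrite h // ltnW.
by congr (_ ++ _); apply: eq_map => k; rewrite h.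
Qed.

Lemma eq_fcols_right F G n j : (forall k j', j < j' -> F k j' = G k j') -> j < n ->
  fcols_right F n j = fcols_right G n j.
Proof.
move=> h; elim: n => //= n IH; rewrite ltnS leq_eqVlt; case: eqP => //= _ hj.
by rewrite IH //; congr (_ ++ _); apply: eq_map => k; rewrite h.
Qed.

Lemma mkseq_cut (f : nat -> nat) n k : k < n ->
  mkseq f n = mkseq f k ++ f k :: [seq f x | x <- iota k.+1 (n - k.+1)].
Proof.
move=> h; rewrite /mkseq -{1}(subnKC h) iotaD map_cat add0n.
by rewrite -addn1 iotaD map_cat /= -catA.
Qed.

Lemma fcols_split F n u x v : fcols F n = u ++ x :: v -> exists j k,
  [/\ j < n, k < conj_part mu j, x = F k j,
      u = fcols_right F n j ++ mkseq (fun k => F k j) k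
    & v = [seq F y j | y <- iota k.+1 (conj_part mu j - k.+1)] ++ fcols F j].
Proof.
elim: n u => [|n IH] u /=; first by case: u.
move=> E; case: (ltnP (size u) (conj_part mu n)) => h.
  exists n, (size u); rewrite ltnSn h eqxx /=.
  move/eqP: E; rewrite /fcol (mkseq_cut (fun k => F k n) h) -catA cat_cons.
  by rewrite eqseq_cat ?size_mkseq // eqseq_cons => /and3P[/eqP E1 /eqP E2 /eqP E3].
move: E; rewrite -{1}(cat_take_drop (conj_part mu n) u) -catA => /eqP.
rewrite eqseq_cat ?size_mkseq ?size_takel // => /andP[/eqP E1 /eqP E2].
have [j [k [h1 h2 h3 h4 h5]]] := IH _ E2; exists j, k; split=> //; first exact: ltnW.
by rewrite ltn_eqF // -catA -h4 E1 cat_take_drop.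
Qed.

End Columns.

Lemma words_neps_cat i u v :
  neps words i (u ++ v) = neps words i u + (neps words i v - nphi words i u).
Proof. exact: neps_cat natural_seminormal _ _ _. Qed.

Lemma words_nphi_cat i u v :
  nphi words i (u ++ v) = nphi words i v + (nphi words i u - neps words i v).
Proof. exact: nphi_cat natural_seminormal _ _ _. Qed.

(** * Stability of tableaux under the operators, and extremal tableaux *)

Section SstFun.
Variables (mu : partition) (F : nat -> nat -> nat).
Hypothesis sF : sst_fun mu F.

Lemma sst_row k l l' : l <= l' -> k < conj_part mu l' -> F k l <= F k l'.
Proof.
elim: l' => [|l' IH]; first by rewrite leqn0 => /eqP ->.
rewrite leq_eqVlt => /orP[/eqP -> //|]; rewrite ltnS => h hk.
have hk' : l'.+1 < part mu k by rewrite part_conj.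
apply: leq_trans (sF.1 _ _ hk'); apply: IH => //.
by rewrite -part_conj ltnW.
Qed.

Lemma sst_col k k' l : k < k' -> k' < conj_part mu l -> F k l < F k' l.
Proof.
elim: k' => // k' IH; rewrite ltnS leq_eqVlt => /orP[/eqP -> |h] hk.
  by apply: sF.2; rewrite part_conj.
by apply: leq_trans (IH h (ltnW hk)) (ltnW _); apply: sF.2; rewrite part_conj.
Qed.

Lemma sst_ge k l : k < conj_part mu l -> k <= F k l.
Proof.
elim: k => // k IH h; apply: leq_ltn_trans (IH (ltnW h)) _.
exact: sst_col.
Qed.

Lemma fcol_uniq l : uniq (fcol mu F l).
Proof.
rewrite map_inj_in_uniq ?iota_uniq // => k k'; rewrite !mem_iota !add0n /= => h h'.
by case: (ltngtP k k') => // hk; [have := sst_col hk h'|have := sst_col hk h]; lia.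
Qed.

Lemma conj_part_le l l' : l <= l' -> conj_part mu l' <= conj_part mu l.
Proof. by move=> h; apply: sub_count => m /= /(leq_ltn_trans h). Qed.

Lemma conj_part_gt0 l : 0 < conj_part mu l -> l < part mu 0.
Proof. by rewrite -part_conj. Qed.

Let rest k l := [seq F y l | y <- iota k.+1 (conj_part mu l - k.+1)].

Lemma mem_rest k l x : x \in rest k l ->
  exists2 k', k < k' < conj_part mu l & x = F k' l.
Proof.
case/mapP => k'; rewrite mem_iota => h ->; exists k' => //; lia.
Qed.

Lemma mem_above k l x : x \in mkseq (fun k => F k l) k -> exists2 k', k' < k & x = F k' l.
Proof. by case/mapP => k'; rewrite mem_iota => h ->; exists k'. Qed.

Definition update (k j x : nat) : nat -> nat -> nat :=
  fun k' j' => if (k' == k) && (j' == j) then x else F k' j'.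

Lemma fcols_update n k j x : j < n -> k < conj_part mu j ->
  fcols mu (update k j x) n =
    fcols_right mu F n j ++ mkseq (fun k => F k j) k ++ x :: rest k j ++ fcols mu F j.
Proof.
move=> hj hk; rewrite (fcols_cut _ _ hj) (@eq_fcols_right mu _ F) //; last first.
  by move=> k' j' h; rewrite /update [j' == j]gtn_eqF // andbF.
rewrite (@eq_fcols mu _ F) //; last first.
  by move=> k' j' h; rewrite /update [j' == j]ltn_eqF // andbF.
rewrite /fcol (mkseq_cut _ hk) -catA {2}/update !eqxx /=.
congr (_ ++ _); congr (_ ++ _); last (congr (_ :: _); congr (_ ++ _)).
  apply/eq_in_map => k'; rewrite mem_iota => h.
  by rewrite /update [k' == k]ltn_eqF.
apply/eq_in_map => k'; rewrite mem_iota => h.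
by rewrite /update [k' == k]gtn_eqF //; lia.
Qed.

Lemma fcols_update_e i w : ke words i (fcols mu F (part mu 0)) = Some w ->
  exists G, sst_fun mu G /\ w = fcols mu G (part mu 0).
Proof.
case/words_ke_split => u [v [E -> pu ev]].
have [j [k [hj hk Ex Eu Ev]]] := fcols_split E.
exists (update k j i); split; last by rewrite fcols_update // Eu Ev -catA.
(* An i above the cell would remain free, as the column has no i+1 above the cell, against phi(u) =
   0. *)
have above k' : k' < k -> F k' j < i.
  move=> h; have := sst_col h hk; rewrite -Ex ltnS leq_eqVlt => /orP[/eqP Ek'|//].
  have hi : i \in mkseq (fun k => F k j) k.
    by rewrite -Ek'; apply: map_f; rewrite mem_iota.
  have n1 : i.+1 \notin mkseq (fun k => F k j) k.
    apply/negP => /mem_above[k2 h2 E2].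
    by have := sst_col h2 hk; rewrite -Ex -E2 ltnn.
  have := words_phi_eps i (mkseq (fun k => F k j) k).
  rewrite (words_eps_notin n1) (count_memPn n1).
  move: hi pu; rewrite -has_pred1 has_count Eu words_nphi_cat; lia.
(* A left neighbour i+1 would need an i above it in its own column to cancel it, as the rest of the
   column of the cell has no free i. The entry to the right of that i is less than i by [above],
   against the row order. *)
have left : 0 < j -> F k j.-1 <= i.
  case: j hj hk Ex Eu Ev above => // j hj hk Ex Eu Ev above _ /=.
  have hkj : k < conj_part mu j by apply: leq_trans hk (conj_part_le (leqnSn j)).
  have := sst_row (leqnSn j) hk; rewrite -Ex leq_eqVlt => /orP[/eqP Ekj|]; last by [].
  have p0 : nphi words i (rest k j.+1) = 0.
    apply/words_phi_notin/negP => /mem_rest[k2 /andP[h2 h2'] E2].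
    by have := sst_col h2 h2'; rewrite -Ex -E2; lia.
  have e0 : neps words i (fcol mu F j) = 0.
    by move: ev; rewrite Ev words_neps_cat p0 /= words_neps_cat; lia.
  have p1 : nphi words i (fcol mu F j) = 0.
    apply/words_phi_notin/negP => /mem_fcol[k2 h2 E2].
    case: (ltngtP k2 k) => h.
    - have h2' : k2 < conj_part mu j.+1 by lia.
      by have := sst_row (leqnSn j) h2'; have := above _ h; lia.
    - by have := sst_col h h2; lia.
    - by move: E2; rewrite h; lia.
  have := words_phi_eps i (fcol mu F j); rewrite p1 e0.
  have : i.+1 \in fcol mu F j by apply/mem_fcol; exists k.
  rewrite -has_pred1 has_count => c1.
  suff -> : count_mem i (fcol mu F j) = 0 by lia.
  apply/count_memPn/negP => /mem_fcol[k2 h2 E2].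
  case: (ltngtP k2 k) => h.
  - have h2' : k2 < conj_part mu j.+1 by lia.
    by have := sst_row (leqnSn j) h2'; have := above _ h; lia.
  - by have := sst_col h h2; lia.
  - by move: E2; rewrite h; lia.
split=> [k' l h|k' l h]; rewrite /update.
- case: (eqVneq k' k) h => [->|_] h /=; last exact: sF.1.
  have := sF.1 _ _ h; case: eqP => [El|_]; case: eqP => [El'|_] //; try lia.
  + by rewrite El -Ex; lia.
  + by move=> _; have := left; rewrite -El' /=; apply.
- case: (eqVneq l j) h => [->|_] h; rewrite ?andbF ?andbT; last exact: sF.2.
  have := sF.2 _ _ h; case: eqP => [Ek|_]; case: eqP => [Ek'|_] //; try lia.
  + by rewrite Ek -Ex; lia.
  + by move=> _; apply: above; lia.
Qed.

Lemma fcols_update_f i w : kf words i (fcols mu F (part mu 0)) = Some w ->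
  exists G, sst_fun mu G /\ w = fcols mu G (part mu 0).
Proof.
case/words_kf_split => u [v [E -> pu ev]].
have [j [k [hj hk Ex Eu Ev]]] := fcols_split E.
exists (update k j i.+1); split; last by rewrite fcols_update // Eu Ev -catA.
(* An i+1 below the cell would remain free, as the column has no i below the cell, against
   epsilon(v) = 0. *)
have below k' : k < k' -> k' < conj_part mu j -> i.+1 < F k' j.
  move=> h h'; have := sst_col h h'; rewrite -Ex leq_eqVlt => /orP[/eqP Ek'|//].
  have hi : i.+1 \in rest k j.
    by rewrite Ek'; apply: map_f; rewrite mem_iota; lia.
  have n1 : i \notin rest k j.
    apply/negP => /mem_rest[k2 /andP[h2 h2'] E2].
    by have := sst_col h2 h2'; rewrite -Ex -E2 ltnn.
  have := words_phi_eps i (rest k j).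
  rewrite (words_phi_notin n1) (count_memPn n1).
  move: hi ev; rewrite -has_pred1 has_count Ev -/(rest k j) words_neps_cat; lia.
(* A right neighbour i would have to be cancelled by an i+1 below it in its own column. The entry to
   the left of that i+1 exceeds i+1 by [below]. *)
have right : j.+1 < part mu k -> i < F k j.+1.
  move=> hr; have hkj : k < conj_part mu j.+1 by rewrite -part_conj.
  have := sst_row (leqnSn j) hkj; rewrite -Ex leq_eqVlt => /orP[/eqP Ekj|]; last by [].
  have e0 : neps words i (mkseq (fun k => F k j) k) = 0.
    apply/words_eps_notin/negP => /mem_above[k2 h2 E2].
    by have := sst_col h2 hk; rewrite -Ex -E2; lia.
  have hn : j.+1 < part mu 0 by apply: leq_trans hr (nth_part_geq _ _).
  have [U EU] := fcols_right_next mu F hn.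
  have p0 : nphi words i (fcol mu F j.+1) = 0.
    by move: pu; rewrite Eu EU words_nphi_cat e0 words_nphi_cat; lia.
  have n1 : i.+1 \notin fcol mu F j.+1.
    apply/negP => /mem_fcol[k2 h2 E2].
    case: (ltngtP k2 k) => h.
    - by have := sst_col h hkj; lia.
    - have h2' : k2 < conj_part mu j by apply: leq_trans h2 (conj_part_le (leqnSn j)).
      by have := sst_row (leqnSn j) h2; have := below _ h h2'; lia.
    - by move: E2; rewrite h; lia.
  have := words_phi_eps i (fcol mu F j.+1).
  rewrite p0 (words_eps_notin n1) (count_memPn n1).
  have : i \in fcol mu F j.+1 by apply/mem_fcol; exists k.
  by rewrite -has_pred1 has_count; lia.
split=> [k' l h|k' l h]; rewrite /update.
- case: (eqVneq k' k) h => [->|_] h /=; last exact: sF.1.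
  have := sF.1 _ _ h; case: eqP => [El|_]; case: eqP => [El'|_] //; try lia.
  + by move=> _; rewrite El; apply: right; rewrite -El.
  + by rewrite El' -Ex; lia.
- case: (eqVneq l j) h => [->|_] h; rewrite ?andbF ?andbT; last exact: sF.2.
  have := sF.2 _ _ h; case: eqP => [Ek|_]; case: eqP => [Ek'|_] //; try lia.
  + by move=> _; apply: below; rewrite -?part_conj Ek // -Ek.
  + by rewrite Ek' -Ex; lia.
Qed.

(** Cells are treated column by column from the right and downwards, which is the reading order.
    Every prefix of the reading also has epsilon 0. *)
Lemma sst_fun_hw : hw words (fcols mu F (part mu 0)) ->
  forall k l, k < conj_part mu l -> F k l = k.
Proof.
move=> hF; have n0 i : neps words i (fcols mu F (part mu 0)) = 0.
  by apply/(sn_e0 (words_seminormal _)).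
move=> k l; have [m] := ubnP (part mu 0 - l); elim: m l k => // m IHl l k le_m.
have [m'] := ubnP k; elim: m' k => // m' IHk k le_m' hk.
apply/eqP; rewrite eqn_leq sst_ge // andbT leqNgt; apply/negP => lt_k.
have hl : l < part mu 0 by apply: conj_part_gt0; apply: leq_trans hk.
have [i Ei ki] : exists2 i, F k l = i.+1 & k <= i.
  by case: (F k l) lt_k => // i h; exists i.
pose p := fcols_right mu F (part mu 0) l ++ mkseq (fun k => F k l) k ++ [:: F k l].
have e0 : neps words i p = 0.
  have E : fcols mu F (part mu 0) = p ++ (rest k l ++ fcols mu F l).
    by rewrite (fcols_cut mu F hl) /fcol (mkseq_cut _ hk) /p -!catA.
  by have := n0 i; rewrite E words_neps_cat; lia.
(* The final i+1 of the prefix must be cancelled by an earlier i. This i lies above the cell or in a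
   column further right, where each entry is already known to equal its row number. *)
have : i \in p.
  have := words_phi_eps i p; rewrite e0 add0n -has_pred1 has_count => <-.
  by rewrite addn_gt0 -has_count has_pred1 !mem_cat Ei mem_seq1 eqxx !orbT.
rewrite !mem_cat Ei inE => /or3P[/(mem_fcols_right hl)[l' [k' [h1 h2 h3]]]|/mem_above[k' h1 h2]|].
- have hl' : l' < part mu 0 by apply: conj_part_gt0; apply: leq_trans h2.
  move: h3; rewrite IHl //; last by lia.
  move=> Ek'; have hk' : k < conj_part mu l' by lia.
  have := sst_row (ltnW h1) hk'; rewrite Ei IHl //; lia.
- by move: h2; rewrite IHk //; lia.
- by rewrite ltn_eqF.
Qed.

End SstFun.

(** The reverse of the reading order: columns from the left, each one upwards. For an entry x that
    is too small, the suffix of the reading starting at its cell would contain more letters x than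
    x+1, against phi 0. *)
Lemma sst_fun_lowest (mu : partition) F n : sst_fun mu F ->
  (forall k l, k < conj_part mu l -> F k l < n) ->
  (forall i, i.+1 < n -> nphi words i (fcols mu F (part mu 0)) = 0) ->
  forall k l, k < conj_part mu l -> F k l = lowest_entry mu n k l.
Proof.
move=> sF bF n0; rewrite /lowest_entry.
(* Ensures that the subtraction in [lowest_entry] is not truncated. *)
have le_n l : conj_part mu l <= n.
  case E: (conj_part mu l) => [//|c]; have h : c < conj_part mu l by rewrite E.
  by have := bF _ _ h; have := sst_ge sF h; lia.
move=> k l; have [m] := ubnP l; elim: m l k => // m IHl l k le_m.
have [m'] := ubnP (conj_part mu l - k); elim: m' k => // m' IHk k le_m' hk.
have ub : F k l <= n - conj_part mu l + k.
  case: (leqP (conj_part mu l) k.+1) => h; first by have := bF _ _ hk; have := le_n l; lia.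
  have := sst_col sF (ltnSn k) h; rewrite (IHk k.+1) //; lia.
apply/eqP; rewrite eqn_leq ub /= leqNgt; apply/negP => lt_k.
have hl : l < part mu 0 by apply: conj_part_gt0; apply: leq_trans hk.
set x := F k l in ub lt_k *; have xn : x.+1 < n by have := le_n l; lia.
pose rest := [seq F y l | y <- iota k.+1 (conj_part mu l - k.+1)].
pose s := x :: rest ++ fcols mu F l.
have p0 : nphi words x s = 0.
  have E : fcols mu F (part mu 0) =
      (fcols_right mu F (part mu 0) l ++ mkseq (fun k => F k l) k) ++ s.
    by rewrite (fcols_cut mu F hl) /fcol (mkseq_cut _ hk) /s -!catA.
  by have := n0 x xn; rewrite E words_nphi_cat; lia.
have r0 : x.+1 \notin rest.
  apply/negP => /mapP[k']; rewrite mem_iota => h E.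
  by move: E; rewrite IHk; lia.
(* The columns on the left are already known to be intervals ending at n-1, and by the row order
   they start no later than x. So each contains x once, and x+1 at most once. *)
have cnt q : q <= l -> count_mem x.+1 (fcols mu F q) <= count_mem x (fcols mu F q).
  elim: q => //= q IHq hq; rewrite !count_cat leq_add ?IHq ?(ltnW hq) //.
  have hkq : k < conj_part mu q by apply: leq_trans hk (conj_part_le _ (ltnW hq)).
  have Fx : n - conj_part mu q + k <= x.
    by rewrite -(IHl q k) //; [apply: (sst_row sF) => //; apply: ltnW|lia].
  have -> : count_mem x (fcol mu F q) = 1.
    rewrite count_uniq_mem ?(fcol_uniq sF) //.
    suff -> : x \in fcol mu F q by [].
    apply/mem_fcol; have := le_n q => lq.
    have hx : x - (n - conj_part mu q) < conj_part mu q by lia.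
    exists (x - (n - conj_part mu q)) => //.
    by rewrite IHl //; lia.
  by rewrite count_uniq_mem ?(fcol_uniq sF) // leq_b1.
have := words_phi_eps x s; rewrite p0 /s /= !count_cat (count_memPn r0) eqxx.
rewrite [x == x.+1]ltn_eqF //; move: (cnt l (leqnn l)) => + E; move: E.
rewrite !add0n => ->; apply/negP; rewrite -ltnNge addnCA -[nat_of_bool true]/1.
by rewrite add1n ltnS addnA leq_addl.
Qed.

Lemma fcols_bound mu F n j k : j < n -> k < conj_part mu j -> F k j \in fcols mu F n.
Proof.
move=> hj hk; rewrite (fcols_cut mu F hj) !mem_cat.
by have -> : F k j \in fcol mu F j; [apply/mem_fcol; exists k|rewrite orbT].
Qed.

Lemma mem_fcols mu F n x : x \in fcols mu F n ->
  exists j k, [/\ j < n, k < conj_part mu j & x = F k j].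
Proof.
elim: n => //= n IH; rewrite mem_cat => /orP[/mem_fcol[k hk ->]|/IH[j [k [h1 h2 h3]]]].
  by exists n, k.
by exists j, k; split=> //; apply: ltnW.
Qed.

Section Sst.
Variable mu : partition.
Implicit Types T : SST mu.

Lemma sst_val T : val T = fill mu (entry (val T)).
Proof. exact: sst_fillK (valP T). Qed.

Lemma sst_reading T : reading (val T) = fcols mu (entry (val T)) (part mu 0).
Proof. by rewrite {1}sst_val reading_fill. Qed.

Lemma fcols_inj F G n : fcols mu F n = fcols mu G n ->
  forall k j, j < n -> k < conj_part mu j -> F k j = G k j.
Proof.
elim: n => //= n IH /eqP; rewrite eqseq_cat ?size_mkseq // => /andP[/eqP E1 /eqP /IH h].
move=> k j; rewrite ltnS leq_eqVlt => /orP[/eqP ->|]; last exact: h.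
by move=> hk; have := congr1 (fun s => nth 0 s k) E1; rewrite !nth_mkseq.
Qed.

Lemma reading_inj : injective (fun T => reading (val T)).
Proof.
move=> T T' /=; rewrite !sst_reading => /fcols_inj h; apply: val_inj.
rewrite sst_val [RHS]sst_val; apply: eq_fill => k l hl; apply: h.
  by apply: leq_trans hl (nth_part_geq _ _).
by rewrite -part_conj.
Qed.

Lemma sst_of_fun G : sst_fun mu G -> exists T, reading (val T) = fcols mu G (part mu 0).
Proof.
move=> h; exists (exist _ (fill mu G) (sst_fun_fill h)); exact: reading_fill.
Qed.

Lemma reading_strict : strict (sst_crystal mu) words (fun T => reading (val T)).
Proof.
apply: pullback_strict => i T w; rewrite sst_reading.
  case/(fcols_update_e (sst_funP (valP T))) => G [/sst_of_fun[T' ET'] ->].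
  by exists T'; rewrite -ET'.
case/(fcols_update_f (sst_funP (valP T))) => G [/sst_of_fun[T' ET'] ->].
by exists T'; rewrite -ET'.
Qed.

Lemma sst_seminormal : seminormal (sst_crystal mu).
Proof.
move=> T; apply: (strict_inj_seminormal reading_strict reading_inj).
exact: words_seminormal.
Qed.

Lemma reading_hw T : hw (sst_crystal mu) T -> hw words (reading (val T)).
Proof. by apply: sim_hw; apply: strict_sim reading_strict. Qed.

Lemma reading_highest : reading (val (highest mu)) = fcols mu (fun k _ => k) (part mu 0).
Proof. exact: reading_fill. Qed.

Lemma reading_lowest n : reading (val (lowest mu n)) = fcols mu (lowest_entry mu n) (part mu 0).
Proof. exact: reading_fill. Qed.

Lemma sst_eq T G : (forall k l, k < conj_part mu l -> entry (val T) k l = G k l) ->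
  val T = fill mu G.
Proof. by move=> h; rewrite sst_val; apply: eq_fill => k l; rewrite part_conj; apply: h. Qed.

Lemma sst_hw T : hw (sst_crystal mu) T -> T = highest mu.
Proof.
move=> /reading_hw; rewrite sst_reading => h; apply: val_inj; apply: sst_eq.
exact: (sst_fun_hw (sst_funP (valP T)) h).
Qed.

(** A nonempty tableau is never killed by all f_i; lowest elements appear once the letters are
    bounded by [n]. *)
Lemma sst_lowest T n : (forall x, x \in reading (val T) -> x < n) ->
  (forall i, i.+1 < n -> kf (sst_crystal mu) i T = None) -> T = lowest mu n.
Proof.
move=> bT hT; apply: val_inj; apply: sst_eq; apply: sst_fun_lowest.
- exact: sst_funP (valP T).
- move=> k l h; apply: bT; rewrite sst_reading; apply: fcols_bound => //.
  by apply: conj_part_gt0; apply: leq_trans h.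
- move=> i /hT; rewrite -sst_reading (sn_f0 (sst_seminormal T)).
  by rewrite -(strict_nphi i (reading_strict T)).
Qed.

Lemma sst_reach_hw T : exists p, run (sst_crystal mu) p T = Some (highest mu).
Proof.
have [|p [T' [h /sst_hw <-]]] := @reach_hw _ (sst_crystal mu)
  (fun T => sumn (reading (val T))) _ T; last by exists p.
move=> i b b' eb; have := strict_e (reading_strict b) i; rewrite eb /=.
exact: words_sumn_e.
Qed.

(** Raising [highest mu] ends at some highest weight tableau, which by [sst_hw] is [highest mu]
    again. No signature has to be computed. *)
Lemma highest_hw : hw (sst_crystal mu) (highest mu).
Proof.
have [|p [T' [h /[dup] /sst_hw -> //]]] := @reach_hw _ (sst_crystal mu)
  (fun T => sumn (reading (val T))) _ (highest mu).
move=> i b b' eb; have := strict_e (reading_strict b) i; rewrite eb /=.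
exact: words_sumn_e.
Qed.

Lemma highest_wt k : wcoef (wt (sst_crystal mu) (highest mu)) k = Posz (part mu k).
Proof.
rewrite -(strict_wt (reading_strict (highest mu))) words_wt reading_highest; congr Posz.
have h : part mu k <= part mu 0 by apply: nth_part_geq.
(* The form that survives induction on the number of columns read: letter k occurs in column l,
   once, exactly when l < mu_k. *)
transitivity (minn (part mu 0) (part mu k)); last by lia.
elim: (part mu 0) => [|n IH]; first by rewrite min0n.
rewrite /= count_cat IH count_uniq_mem; last first.
  by rewrite map_inj_in_uniq ?iota_uniq // => x y _ _ ->.
have -> : (k \in fcol mu (fun k _ => k) n) = (n < part mu k).
  by rewrite part_conj; apply/mem_fcol/idP => [[k' h' ->]//|h']; exists k.
by clear; move: (part mu k) => a; lia.
Qed.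

End Sst.

Lemma part_ext (mu nu : partition) : (forall k, part mu k = part nu k) -> mu = nu.
Proof.
move=> h; apply: val_inj.
have pos (la : partition) k : (k < size (val la)) = (0 < part la k).
  case: ltnP => hk; last by rewrite nth_default.
  have /andP[_ n0] := valP la; rewrite lt0n; apply/esym; apply: contra n0 => /eqP E.
  by have := mem_nth 0 hk; rewrite E.
apply: (@eq_from_nth _ 0) => [|k _]; last exact: h.
case: (ltngtP (size (val mu)) (size (val nu))) => // hs.
  by have := hs; rewrite (pos nu) -h -(pos mu) ltnn.
by have := hs; rewrite (pos mu) h -(pos nu) ltnn.
Qed.

Lemma nth_filter_pos (s : seq nat) k : sorted geq s ->
  nth 0 [seq x <- s | x != 0] k = nth 0 s k.
Proof.
elim: s k => // x s IH k hs; have hs' := path_sorted hs.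
have /allP mx := order_path_min geq_trans hs.
rewrite /=; case: eqP => [x0|_] /=; last by case: k => [|k] //=; rewrite IH.
have z y : y \in x :: s -> y = 0.
  by rewrite inE => /orP[/eqP -> //|/mx /=]; rewrite x0; lia.
have z0 t q : {subset t <= x :: s} -> nth 0 t q = 0.
  move=> st; case: (ltnP q (size t)) => h; last exact: nth_default.
  by apply: z; apply: st; apply: mem_nth.
by rewrite IH // !z0 // => y; rewrite inE => ->; rewrite orbT.
Qed.

Lemma bihw_partition A : hw mat_crystal A -> hw mat_crystal_t A ->
  exists mu : partition, forall k, A (k, k) = part mu k.
Proof.
move=> h ht; pose s := mkseq (fun k => A (k, k)) (nrows A).
have ss : sorted geq s.
  apply/(sortedP 0) => k; rewrite size_mkseq => hk.
  by rewrite !nth_mkseq ?(ltnW hk) //; apply: bihw_decr.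
have ps : sorted geq [seq x <- s | x != 0] && (0 \notin [seq x <- s | x != 0]).
  by rewrite (sorted_filter geq_trans) // mem_filter.
exists (exist (fun mu => is_true (sorted geq mu && (0 \notin mu))) _ ps) => k.
rewrite [val _]/= nth_filter_pos //.
case: (ltnP k (nrows A)) => hk; first by rewrite nth_mkseq.
rewrite nth_default ?size_mkseq //.
by case: (A (k, k) =P 0) => // /mat_lt[]; lia.
Qed.

(** The tableau is carried over to matrices through its reading. There both sides become doubly
    highest weight matrices of the same weight, and these coincide. *)
Lemma mat_hw_sst A : hw mat_crystal A -> exists mu : partition,
  sim mat_crystal (sst_crystal mu) A (highest mu).
Proof.
move=> hA; have [D [h ht sAD _]] := mat_hw_diag hA.
have [mu Dmu] := bihw_partition h ht; exists mu.
have [D' [h' ht' sD']] := words_hw_diag (reading_hw (@highest_hw mu)).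
have sH : sim (sst_crystal mu) words (highest mu) (reading (val (highest mu))).
  exact: (strict_sim (highest mu) (@reading_strict mu)).
apply: sim_trans sAD _; apply: sim_sym; apply: (sim_trans sH).
suff -> : D = D' by [].
apply: bihw_uniq => //; rewrite -(sim_wt sD') -(sim_wt sH); apply: wcoefP => k.
by rewrite highest_wt bihw_wt // Dmu.
Qed.

Lemma sim_run_ex (T T' : Type) (C : crystal T) (C' : crystal T') p x y x' :
  sim C C' x y -> run C p x = Some x' -> exists2 y', run C' p y = Some y' & sim C C' x' y'.
Proof.
move=> /(@sim_run _ _ _ _ _ _ p) + ex; rewrite ex.
by case: (run C' p y) => // y' h; exists y'.
Qed.

(** A path from [T] to [highest mu] takes [T'] to [highest nu]. Equality of weights gives mu = nu,
    and the path can be run backwards. *)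
Lemma sst_sim_uniq mu nu (T : SST mu) (T' : SST nu) :
  sim (sst_crystal mu) (sst_crystal nu) T T' -> existT SST mu T = existT SST nu T'.
Proof.
move=> s; have [p hp] := sst_reach_hw T; have [U hU sU] := sim_run_ex s hp.
have EU := sst_hw (sim_hw sU (@highest_hw mu)); rewrite {}EU in hU sU.
have E : mu = nu.
  by apply: part_ext => k; have := sim_wt sU => /(congr1 (fun w => wcoef w k));
    rewrite !highest_wt => -[].
clear s sU; subst nu.
by rewrite (run_inj (@sst_seminormal mu) hp hU).
Qed.

(** * The RSK isomorphism *)

Definition tableau_pair : Type := {mu : partition & (SST mu * SST mu)%type}.

Definition is_rsk (A : Mat) (x : tableau_pair) : Prop :=
  sim mat_crystal (sst_crystal (projT1 x)) A (projT2 x).1 /\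
  sim mat_crystal_t (sst_crystal (projT1 x)) A (projT2 x).2.

Lemma bihw_sim_t A : hw mat_crystal A -> hw mat_crystal_t A -> sim mat_crystal_t mat_crystal A A.
Proof. by move=> h ht; rewrite -{2}(bihw_tr h ht); apply: strict_sim tr_mat_strict. Qed.

Lemma is_rsk_exists A : exists x, is_rsk A x.
Proof.
have [p [B [hp hB]]] := mat_reach_hw A.
have [D [h ht sBD [q hq]]] := mat_hw_diag hB; have [mu sD] := mat_hw_sst h.
have sDt := sim_trans (bihw_sim_t h ht) sD.
have [T2 _ sT2] := sim_run_ex sDt (run_rev mat_t_seminormal hq).
have [T1 _ sT1] := sim_run_ex (sim_trans sBD sD) (run_rev mat_seminormal hp).
(* The path [p] of the first structure does not change similarity for the second one. *)
by exists (existT _ mu (T1, T2)); split=> //; apply: sim_trans (mat_t_sim_run hp) sT2.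
Qed.

Lemma is_rsk_uniq A x y : is_rsk A x -> is_rsk A y -> x = y.
Proof.
case: x y => [mu [T1 T2]] [nu [S1 S2]] [/= h1 h2] [/= k1 k2].
have E1 := sst_sim_uniq (sim_trans (sim_sym h1) k1).
have E2 := sst_sim_uniq (sim_trans (sim_sym h2) k2).
have E := projT1_eq E1; rewrite /= in E; clear h1 h2 k1 k2; subst nu.
have dec := Eqdep_dec.inj_pair2_eq_dec _ (@eq_comparable partition).
by rewrite (dec _ _ _ _ E1) (dec _ _ _ _ E2).
Qed.

(** [B] can follow [A] along a path of the first structure and then one of the second. Both end at
    doubly highest weight matrices of equal weight, hence at the same one, and the paths are
    reversed. *)
Lemma is_rsk_inj A B x : is_rsk A x -> is_rsk B x -> A = B.
Proof.
case=> a1 a2 [b1 b2]; have s := sim_trans a1 (sim_sym b1).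
have st := sim_trans a2 (sim_sym b2).
have [p [A1 [hp hA1]]] := mat_reach_hw A; have [B1 hpB sAB] := sim_run_ex s hp.
have [D [h ht sD [q hq]]] := mat_hw_diag hA1.
have sABt : sim mat_crystal_t mat_crystal_t A1 B1.
  by apply: sim_trans (mat_t_sim_run hpB); apply: sim_trans st; apply: sim_sym (mat_t_sim_run hp).
have [D' hq' sDD'] := sim_run_ex sABt hq.
have sD' := mat_sim_run_t hq'.
have E : D = D'.
  apply: bihw_uniq => //.
  - exact: sim_hw sD' (sim_hw sAB hA1).
  - exact: sim_hw sDD' ht.
  - by rewrite -(sim_wt sD) (sim_wt sAB) (sim_wt sD').
apply: (run_inj mat_seminormal hp); rewrite hpB; congr Some.
by rewrite -E in hq'; apply: (run_inj mat_t_seminormal hq' hq).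
Qed.

Lemma is_rsk_surj x : exists A, is_rsk A x.
Proof.
case: x => mu [T1 T2].
have [p hp] := sst_reach_hw T1; have [q hq] := sst_reach_hw T2.
have [D [h ht sD]] := words_hw_diag (reading_hw (@highest_hw mu)).
have {}sD := sim_trans (strict_sim _ (@reading_strict mu)) sD.
have [X hX sX] := sim_run_ex sD (run_rev (@sst_seminormal mu) hp).
have sXt : sim (sst_crystal mu) mat_crystal_t (highest mu) X.
  apply: sim_trans sD _; apply: sim_trans (sim_sym (bihw_sim_t h ht)) _.
  exact: mat_t_sim_run hX.
have [A hA sA] := sim_run_ex sXt (run_rev (@sst_seminormal mu) hq).
exists A; split; last exact: sim_sym.
by apply: sim_sym; apply: sim_trans sX _; apply: mat_sim_run_t hA.
Qed.

Definition rsk (A : Mat) : tableau_pair := projT1 (cid (is_rsk_exists A)).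

Lemma rskP A : is_rsk A (rsk A).
Proof. exact: projT2 (cid (is_rsk_exists A)). Qed.

Lemma rsk_bij : bijective rsk.
Proof.
apply: (@Bijective _ _ _ (fun x => projT1 (cid (is_rsk_surj x)))).
  by move=> A; case: cid => B /= hB; apply: is_rsk_inj hB (rskP A).
by move=> x; case: cid => A /= hA; apply: is_rsk_uniq (rskP A) hA.
Qed.

(** Epsilon and phi come for free, being determined by similarity in seminormal crystals. *)
Lemma step_strict (T T' : Type) (C : crystal T) (C' : crystal T') f :
  seminormal C -> seminormal C' -> (forall x, wt C' (f x) = wt C x) ->
  (forall x si, step C' si (f x) = omap f (step C si x)) -> strict C C' f.
Proof.
move=> sn sn' hw hs x.
have s : sim C C' x (f x).
  apply: (@bisim _ _ _ _ (fun x y => y = f x)) => // [{}x _ ->|{}x _ si ->] //.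
  by rewrite hs; case: (step C si x).
split=> // [i|i|i|i].
- by rewrite (sn_eps (sn x)) (sn_eps (sn' _)) (sim_neps sn sn' i s).
- by rewrite (sn_phi (sn x)) (sn_phi (sn' _)) (sim_nphi sn sn' i s).
- exact: hs x (true, i).
- exact: hs x (false, i).
Qed.

(** * Disjoint unions of squares of crystals *)

Section SumAct.
Variables (I : Type) (T : I -> Type) (C : forall k, crystal (T k)).

Lemma act_fst_strict k (b : T k) : strict (C k)
  (crystal_sum (fun k => act_fst (T k) (C k))) (fun a => existT _ k (a, b)).
Proof.
by move=> a; split=> //= i; [case: (ke (C k) i a)|case: (kf (C k) i a)].
Qed.

Lemma act_snd_strict k (a : T k) : strict (C k)
  (crystal_sum (fun k => act_snd (T k) (C k))) (fun b => existT _ k (a, b)).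
Proof.
by move=> b; split=> //= i; [case: (ke (C k) i b)|case: (kf (C k) i b)].
Qed.

Hypothesis sn : forall k, seminormal (C k).

Lemma sum_fst_seminormal : seminormal (crystal_sum (fun k => act_fst (T k) (C k))).
Proof. by case=> k [a b]; apply: (strict_seminormal (act_fst_strict b)); apply: sn. Qed.

Lemma sum_snd_seminormal : seminormal (crystal_sum (fun k => act_snd (T k) (C k))).
Proof. by case=> k [a b]; apply: (strict_seminormal (act_snd_strict a)); apply: sn. Qed.

Lemma sum_bicrystal : is_bicrystal (crystal_sum (fun k => act_fst (T k) (C k)))
  (crystal_sum (fun k => act_snd (T k) (C k))).
Proof.
split; [exact: seminormal_crystal sum_fst_seminormal|
  exact: seminormal_crystal sum_snd_seminormal|..];
  move=> i j [k [a b]] /=.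
- by case E: (ke (C k) j b) => [b'|]; case E': (ke (C k) i a) => [a'|]; rewrite /= ?E ?E'.
- by case E: (kf (C k) j b) => [b'|]; case E': (ke (C k) i a) => [a'|]; rewrite /= ?E ?E'.
- by case E: (ke (C k) j b) => [b'|]; case E': (kf (C k) i a) => [a'|]; rewrite /= ?E ?E'.
- by case E: (kf (C k) j b) => [b'|]; case E': (kf (C k) i a) => [a'|]; rewrite /= ?E ?E'.
Qed.

End SumAct.

Definition pair_crystal_l : crystal tableau_pair :=
  crystal_sum (fun mu => act_fst (SST mu) (sst_crystal mu)).
Definition pair_crystal_r : crystal tableau_pair :=
  crystal_sum (fun mu => act_snd (SST mu) (sst_crystal mu)).

Lemma step_strict_eq (T T' : Type) (C : crystal T) (C' : crystal T') f si x :
  strict C C' f -> step C' si (f x) = omap f (step C si x).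
Proof. by move=> s; case: si => -[] i; [apply: strict_e|apply: strict_f]. Qed.

Lemma rsk_strict_l : strict mat_crystal pair_crystal_l rsk.
Proof.
apply: step_strict; first exact: mat_seminormal.
- apply: sum_fst_seminormal => mu; exact: sst_seminormal.
- by move=> A; rewrite (sim_wt (rskP A).1).
move=> A si; have [] := rskP A; case: (rsk A) => mu [T1 T2] /= s1 s2.
rewrite (step_strict_eq si T1 (@act_fst_strict _ _ (fun mu => sst_crystal mu) mu T2)).
have := sim_step si s1; case EA: (step mat_crystal si A) => [B|] /=;
  case: (step _ si T1) => [T1'|] //= sB.
(* The old second tableau still fits: a step of the first structure gives a matrix similar to [A] in
   the second one. *)
congr Some; apply: is_rsk_uniq (rskP B); split=> //=.
apply: sim_trans s2; apply: sim_sym; apply: (@mat_t_sim_run _ _ [:: si]).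
by rewrite /= EA.
Qed.

Lemma rsk_strict_r : strict mat_crystal_t pair_crystal_r rsk.
Proof.
apply: step_strict; first exact: mat_t_seminormal.
- apply: sum_snd_seminormal => mu; exact: sst_seminormal.
- by move=> A; rewrite (sim_wt (rskP A).2).
move=> A si; have [] := rskP A; case: (rsk A) => mu [T1 T2] /= s1 s2.
rewrite (step_strict_eq si T2 (@act_snd_strict _ _ (fun mu => sst_crystal mu) mu T1)).
have := sim_step si s2; case EA: (step mat_crystal_t si A) => [B|] /=;
  case: (step _ si T2) => [T2'|] //= sB.
congr Some; apply: is_rsk_uniq (rskP B); split=> //=.
apply: sim_trans s1; apply: sim_sym; apply: (@mat_sim_run_t _ _ [:: si]).
by rewrite /= EA.
Qed.

(** * Moving letters past dual letters *)

(* The strict embedding of N^vee (x) N into N (x) N^vee.  Its image misses only the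
   trivial component {0 (x) 0^vee}. *)
Definition swap_letters (p : nat * nat) : nat * nat :=
  if p.1 == p.2 then (p.1.+1, p.1.+1) else (p.2, p.1).

Lemma swap_letters_inj : injective swap_letters.
Proof.
by move=> [i j] [i' j']; rewrite /swap_letters /=;
  case: eqP => [->|h]; case: eqP => [->|h'] [] E1 E2; congr pair; lia.
Qed.

Lemma natural_dual_neps i k : neps (dual natural) i k = (k == i).
Proof. by []. Qed.

Lemma natural_dual_nphi i k : nphi (dual natural) i k = (k == i.+1).
Proof. by []. Qed.

Lemma dual_seminormal (T : Type) (C : crystal T) : seminormal C -> seminormal (dual C).
Proof. by move=> sn b; apply: dual_seminormal_at. Qed.

Lemma tensor_seminormal (T1 T2 : Type) (C1 : crystal T1) (C2 : crystal T2) :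
  seminormal C1 -> seminormal C2 -> seminormal (tensor C1 C2).
Proof. by move=> s1 s2 [b1 b2]; apply: tensor_seminormal_at. Qed.

(** The shift on equal letters is forced: e_j sends j^vee (x) j to (j+1)^vee (x) j, and its image j
    (x) (j+1)^vee is e_j applied to (j+1) (x) (j+1)^vee. *)
Lemma swap_letters_strict :
  strict (tensor (dual natural) natural) (tensor natural (dual natural)) swap_letters.
Proof.
have sn := natural_seminormal; have snd := dual_seminormal sn.
apply: step_strict; [exact: tensor_seminormal|exact: tensor_seminormal|..].
- move=> [i j]; apply: wcoefP => k; rewrite /swap_letters /=.
  case: eqP => [->|_] /=; rewrite !wcoefD !wcoefN; last by rewrite addrC.
  by rewrite addrN addNr.
- move=> [i j] [[] k].
    change (ke (tensor natural (dual natural)) k (swap_letters (i, j)) =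
      omap swap_letters (ke (tensor (dual natural) natural) k (i, j))).
    rewrite [swap_letters (i, j)]/swap_letters [(i, j).1]/= [(i, j).2]/=.
    rewrite (tensor_ke k (snd i) (sn j)) natural_dual_nphi natural_neps.
    case: (eqVneq i j) => [->|ne]; rewrite (tensor_ke k (sn _) (snd _));
      rewrite natural_dual_neps natural_nphi /= ?leqnn.
      rewrite eqSS; case: (eqVneq j k) => //= ->.
      by rewrite /swap_letters /= gtn_eqF.
    case: (eqVneq i k) => [Ei|n1]; case: (eqVneq j k) => [Ej|n2];
    case: (eqVneq i k.+1) => [Ei'|n3]; case: (eqVneq j k.+1) => [Ej'|n4]; 
    rewrite /= /swap_letters /= ?eqxx; subst=> //; try lia; by case: eqP => //; lia.
  change (kf (tensor natural (dual natural)) k (swap_letters (i, j)) =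
    omap swap_letters (kf (tensor (dual natural) natural) k (i, j))).
  rewrite [swap_letters (i, j)]/swap_letters [(i, j).1]/= [(i, j).2]/=.
  rewrite (tensor_kf k (snd i) (sn j)) natural_dual_nphi natural_neps.
  case: (eqVneq i j) => [->|ne]; rewrite (tensor_kf k (sn _) (snd _));
    rewrite natural_dual_neps natural_nphi /= ?ltnn.
    rewrite eqSS; case: (eqVneq j k) => //= ->.
    by rewrite /swap_letters /= ltn_eqF.
  case: (eqVneq i k) => [Ei|n1]; case: (eqVneq j k) => [Ej|n2];
  case: (eqVneq i k.+1) => [Ei'|n3]; case: (eqVneq j k.+1) => [Ej'|n4];
  rewrite /= /swap_letters /= ?eqxx; subst=> //; try lia; by case: eqP => //; lia.
Qed.

(** Duality reverses tensor products, so the head of the dual word is its rightmost factor and the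
    first one that the letter meets. *)
Fixpoint pass (u : seq nat) (x : nat) : nat * seq nat :=
  if u is a :: u' then
    let s := swap_letters (a, x) in
    ((pass u' s.1).1, s.2 :: (pass u' s.1).2)
  else (x, [::]).

Lemma pass_inj u v x y : pass u x = pass v y -> u = v /\ x = y.
Proof.
elim: u v x y => [|a u IH] [|b v] x y //=; first by case.
move=> [E1 E2 E3].
have [-> Es] : u = v /\ (swap_letters (a, x)).1 = (swap_letters (b, y)).1.
  by apply: IH; rewrite [LHS]surjective_pairing [RHS]surjective_pairing E1 E3.
have /swap_letters_inj[-> ->] // : swap_letters (a, x) = swap_letters (b, y).
by rewrite [LHS]surjective_pairing [RHS]surjective_pairing Es E2.
Qed.

Lemma pass_notin u x : x \notin u -> pass u x = (x, u).
Proof.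
elim: u => //= a u IH; rewrite inE negb_or => /andP[/negbTE h1 h2].
by rewrite /swap_letters /= eq_sym h1 /= IH.
Qed.

Definition swap (T1 T2 : Type) (p : T1 * T2) : T2 * T1 := (p.2, p.1).

Lemma id_strict_at (T : Type) (C : crystal T) b : strict_at C C id b.
Proof. by split=> // i; [case: (ke C i b)|case: (kf C i b)]. Qed.

Lemma undual_tensor_strict_at (T1 T2 : Type) (C1 : crystal T1) (C2 : crystal T2) b1 b2 :
  seminormal_at C1 b1 -> seminormal_at C2 b2 ->
  strict_at (tensor (dual C2) (dual C1)) (dual (tensor C1 C2)) (@swap T2 T1) (b2, b1).
Proof.
move=> s1 s2; have K : cancel (@swap T1 T2) (@swap T2 T1) by case.
exact: (strict_at_inv (dual_tensor_strict_at s1 s2) K).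
Qed.

(** The composite follows u^vee (x) a^vee (x) x: exchange the last two factors, let the resulting
    letter pass [u] by induction, and put the dual word together again. *)
Lemma pass_strict_at u x :
  strict_at (tensor (dual words) natural) (tensor natural (dual words))
    (fun p => pass p.1 p.2) (u, x).
Proof.
have sn := natural_seminormal; have snd := dual_seminormal sn.
have sw := words_seminormal; have swd := dual_seminormal sw.
elim: u x => [|a u IH] x.
  have [h1 h2 h3 h4] := tensor_at (swd [::]) (sn x).
  have [k1 k2 k3 k4] := tensor_at (sn x) (swd [::]).
  have e0 i : neps (dual words) i [::] = 0 by [].
  have p0 i : nphi (dual words) i [::] = 0 by [].
  split=> [|i|i|i|i]; rewrite [pass _ _]/=.
  - by rewrite /= addrC.
  - by rewrite h1 k1 e0 p0 subn0 addn0.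
  - by rewrite h2 k2 e0 p0 addn0 subn0.
  - rewrite h3 k3 e0 p0 leqn0 natural_neps /=.
    by case: (x == i.+1).
  - rewrite h4 k4 e0 p0 ltn0 natural_nphi /=.
    by case: (x == i).
have s1 : strict_at (tensor (dual words) natural)
    (tensor (dual (tensor natural words)) natural)
    (fun p => ((head a p.1, behead p.1), p.2)) (a :: u, x).
  exact: (tensor_strict_at (dual_strict_at (uncons_strict_at natural a a u)) (id_strict_at _ x)).
have s2 := strict_at_comp s1
  (tensor_strict_at (dual_tensor_strict_at (sn a) (sw u)) (id_strict_at natural x)).
have s3 := strict_at_comp s2 (assoc_strict_at (swd u) (snd a) (sn x)).
have s4 := strict_at_comp s3
  (tensor_strict_at (id_strict_at (dual words) u) (swap_letters_strict (a, x))).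
case Es : (swap_letters (a, x)) => [x1 a1].
have s5 : strict_at (tensor (dual words) (tensor natural (dual natural)))
    (tensor (tensor (dual words) natural) (dual natural))
    (fun p => ((p.1, p.2.1), p.2.2)) (u, swap_letters (a, x)).
  by rewrite Es; apply: assoc_inv_strict_at (swd u) (sn x1) (snd a1).
have {}s5 := strict_at_comp s4 s5.
have s6 : strict_at (tensor (tensor (dual words) natural) (dual natural))
    (tensor (tensor natural (dual words)) (dual natural))
    (fun p => (pass p.1.1 p.1.2, p.2))
    ((u, (swap_letters (a, x)).1), (swap_letters (a, x)).2).
  exact: (tensor_strict_at (IH _) (id_strict_at _ _)).
have {}s6 := strict_at_comp s5 s6.
case Ep : (pass u (swap_letters (a, x)).1) => [x2 u2].
have s7 : strict_at (tensor (tensor natural (dual words)) (dual natural))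
    (tensor natural (tensor (dual words) (dual natural)))
    (fun p => (p.1.1, (p.1.2, p.2)))
    (pass u (swap_letters (a, x)).1, (swap_letters (a, x)).2).
  by rewrite Ep; apply: (assoc_strict_at (sn x2) (swd u2)).
have {}s7 := strict_at_comp s6 s7.
have s8 := strict_at_comp s7 (tensor_strict_at (id_strict_at natural _)
  (undual_tensor_strict_at (sn (swap_letters (a, x)).2)
     (sw (pass u (swap_letters (a, x)).1).2))).
have s9 := strict_at_comp s8 (tensor_strict_at (id_strict_at natural _)
  (dual_strict_at (cons_strict natural
     ((swap_letters (a, x)).2, (pass u (swap_letters (a, x)).1).2)))).
(* The composite is [pass] only on nonempty dual words; the neighbours are nonempty because
   operators preserve the length. *)
apply: strict_at_ext s9 => // i [[|b v] y] // H; exfalso.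
have [_ _ h3 h4] := tensor_at (swd (a :: u)) (sn x).
have bad (o : option (seq nat)) : (forall w, o = Some w -> size w = (size u).+1) ->
  omap (fun c => (c, x)) o <> Some ([::], y) 
  by case: o => [w|] //= /(_ w erefl) sz [Ew _]; rewrite Ew in sz.
have bad' (o : option nat) : omap (fun c => (a :: u, c)) o <> Some ([::], y) by case: o.
move: H; rewrite h3 h4 => -[]; case: ifP => _; try exact: bad'; apply: bad => w.
- exact: words_size_f.
- exact: words_size_e.
Qed.

Fixpoint pass_all (u w : seq nat) : seq nat * seq nat :=
  if w is x :: w' then
    let p := pass u x in
    (p.1 :: (pass_all p.2 w').1, (pass_all p.2 w').2)
  else ([::], u).

Lemma pass_all_inj u v w z : pass_all u w = pass_all v z -> u = v /\ w = z.
Proof.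
elim: w u v z => [|x w IH] u v [|y z] //=; first by case.
move=> [E1 E2 E3].
have [Eu ->] : (pass u x).2 = (pass v y).2 /\ w = z.
  by apply: IH; rewrite [LHS]surjective_pairing [RHS]surjective_pairing E2 E3.
have /pass_inj[-> ->] // : pass u x = pass v y.
by rewrite [LHS]surjective_pairing [RHS]surjective_pairing E1 Eu.
Qed.

Lemma pass_all_disjoint u w : (forall x, x \in w -> x \notin u) -> pass_all u w = (w, u).
Proof.
elim: w => //= x w IH h; rewrite pass_notin ?h ?mem_head //= IH // => y hy.
by rewrite h // inE hy orbT.
Qed.

Lemma pass_all_strict_at u w :
  strict_at (tensor (dual words) words) (tensor words (dual words))
    (fun p => pass_all p.1 p.2) (u, w).
Proof.
have sn := natural_seminormal; have snd := dual_seminormal sn.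
have sw := words_seminormal; have swd := dual_seminormal sw.
elim: w u => [|x w IH] u.
  have [h1 h2 h3 h4] := tensor_at (swd u) (sw [::]).
  have [k1 k2 k3 k4] := tensor_at (sw [::]) (swd u).
  have e0 i : neps words i [::] = 0 by [].
  have p0 i : nphi words i [::] = 0 by [].
  split=> [|i|i|i|i]; rewrite [pass_all _ _]/=.
  - by rewrite /= addrC.
  - by rewrite h1 k1 e0 p0 subn0 addn0.
  - by rewrite h2 k2 e0 p0 addn0 subn0.
  - rewrite h3 k3 e0 p0 leqn0 leq0n.
    by case: (sn_eP (swd u) i) => [[-> ->]|[c [-> h]]] //=; rewrite gtn_eqF.
  - rewrite h4 k4 e0 p0 ltn0.
    by case: (sn_fP (swd u) i) => [[-> ->]|[c [-> ->]]].
have s1 : strict_at (tensor (dual words) words)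
    (tensor (dual words) (tensor natural words))
    (fun p => (p.1, (head x p.2, behead p.2))) (u, x :: w).
  exact: (tensor_strict_at (id_strict_at (dual words) u) (uncons_strict_at natural x x w)).
have s2 := strict_at_comp s1 (assoc_inv_strict_at (swd u) (sn x) (sw w)).
have s3 : strict_at (tensor (tensor (dual words) natural) words)
    (tensor (tensor natural (dual words)) words)
    (fun p => (pass p.1.1 p.1.2, p.2)) ((u, x), w).
  exact: (tensor_strict_at (pass_strict_at u x) (id_strict_at _ _)).
have {}s3 := strict_at_comp s2 s3.
case Ep : (pass u x) => [x2 u2].
have s4 : strict_at (tensor (tensor natural (dual words)) words)
    (tensor natural (tensor (dual words) words))
    (fun p => (p.1.1, (p.1.2, p.2))) (pass u x, w).
  by rewrite Ep; apply: (assoc_strict_at (sn x2) (swd u2)).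
have {}s4 := strict_at_comp s3 s4.
have s5 := strict_at_comp s4 (tensor_strict_at (id_strict_at natural (pass u x).1)
  (IH (pass u x).2)).
case Eq : (pass_all (pass u x).2 w) => [w3 u3].
have s6 : strict_at (tensor natural (tensor words (dual words)))
    (tensor (tensor natural words) (dual words))
    (fun p => ((p.1, p.2.1), p.2.2)) ((pass u x).1, pass_all (pass u x).2 w).
  by rewrite Eq; apply: assoc_inv_strict_at.
have {}s6 := strict_at_comp s5 s6.
have s7 := strict_at_comp s6 (tensor_strict_at
  (cons_strict natural ((pass u x).1, (pass_all (pass u x).2 w).1))
  (id_strict_at (dual words) _)).
apply: strict_at_ext s7 => // i [v [|b z]] // H; exfalso.
have [_ _ h3 h4] := tensor_at (swd u) (sw (x :: w)).
have bad (o : option (seq nat)) : (forall w', o = Some w' -> size w' = (size w).+1) ->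
  omap (fun c => (u, c)) o <> Some (v, [::]) 
  by case: o => [w'|] //= /(_ w' erefl) sz [_ Ew]; rewrite Ew in sz.
have bad' (o : option (seq nat)) : omap (fun c => (c, x :: w)) o <> Some (v, [::]) by case: o.
move: H; rewrite h3 h4 => -[]; case: ifP => _; try exact: bad'; apply: bad => w'.
- exact: words_size_e.
- exact: words_size_f.
Qed.

(** * Components and the final isomorphism *)

Lemma connected_transfer (T T' W : Type) (C : crystal T) (C' : crystal T')
    (D : crystal W) f g b0 c0 b : strict C D f -> strict C' D g -> f b0 = g c0 ->
  connected C b0 b -> exists2 c, connected C' c0 c & f b = g c.
Proof.
move=> sf sg E0; elim=> [|i b1 b2 _ [c1 hc1 E1] h|i b1 b2 _ [c1 hc1 E1] h].
- by exists c0 => //; apply: connected_refl.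
- have := strict_e (sf b1) i; rewrite h E1 (strict_e (sg c1)).
  case hc: (ke C' i c1) => [c2|] //= [E2]; exists c2 => //.
  exact: connected_e hc1 hc.
- have := strict_f (sf b1) i; rewrite h E1 (strict_f (sg c1)).
  case hc: (kf C' i c1) => [c2|] //= [E2]; exists c2 => //.
  exact: connected_f hc1 hc.
Qed.

Lemma omap_inj (T T' : Type) (f : T -> T') : injective f -> injective (omap f).
Proof. by move=> fI [a|] [b|] //= [/fI->]. Qed.

Lemma strict_factor (T T' W : Type) (C : crystal T) (C' : crystal T')
    (D : crystal W) f g h : strict C D f -> strict C' D g -> injective g ->
  (forall b, g (h b) = f b) -> strict C C' h.
Proof.
move=> sf sg gI E b; split=> [|i|i|i|i].
- by rewrite -(strict_wt (sg (h b))) E (strict_wt (sf b)).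
- by rewrite -(strict_eps (sg (h b))) E (strict_eps (sf b)).
- by rewrite -(strict_phi (sg (h b))) E (strict_phi (sf b)).
- apply: (omap_inj gI); rewrite -(strict_e (sg (h b))) E (strict_e (sf b)).
  by case: (ke C i b) => //= c; rewrite E.
- apply: (omap_inj gI); rewrite -(strict_f (sg (h b))) E (strict_f (sf b)).
  by case: (kf C i b) => //= c; rewrite E.
Qed.

(** Strict embeddings into a common crystal [D] let paths be transferred in both directions. As [C]
    is connected, its image in [D] is that of the component of [c0]. *)
Lemma component_iso (T T' W : Type) (C : crystal T) (C' : crystal T')
    (D : crystal W) f g b0 c0 : strict C D f -> injective f ->
  strict C' D g -> injective g -> f b0 = g c0 ->
  (forall b, connected C b0 b) ->
  exists h : T -> component C' c0, bijective h /\ strict C (component_crystal C' c0) h.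
Proof.
move=> sf fI sg gI E0 conn.
have /choice[h hE] : forall b, exists c : component C' c0, g (proj1_sig c) = f b.
  move=> b; have [c hc E] := connected_transfer sf sg E0 (conn b).
  by exists (exist _ c hc).
exists h; split; last first.
  apply: (@strict_factor _ _ _ _ _ _ f (fun c => g (proj1_sig c))) => //.
    move=> c; apply: strict_at_comp (sg _); exact: sval_component_strict.
  by move=> x y E; apply: component_inj; apply: gI E.
have surj : forall c, exists b, h b = c.
  move=> [c hc]; have [b _ E] := connected_transfer sg sf (esym E0) hc.
  by exists b; apply: component_inj; apply: gI; rewrite hE /= E.
have [k kE] := choice surj; exists k => // b.
by apply: fI; rewrite -!hE kE.
Qed.

Section MixedTensor.
Variables mu nu : partition.

Let L := tensor (dual (sst_crystal nu)) (sst_crystal mu).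

Lemma mixed_seminormal : seminormal L.
Proof.
apply: tensor_seminormal; last exact: sst_seminormal.
apply: dual_seminormal; exact: sst_seminormal.
Qed.

Lemma reading_ke la i (T T' : SST la) : ke (sst_crystal la) i T = Some T' ->
  exists u v, reading (val T) = u ++ i.+1 :: v /\ reading (val T') = u ++ i :: v.
Proof.
move=> h; have := strict_e (reading_strict T) i; rewrite h /=.
by case/words_ke_split => u [v [-> -> _ _]]; exists u, v.
Qed.

Lemma reading_kf la i (T T' : SST la) : kf (sst_crystal la) i T = Some T' ->
  exists u v, reading (val T) = u ++ i :: v /\ reading (val T') = u ++ i.+1 :: v.
Proof.
move=> h; have := strict_f (reading_strict T) i; rewrite h /=.
by case/words_kf_split => u [v [-> -> _ _]]; exists u, v.
Qed.

Lemma lowest_bounds n x : plength nu <= n -> x \in reading (val (lowest nu n)) ->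
  n - plength nu <= x < n.
Proof.
move=> hn; rewrite reading_lowest => /mem_fcols[j [k [_ hk ->]]].
have : conj_part nu j <= plength nu by apply: count_size.
by rewrite /lowest_entry; lia.
Qed.

Lemma highest_bound x : x \in reading (val (highest mu)) -> x < plength mu.
Proof.
rewrite reading_highest => /mem_fcols[j [k [_ hk ->]]].
exact: leq_trans hk (count_size _ _).
Qed.

Lemma sst_neps_notin la (T : SST la) i : i.+1 \notin reading (val T) ->
  neps (sst_crystal la) i T = 0.
Proof. by rewrite -(strict_neps i (reading_strict T)); apply: words_eps_notin. Qed.

(* Raising moves the letters of the dual factor up towards n and those of the
   other factor down; as the two ranges of letters stay apart, the process can
   only stop at the lowest and the highest tableau. *)
Lemma mixed_connected_lowest n m (S : SST nu) (T : SST mu) :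
  (forall x, x \in reading (val S) -> x < n) ->
  (forall x, x \in reading (val T) -> x < m) -> m + plength nu <= n ->
  connected L (S, T) (lowest nu n, highest mu).
Proof.
move=> + + hmn.
(* Raising moves dual letters up and the other letters down, hence the distances to [n] on one side
   and the letters themselves on the other. Restricting to i+1 < n keeps the dual letters below
   [n]. *)
pose ms (S : SST nu) := sumn [seq n - x | x <- reading (val S)].
pose mt (T : SST mu) := sumn (reading (val T)).
have [k] := ubnP (ms S + mt T); elim: k S T => // k IH S T le_k bS bT.
have snS := @sst_seminormal nu S; have snT := @sst_seminormal mu T.
case: (pselect (exists i, i.+1 < n /\ ke L i (S, T) <> None)) => [[i [hi]]|none].
  case h: (ke L i (S, T)) => [[S' T']|] // _.
  apply: connected_trans (connected_e (connected_refl _ _) h) _.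
  move: h; rewrite (tensor_ke i (dual_seminormal_at snS) snT); case: ifP => _.
    change (ke (dual (sst_crystal nu)) i S) with (kf (sst_crystal nu) i S).
    case h: (kf (sst_crystal nu) i S) => [S1|] //= [<- <-].
    have [u [v [E E']]] := reading_kf h; apply: IH => //.
      move: le_k; rewrite /ms E E' !map_cat !sumn_cat /=; lia.
    move=> x; rewrite E' mem_cat inE => hx.
    case/or3P: hx => [hx|/eqP ->|hx] //; apply: bS; rewrite E mem_cat ?hx //.
    by rewrite inE hx !orbT.
  case h: (ke (sst_crystal mu) i T) => [T1|] //= [<- <-].
  have [u [v [E E']]] := reading_ke h; apply: IH => //.
    move: le_k; rewrite /mt E E' !sumn_cat /=; lia.
  move=> x; rewrite E' mem_cat inE => hx.
  case/or3P: hx => [hx|/eqP ->|hx]; last 2 first.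
  - by apply: ltnW; apply: bT; rewrite E mem_cat mem_head orbT.
  - by apply: bT; rewrite E mem_cat inE hx !orbT.
  - by apply: bT; rewrite E mem_cat hx.
have nke i : i.+1 < n -> kf (sst_crystal nu) i S = None /\
    neps (sst_crystal mu) i T <= neps (sst_crystal nu) i S.
  move=> hi; have : ke L i (S, T) = None.
    by apply: contrapT => h; apply: none; exists i.
  rewrite (tensor_ke i (dual_seminormal_at snS) snT).
  change (nphi (dual (sst_crystal nu)) i S) with (neps (sst_crystal nu) i S).
  change (ke (dual (sst_crystal nu)) i S) with (kf (sst_crystal nu) i S).
  case: leqP => h; first by case: (kf (sst_crystal nu) i S).
  by case: (sn_eP snT i) => [[_ h0]|[c [-> _]]] //; rewrite h0 in h.
have ES : S = lowest nu n by apply: sst_lowest bS _ => i /nke[].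
suff ET : T = highest mu by rewrite ES ET; apply: connected_refl.
(* For i+1 >= m the letter i+1 does not occur in [T]. Otherwise i+1 lies below all letters of the
   lowest tableau [S], whose epsilon is then 0 and bounds that of [T]. *)
apply: sst_hw => i; apply/(sn_e0 snT); case: (leqP m i.+1) => hm.
  by apply: sst_neps_notin; apply/negP => /bT; rewrite ltnNge hm.
have hi : i.+1 < n by lia.
have [_] := nke i hi; rewrite ES (@sst_neps_notin nu (lowest nu n)) ?leqn0 => [/eqP //|].
have hn : plength nu <= n by lia.
by apply/negP => /(lowest_bounds hn); lia.
Qed.

Let base : SST nu * SST mu := (lowest nu (plength mu + plength nu), highest mu).

Lemma seq_ubound (s : seq nat) : exists n, forall x, x \in s -> x < n.
Proof.
exists (sumn s).+1 => x; rewrite ltnS; elim: s => //= a s IH.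
by rewrite inE => /orP[/eqP ->|/IH]; lia.
Qed.

Lemma mixed_connected b : connected L base b.
Proof.
case: b => S T; have [n1 b1] := seq_ubound (reading (val S)).
have [m1 b2] := seq_ubound (reading (val T)).
(* Large enough for the base point as well, so that both elements lead to the same extremal one. *)
pose m := m1 + plength mu; pose n := n1 + m + plength nu.
have h1 : connected L (S, T) (lowest nu n, highest mu).
  apply: (@mixed_connected_lowest n m) => [x /b1|x /b2|]; rewrite /n /m; lia.
have h2 : connected L base (lowest nu n, highest mu).
  apply: (@mixed_connected_lowest n m) => [x hx|x hx|]; rewrite /n /m.
  - have := @lowest_bounds (plength mu + plength nu) x; rewrite leq_addl => /(_ isT hx); lia.
  - by have := highest_bound hx; lia.
  - by lia.
exact: connected_trans h2 (connected_sym mixed_seminormal h1).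
Qed.

Lemma mixed_iso : exists h : SST nu * SST mu -> B2 mu nu,
  bijective h /\ strict L (B2_crystal mu nu) h.
Proof.
pose f (p : SST nu * SST mu) := pass_all (reading (val p.1)) (reading (val p.2)).
pose g (p : SST mu * SST nu) := (reading (val p.1), reading (val p.2)).
apply: (@component_iso _ _ _ L (B2_tensor mu nu) (tensor words (dual words)) f g base).
- move=> [S T].
  exact: (strict_at_comp
    (tensor_strict_at (dual_strict_at (reading_strict S)) (reading_strict T))
    (pass_all_strict_at (reading (val S)) (reading (val T)))).
- by move=> [S T] [S' T'] /pass_all_inj[/= /reading_inj -> /reading_inj ->].
- move=> [T S].
  exact: (tensor_strict_at (reading_strict T) (dual_strict_at (reading_strict S))).
- by move=> [T S] [T' S'] [/reading_inj -> /reading_inj ->].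
(* At the base point the dual letters are at least l(mu) and the others less, so the crossing is a
   plain exchange. *)
- rewrite /f /g /=; apply: pass_all_disjoint => x /highest_bound hx.
  apply/negP => /(lowest_bounds (leq_addl _ _)); lia.
- exact: mixed_connected.
Qed.

End MixedTensor.

Definition mixed (mu nu : partition) : SST nu * SST mu -> B2 mu nu :=
  projT1 (cid (mixed_iso mu nu)).

Lemma mixed_bij mu nu : bijective (@mixed mu nu).
Proof. by have [] := projT2 (cid (mixed_iso mu nu)). Qed.

Lemma mixed_strict mu nu : strict (tensor (dual (sst_crystal nu)) (sst_crystal mu))
  (B2_crystal mu nu) (@mixed mu nu).
Proof. by have [] := projT2 (cid (mixed_iso mu nu)). Qed.

Lemma B2_seminormal mu nu : seminormal (B2_crystal mu nu).
Proof.
move=> b; apply: (strict_inj_seminormal (@sval_component_strict _ _ _)).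
  exact: component_inj.
apply: tensor_seminormal; first exact: sst_seminormal.
apply: dual_seminormal; exact: sst_seminormal.
Qed.

(** The first pair comes from the dual matrix and supplies [nu], whence the exchange of the two
    shapes in the index. *)
Definition regroup (p : tableau_pair * tableau_pair) : PW :=
  let: (x, y) := p in
  existT (fun mn : partition * partition => (B2 mn.1 mn.2 * B2 mn.1 mn.2)%type)
    (projT1 y, projT1 x)
    (mixed ((projT2 x).1, (projT2 y).1), mixed ((projT2 x).2, (projT2 y).2)).

Lemma regroup_bij : bijective regroup.
Proof.
have ex (mn : partition * partition) : exists k : B2 mn.1 mn.2 -> SST mn.2 * SST mn.1,
      cancel (@mixed mn.1 mn.2) k /\ cancel k (@mixed mn.1 mn.2).
  by have [k h1 h2] := mixed_bij mn.1 mn.2; exists k.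
pose k mn := projT1 (cid (ex mn)).
have kE mn : cancel (@mixed mn.1 mn.2) (k mn) /\ cancel (k mn) (@mixed mn.1 mn.2).
  exact: projT2 (cid (ex mn)).
exists (fun z : PW => let: existT mn (b, c) := z in
  (existT (fun la => (SST la * SST la)%type) mn.2 ((k mn b).1, (k mn c).1),
   existT (fun la => (SST la * SST la)%type) mn.1 ((k mn b).2, (k mn c).2))).
- move=> [[nu [a b]] [mu [c d]]] /=.
  by rewrite !(kE (mu, nu)).1.
- move=> [[mu nu] [b c]] /=; rewrite -!surjective_pairing.
  by rewrite !(kE (mu, nu)).2.
Qed.

Lemma strict_at_factor (T T1 T2 : Type) (C : crystal T) (C1 : crystal T1)
    (C2 : crystal T2) f g h b : strict_at C C1 f b -> strict_at C C2 g b ->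
  (forall c, h (f c) = g c) -> strict_at C1 C2 h (f b).
Proof.
move=> sf sg E; split=> [|i|i|i|i]; rewrite E.
- by rewrite (strict_wt sg) (strict_wt sf).
- by rewrite (strict_eps sg) (strict_eps sf).
- by rewrite (strict_phi sg) (strict_phi sf).
- by rewrite (strict_e sg) (strict_e sf); case: (ke C i b) => //= c; rewrite E.
- by rewrite (strict_f sg) (strict_f sf); case: (kf C i b) => //= c; rewrite E.
Qed.

(** The first structure leaves the second tableaux [b] and [d] alone; with these fixed, [regroup] is
    [mixed] on the first ones. *)
Lemma regroup_strict_l :
  strict (tensor (dual pair_crystal_l) pair_crystal_l) PW_crystal_l regroup.
Proof.
move=> [[nu [a b]] [mu [c d]]].
have s1 := tensor_strict_at
  (dual_strict_at (@act_fst_strict _ _ (fun la => sst_crystal la) nu b a))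
  (@act_fst_strict _ _ (fun la => sst_crystal la) mu d c).
have s2 := strict_at_comp (@mixed_strict mu nu (a, c))
  (@act_fst_strict _ _ (fun mn => B2_crystal mn.1 mn.2) (mu, nu) (mixed (b, d)) _).
by apply: (strict_at_factor s1 s2) => -[].
Qed.

Lemma regroup_strict_r :
  strict (tensor (dual pair_crystal_r) pair_crystal_r) PW_crystal_r regroup.
Proof.
move=> [[nu [a b]] [mu [c d]]].
have s1 := tensor_strict_at
  (dual_strict_at (@act_snd_strict _ _ (fun la => sst_crystal la) nu a b))
  (@act_snd_strict _ _ (fun la => sst_crystal la) mu c d).
have s2 := strict_at_comp (@mixed_strict mu nu (b, d))
  (@act_snd_strict _ _ (fun mn => B2_crystal mn.1 mn.2) (mu, nu) (mixed (a, c)) _).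
by apply: (strict_at_factor s1 s2) => -[].
Qed.

Lemma PW_bicrystal : is_bicrystal PW_crystal_l PW_crystal_r.
Proof.
apply: (@sum_bicrystal _ _ (fun mn => B2_crystal mn.1 mn.2)) => mn.
exact: B2_seminormal.
Qed.

Definition rsk_pair (p : Mat * Mat) : PW := regroup (rsk p.1, rsk p.2).

Lemma rsk_pair_bij : bijective rsk_pair.
Proof.
have [k h1 h2] := rsk_bij.
apply: (@bij_comp _ _ _ regroup (fun p : Mat * Mat => (rsk p.1, rsk p.2)) regroup_bij).
by exists (fun q => (k q.1, k q.2)) => -[a b] /=; rewrite ?h1 ?h2.
Qed.

Lemma rsk_pair_strict_l : strict bimat_crystal PW_crystal_l rsk_pair.
Proof.
move=> [A B]; exact: (strict_at_comp
  (tensor_strict_at (dual_strict_at (rsk_strict_l A)) (rsk_strict_l B))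
  (regroup_strict_l _)).
Qed.

Lemma rsk_pair_strict_r : strict bimat_crystal_t PW_crystal_r rsk_pair.
Proof.
move=> [A B]; exact: (strict_at_comp
  (tensor_strict_at (dual_strict_at (rsk_strict_r A)) (rsk_strict_r B))
  (regroup_strict_r _)).
Qed.

Lemma commuting_transfer (T T' : Type) (f : T -> T') o1 o2 (p1 p2 : T' -> option T') :
  injective f -> (forall b, p1 (f b) = omap f (o1 b)) ->
  (forall b, p2 (f b) = omap f (o2 b)) -> commuting p1 p2 -> commuting o1 o2.
Proof.
move=> fI h1 h2 h b; apply: (omap_inj fI); have := h (f b); rewrite h1 h2.
case: (o1 b) => [b1|]; case: (o2 b) => [b2|] //=; by rewrite ?h1 ?h2.
Qed.

Lemma bicrystal_transfer (T T' : Type) (C D : crystal T) (C' D' : crystal T') f :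
  injective f -> strict C C' f -> strict D D' f -> seminormal C' -> seminormal D' ->
  is_bicrystal C' D' -> is_bicrystal C D.
Proof.
move=> fI sC sD snC snD [_ _ h1 h2 h3 h4]; split.
- by apply: seminormal_crystal => b; apply: (strict_inj_seminormal sC fI).
- by apply: seminormal_crystal => b; apply: (strict_inj_seminormal sD fI).
- move=> i j; apply: (commuting_transfer fI _ _ (h1 i j)) => b.
    exact: (strict_e (sC b)).
  exact: (strict_e (sD b)).
- move=> i j; apply: (commuting_transfer fI _ _ (h2 i j)) => b.
    exact: (strict_e (sC b)).
  exact: (strict_f (sD b)).
- move=> i j; apply: (commuting_transfer fI _ _ (h3 i j)) => b.
    exact: (strict_f (sC b)).
  exact: (strict_e (sD b)).
- move=> i j; apply: (commuting_transfer fI _ _ (h4 i j)) => b.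
    exact: (strict_f (sC b)).
  exact: (strict_f (sD b)).
Qed.

Theorem corollary5p7 (Theta : BU -> Mat * Mat)
    (hTheta : crystal_iso BU_crystal bimat_crystal Theta) :
  is_bicrystal BU_crystal (pullback Theta bimat_crystal_t) /\
  is_bicrystal PW_crystal_l PW_crystal_r /\
  exists f : BU -> PW,
    bicrystal_iso BU_crystal (pullback Theta bimat_crystal_t)
                  PW_crystal_l PW_crystal_r f.
Proof.
have bT := iso_bij hTheta.
pose f b := rsk_pair (Theta b).
have bf : bijective f by apply: bij_comp rsk_pair_bij bT.
have sl : strict BU_crystal PW_crystal_l f.
  by move=> b; apply: strict_at_comp (iso_strict hTheta b) (rsk_pair_strict_l _).
have sr : strict (pullback Theta bimat_crystal_t) PW_crystal_r f.
  move=> b; apply: strict_at_comp (pullback_bij_strict _ bT b) _.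
  exact: rsk_pair_strict_r.
split; last first.
  split; first exact: PW_bicrystal.
  by exists f; split; apply: strict_bij_iso.
(* The axioms and the commutation on the left are read off from the right, where the two structures
   act on separate factors. *)
apply: (bicrystal_transfer (bij_inj bf) sl sr _ _ PW_bicrystal).
- apply: (@sum_fst_seminormal _ _ (fun mn => B2_crystal mn.1 mn.2)) => mn.
  exact: B2_seminormal.
- apply: (@sum_snd_seminormal _ _ (fun mn => B2_crystal mn.1 mn.2)) => mn.
  exact: B2_seminormal.
Qed.
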